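(* Let $d\in\{1,2,3\}$. For any smooth function $f$ on $\mathbb{T}^d\times\mathbb{R}^d$, the functionals $\mathcal{T}$ and $\mathcal{U}$ satisfy $$[[\mathcal{T},\mathcal{U}],\mathcal{U}](f) = 2\,m(f)\,\mathcal{U}(f)+\mathcal{V}(f),$$ where $$m(f)=\frac{1}{(2\pi)^d}\int_{\mathbb{T}^d\times\mathbb{R}^d} f(x,v)\,\mathrm{d}x\,\mathrm{d}v$$ is a constant of motion of the Vlasov--Poisson equation $\partial_t f+v\cdot\partial_x f-\partial_x\phi(f)\cdot\partial_v f=0$, and $$\mathcal{V}(f)=-\int_{\mathbb{T}^d}\Delta_x\phi(f)(x)\,|\partial_x\phi(f)(x)|^2\,\mathrm{d}x .$$ In dimension $d=1$ one has $\mathcal{V}(f)=0$, and in any dimension $d\ge 1$ the relation $$[[[\mathcal{T},\mathcal{U}],\mathcal{U}],\mathcal{U}](f)=0$$ holds for all smooth functions $f$.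
   Context: $\mathbb{T}^d=\mathbb{R}^d/(2\pi\mathbb{Z}^d)$. Points of phase space are $(x,v)\in\mathbb{T}^d\times\mathbb{R}^d$; $\partial_x,\partial_v$ denote gradients in $x$ and $v$, and $\Delta_x=\sum_{i=1}^d\partial_{x_i}^2$. ''Smooth'' function $f=f(x,v)$: $f$ is real-valued, $C^\infty$, and $v^m\partial_x^p\partial_v^q f\in L^2(\mathbb{T}^d\times\mathbb{R}^d)$ for all multi-indices $m,p,q\in\mathbb{N}^d$. Electric potential: $\phi(f)(x)=-\Delta_x^{-1}\Big[\int_{\mathbb{R}^d}f(x,v)\,\mathrm{d}v-\frac{1}{(2\pi)^d}\int_{\mathbb{T}^d\times\mathbb{R}^d}f(x,v)\,\mathrm{d}x\,\mathrm{d}v\Big]$, where $\Delta_x$ is inverted on functions on $\mathbb{T}^d$ with zero average. Electric field: $E(f)=-\partial_x\phi(f)$. Functionals: $\mathcal{T}(f)=\int_{\mathbb{T}^d\times\mathbb{R}^d}\frac{|v|^2}{2}f(x,v)\,\mathrm{d}x\,\mathrm{d}v$ and $\mathcal{U}(f)=\int_{\mathbb{T}^d}\frac12|E(f)(x)|^2\,\mathrm{d}x$. Fréchet derivative of a functional $\mathcal{G}$ at $f$: the function (or distribution) $\frac{\delta\mathcal{G}}{\delta f}(f)$ of $(x,v)$ with $\mathcal{G}(f+\delta f)-\mathcal{G}(f)=\int_{\mathbb{T}^d\times\mathbb{R}^d}\frac{\delta\mathcal{G}}{\delta f}(f)\,\delta f\,\mathrm{d}x\,\mathrm{d}v+\mathcal{O}(\delta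 f^2)$ for all smooth variations $\delta f$. Microcanonical bracket of functions of $(x,v)$: $\{f,g\}=\partial_x f\cdot\partial_v g-\partial_v f\cdot\partial_x g$. Poisson bracket of functionals: $[\mathcal{H},\mathcal{G}](f)=\int_{\mathbb{T}^d\times\mathbb{R}^d}\frac{\delta\mathcal{H}}{\delta f}(f)\,\Big\{\frac{\delta\mathcal{G}}{\delta f}(f),f\Big\}\,\mathrm{d}x\,\mathrm{d}v$, which is again a functional of $f$, so brackets can be iterated. *)

(* Defs.v *)
From HB Require Import structures.
From mathcomp Require Import all_boot all_order all_algebra.
From mathcomp Require Import all_classical all_reals all_analysis.
Set Implicit Arguments. Unset Strict Implicit. Unset Printing Implicit Defensive.
Import Order.TTheory GRing.Theory Num.Theory.
Import numFieldNormedType.Exports.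
Local Open Scope classical_set_scope.
Local Open Scope ring_scope.

(* 'rV[R]_n carries the product sigma-algebra, generated by the coordinates. *)
Section row_measurable.
Context {R : realType} {n : nat}.

Definition row_coord (i : 'I_n) (x : 'rV[R]_n) : measurableTypeR R := x ord0 i.

Let row_set0 : g_sigma_preimage row_coord set0.
Proof. exact: sigma_algebra0. Qed.

Let row_setC A : g_sigma_preimage row_coord A -> g_sigma_preimage row_coord (~` A).
Proof. exact: sigma_algebraC. Qed.

Let row_bigcup (F : (set 'rV[R]_n)^nat) :
  (forall i, g_sigma_preimage row_coord (F i)) ->
  g_sigma_preimage row_coord (\bigcup_i F i).
Proof. exact: sigma_algebra_bigcup. Qed.

HB.instance Definition _ := @isMeasurable.Build
  (measure_tuple_display default_measure_display)
  'rV[R]_n (g_sigma_preimage row_coord) row_set0 row_setC row_bigcup.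

End row_measurable.

Lemma measurable_row_coord (R : realType) n (i : 'I_n) :
  measurable_fun [set: 'rV[R]_n] (row_coord i).
Proof.
move=> _ Y mY; rewrite setTI; apply: sub_sigma_algebra => /=.
rewrite -bigcup_seq/=; exists i => /=; first by rewrite mem_index_enum.
by exists Y => //; rewrite setTI.
Qed.

Lemma measurable_fun_row (R : realType) d (T : measurableType d) n
    (f : T -> 'rV[R]_n) :
  (forall i, measurable_fun [set: T] (row_coord i \o f)) ->
  measurable_fun [set: T] f.
Proof.
move=> mf; suff prefS : g_sigma_preimage (fun i => row_coord i \o f) `<=`
    (measurable : set (set T)).
  move: prefS; rewrite g_sigma_preimage_comp => prefS _ A mA.
  by apply: prefS; exists A.
apply: smallest_sub; first exact: sigma_algebra_measurable.
rewrite -bigcup_seq; apply: bigcup_sub => i _ A [B mB <-].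
exact: mf.
Qed.

Section power_measure.
Context {R : realType}.
Local Notation RR := (measurableTypeR R).

Definition row_cons n (p : RR * 'rV[R]_n) : 'rV[R]_n.+1 :=
  row_mx (const_mx p.1 : 'rV[R]_1) p.2.

Let row_uncons n (x : 'rV[R]_n.+1) : RR * 'rV[R]_n :=
  (x ord0 ord0, rsubmx (x : 'rV[R]_(1 + n))).

Let row_consK n : cancel (@row_cons n) (@row_uncons n).
Proof.
move=> [a x]; rewrite /row_uncons /row_cons /=; congr pair; last exact: row_mxKr.
have -> : (ord0 : 'I_n.+1) = lshift n (ord0 : 'I_1) by exact/val_inj.
exact: (etrans (row_mxEl (const_mx a : 'rV[R]_1) x _ _) (mxE _ _ _ _)).
Qed.

Lemma measurable_row_cons n : measurable_fun setT (@row_cons n).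
Proof.
apply: measurable_fun_row => i.
case: (split_ordP (i : 'I_(1 + n))) => j ->.
  rewrite (_ : _ \o _ = fst); first exact: measurable_fst.
  apply/funext => -[a x].
  exact: (etrans (row_mxEl (const_mx a : 'rV[R]_1) x _ _) (mxE _ _ _ _)).
rewrite (_ : _ \o _ = row_coord j \o snd).
  by apply: measurableT_comp; [exact: measurable_row_coord|exact: measurable_snd].
apply/funext => -[a x].
exact: (row_mxEr (const_mx a : 'rV[R]_1) x).
Qed.

Let measurable_row_uncons n : measurable_fun setT (@row_uncons n).
Proof.
apply/measurable_fun_pairP; split; first exact: (measurable_row_coord ord0).
apply: measurable_fun_row => i.
rewrite (_ : _ \o _ = row_coord (rshift 1 i : 'I_n.+1)).
  exact: measurable_row_coord.
by apply/funext => x; rewrite /row_coord /= mxE.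
Qed.

(* [power_measure mu n] is the n-fold product of [mu], carried from
   R * 'rV[R]_n to 'rV[R]_n.+1 at each step. *)
Variable mu : {sigma_finite_measure set RR -> \bar R}.

Section step.
Variables (n : nat) (m : {sigma_finite_measure set 'rV[R]_n -> \bar R}).

Definition power_measure_step : set 'rV[R]_n.+1 -> \bar R :=
  pushforward (mu \x m)%E (@row_cons n).

Let step0 : power_measure_step set0 = 0%E.
Proof. by rewrite /power_measure_step /pushforward preimage_set0 measure0. Qed.

Let step_ge0 A : (0 <= power_measure_step A)%E.
Proof. exact: (measure_ge0 (mu \x m)%E). Qed.

Let step_sigma_additive : semi_sigma_additive power_measure_step.
Proof.
exact: (@measure_semi_sigma_additive _ _ _ (measure_function_pushforward__canonical__measure_function_Measure
  (mu \x m)%E (@measurable_row_cons n))).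
Qed.

HB.instance Definition _ := isMeasure.Build _ _ _ power_measure_step
  step0 step_ge0 step_sigma_additive.

Let step_sigma_finite : sigma_finite setT power_measure_step.
Proof.
have /sigma_finiteP[F [TF ndF Foo]] := sigma_finiteT mu.
have /sigma_finiteP[G [TG ndG Goo]] := sigma_finiteT m.
exists (fun k => @row_uncons n @^-1` (F k `*` G k)).
  rewrite -preimage_bigcup (_ : \bigcup_k _ = setT) ?preimage_setT//.
  rewrite -setXTT TF TG predeqE => -[x y]; split.
    by move=> [k _ []/= ? ?]; split; exists k.
  move=> [/= [i _ Fix] [j _ Gjy]]; exists (maxn i j) => //; split.
  - by move: x Fix; exact/subsetPset/ndF/leq_maxl.
  - by move: y Gjy; exact/subsetPset/ndG/leq_maxr.
move=> k; have [mFk Fk] := Foo k; have [mGk Gk] := Goo k; split.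
  rewrite -[X in measurable X]setTI; apply: measurable_row_uncons => //.
  exact: measurableX.
rewrite /power_measure_step /pushforward -comp_preimage.
rewrite (_ : _ \o _ = id); last by apply/funext => x; exact: row_consK.
by rewrite preimage_id product_measure1E// lte_mul_pinfty// ge0_fin_numE.
Qed.

HB.instance Definition _ := Measure_isSigmaFinite.Build _ _ _ power_measure_step
  step_sigma_finite.

End step.

Fixpoint power_measure n : {sigma_finite_measure set 'rV[R]_n -> \bar R} :=
  match n with
  | 0 => dirac (0 : 'rV[R]_0)
  | n'.+1 => power_measure_step (power_measure n')
  end.

End power_measure.

Section circle_measure.
Context {R : realType}.

Definition circle_measure : set (measurableTypeR R) -> \bar R :=
  mrestr lebesgue_measure (measurable_itv `[0, 2 * pi : R]).

HB.instance Definition _ := Measure.on circle_measure.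

Let circle_measure_fin : fin_num_fun circle_measure.
Proof.
move=> U mU; rewrite ge0_fin_numE; last exact: measure_ge0.
rewrite /circle_measure /mrestr.
rewrite (@le_lt_trans _ _ (lebesgue_measure `[0, 2 * pi : R]%classic))//.
  by apply: le_measure; rewrite ?inE//; apply: measurableI.
by rewrite lebesgue_measure_itv /=; case: ifP => //; rewrite ltry.
Qed.

HB.instance Definition _ :=
  Measure_isFinite.Build _ _ _ circle_measure circle_measure_fin.

End circle_measure.

(* Functions on T^d are functions on 'rV[R]_d that are 2pi-periodic in every
   coordinate; they are integrated over the fundamental cell [0, 2pi]^d. *)
Section measures.
Context {R : realType} (d : nat).

Definition space_measure : {sigma_finite_measure set 'rV[R]_d -> \bar R} :=
  power_measure circle_measure d.

Definition velocity_measure : {sigma_finite_measure set 'rV[R]_d -> \bar R} :=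
  power_measure lebesgue_measure d.

Definition phase_measure :
    {measure set ('rV[R]_d * 'rV[R]_d)%type -> \bar R} :=
  (space_measure \x velocity_measure)%E.

End measures.

(* Iterated directional derivatives of all orders exist and are differentiable
   (hence continuous); on a finite-dimensional V this is C^oo. *)
Definition Cinfty {R : realType} {V : normedModType R} (f : V -> R) : Prop :=
  forall (s : seq V) (z : V),
    differentiable (foldr (fun u (g : V -> R) => 'D_u g) f s) z.

Section vlasov_poisson.
Context {R : realType} {d : nat}.
Local Notation V := 'rV[R]_d.
Local Notation phase := ('rV[R]_d * 'rV[R]_d)%type.
Implicit Types (f g h : phase -> R) (u : V -> R) (m p q : 'I_d -> nat).
Implicit Types (G H : (phase -> R) -> R).

Definition ebase (i : 'I_d) : V := delta_mx ord0 i.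
Definition dX (i : 'I_d) f : phase -> R := 'D_((ebase i, 0) : phase) f.
Definition dV (i : 'I_d) f : phase -> R := 'D_((0, ebase i) : phase) f.
Definition partial (i : 'I_d) u : V -> R := 'D_(ebase i) u.

Definition multi_derive (D : 'I_d -> (phase -> R) -> (phase -> R)) p f :
    phase -> R :=
  foldr (fun i g => iter (p i) (D i) g) f (enum 'I_d).

(* v^m d_x^p d_v^q f *)
Definition weighted m p q f (z : phase) : R :=
  (\prod_(i < d) z.2 ord0 i ^+ m i) *
  multi_derive dX p (multi_derive dV q f) z.

Definition space_periodic u : Prop :=
  forall i x, u (x + (2 * pi) *: ebase i) = u x.

Definition phase_periodic f : Prop :=
  forall v, space_periodic (fun x => f (x, v)).

Definition smooth f : Prop :=
  [/\ Cinfty f, phase_periodic f &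
      forall m p q, weighted m p q f \in Lfun (phase_measure d) 2%:E].

(* The L^2 norms of the v^m d_x^p d_v^q f with all exponents at most N; these
   norms define the natural topology of the space of smooth functions. *)
Definition snorm (N : nat) f : R :=
  \sum_(m : {ffun 'I_d -> 'I_N.+1}) \sum_(p : {ffun 'I_d -> 'I_N.+1})
  \sum_(q : {ffun 'I_d -> 'I_N.+1})
    fine ('N[phase_measure d]_2%:E[EFin \o
      weighted (fun i => m i) (fun i => p i) (fun i => q i) f])%E.

Definition laplacian u (x : V) : R := \sum_(i < d) partial i (partial i u) x.

Definition is_inv_laplacian (g u : V -> R) : Prop :=
  [/\ Cinfty u, space_periodic u, \int[space_measure d]_x u x = 0 &
      forall x, laplacian u x = g x].

Definition inv_laplacian (g : V -> R) : V -> R :=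
  xget (fun=> 0) [set u | is_inv_laplacian g u].

Definition density f (x : V) : R := \int[velocity_measure d]_v f (x, v).

Definition mass f : R := ((2 * pi) ^+ d)^-1 * \int[phase_measure d]_z f z.

Definition potential f (x : V) : R :=
  - inv_laplacian (fun y => density f y - mass f) x.

Definition efield (i : 'I_d) f (x : V) : R := - partial i (potential f) x.

Definition kinetic f : R :=
  \int[phase_measure d]_z ((\sum_(i < d) z.2 ord0 i ^+ 2) / 2 * f z).

Definition electric f : R :=
  \int[space_measure d]_x (2^-1 * \sum_(i < d) efield i f x ^+ 2).

Definition cubic f : R :=
  - \int[space_measure d]_x
      (laplacian (potential f) x * \sum_(i < d) partial i (potential f) x ^+ 2).

(* O(df^2) is read in the topology of the smooth functions: a bound by the
   square of one of the norms [snorm N], uniform over small variations df.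
   Requiring h to be C^oo makes h unique and lets it enter [mbracket]. *)
Definition is_frechet G f h : Prop :=
  [/\ Cinfty h, phase_periodic h,
      forall df, smooth df ->
        (phase_measure d).-integrable setT (fun z => (h z * df z)%:E) &
      exists (N : nat) (C : R), forall df, smooth df -> snorm N df <= 1 ->
        `|G (f \+ df) - G f - \int[phase_measure d]_z (h z * df z)| <=
          C * snorm N df ^+ 2].

Definition frechet G f : phase -> R :=
  xget (fun=> 0) [set h | is_frechet G f h].

Definition mbracket f g (z : phase) : R :=
  \sum_(i < d) dX i f z * dV i g z - \sum_(i < d) dV i f z * dX i g z.

Definition bracket H G f : R :=
  \int[phase_measure d]_z (frechet H f z * mbracket (frechet G f) f z).

(* [frechet] and the real-valued integral are total; this says that
   [bracket H G f] does not rest on their default values. *)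
Definition bracket_defined H G f : Prop :=
  [/\ exists h, is_frechet H f h, exists g, is_frechet G f g &
      (phase_measure d).-integrable setT
        (fun z => (frechet H f z * mbracket (frechet G f) f z)%:E)].

(* Classical solutions on the time interval ]a, b[ that remain in the space of
   smooth functions, with norms bounded on compact time intervals. *)
Definition vlasov_poisson_solution (a b : R) (f : R -> phase -> R) : Prop :=
  [/\ forall t, a < t < b -> smooth (f t),
      forall (N : nat) (a' b' : R), a < a' -> b' < b ->
        exists C : R, forall t, a' <= t <= b' -> snorm N (f t) <= C &
      forall t z, a < t < b ->
        derivable (fun s => f s z) t 1 /\
        'D_1 (fun s => f s z) t + \sum_(i < d) z.2 ord0 i * dX i (f t) z
          - \sum_(i < d) partial i (potential (f t)) z.1 * dV i (f t) z = 0].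

(* J is a constant of motion of the Vlasov--Poisson equation. *)
Definition constant_of_motion (J : (phase -> R) -> R) : Prop :=
  forall (a b : R) (f : R -> phase -> R), vlasov_poisson_solution a b f ->
    forall s t, a < s < b -> a < t < b -> J (f s) = J (f t).

End vlasov_poisson.

(* Main.v *)
(* Write phi for the potential, rho for the density and J for the current of f.
   Integrating by parts in v gives
     [T,U](f) = - int dphi . J,
   whose derivative is - v . dphi + psi(x) with - Lap psi = div J.  Then
     [[T,U],U](f) = int rho |dphi|^2 = int (m - Lap phi) |dphi|^2 = 2 m U + V.
   The derivative of this functional depends on x only, and the derivative of U
   is phi(x), so the last bracket integrates d_v f over v and vanishes.

   - The Poisson equation is solved as a limit of its finite-difference
     approximations.  On the grid a Poincare inequality bounds the solution by
     the square-free differences of its Laplacian; this gives the Cauchy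
     property, and in the limit uniqueness and continuity of the solution
     operator.
   - A Sobolev inequality with square-free derivatives bounds v^t d_x^s d_v^r f
     by the norms of f; applied with the weights 1 + v_i^2 it gives the decay
     prod_i (1 + v_i^2)^-1, with which all integrals in v converge.
   - A derivative h is unique because, tested against h chi with chi a cutoff in
     v, it gives int (D^w (h chi))^2 = 0 for every w, whence h chi = 0 by the
     same Sobolev inequality.
   - The mass is conserved by differentiation under the integral. *)
From HB Require Import structures.
Require Import Defs.
From mathcomp Require Import all_boot all_order all_algebra.
From mathcomp Require Import all_classical all_reals all_analysis.
From mathcomp Require Import measurable_realfun lebesgue_integral_under ring lra.
Set Implicit Arguments. Unset Strict Implicit. Unset Printing Implicit Defensive.
Import Order.TTheory GRing.Theory Num.Theory.
Import numFieldNormedType.Exports.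
Local Open Scope classical_set_scope.
Local Open Scope ring_scope.

(** The functionals to be differentiated are polynomials in f of degree at most three, so each
    derivative is read off an exact expansion of G (f + df), and the remainder is an explicit
    integral. What is left is its size: sup bounds for the gradient of the potential, the density
    and the current of df, linear in one [snorm] of df. This is why the Poisson equation is needed
    with quantitative control in the sup norm.

    Square-free derivatives arise because a value is at most an average along one coordinate line
    plus the average of one derivative along that line; treating each coordinate once produces each
    subset of the coordinates once. In phase space the same mechanism is applied to squares.

    A bracket is known in closed form only at smooth f. Each one is therefore replaced by an
    explicit functional that agrees with it on smooth functions, and this functional is
    differentiated instead.

    Weights and derivatives are recorded by words of coordinates rather than multi-indices, and the
    constants of the linear estimates are chosen before f. *)

Lemma cvg_bigsum (R : realType) (T : Type) (F : set_system T) {FF : Filter F} I (r : seq I)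
    (f : I -> T -> R) (a : I -> R) :
  (forall i, f i x @[x --> F] --> a i) ->
  (\sum_(i <- r) f i x) @[x --> F] --> \sum_(i <- r) a i.
Proof.
move=> fa; elim: r => [|i r IH].
  by under eq_fun do rewrite big_nil; rewrite big_nil; exact: cvg_cst.
by under eq_fun do rewrite big_cons; rewrite big_cons; apply: cvgD.
Qed.

(** * Smooth functions on normed spaces *)

Section calculus.
Context {R : realType} {V : normedModType R}.
Implicit Types (f g : V -> R) (u v x : V).

Definition derive_along s f : V -> R := foldr (fun u g => 'D_u g) f s.

Lemma derive_along_rcons s u f :
  derive_along (rcons s u) f = derive_along s ('D_u f).
Proof. by rewrite /derive_along foldr_rcons. Qed.

(** Coinduction for smoothness: it is enough to find a class of differentiable functions closed
    under all directional derivatives. Classes used below include finite sums of products, affine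
    pullbacks, the solutions [poisson_sol g], velocity moments and the functions [flat p]. *)
Lemma Cinfty_coind (S : set (V -> R)) :
  (forall f, S f -> (forall x, differentiable f x) /\ forall u, S ('D_u f)) ->
  forall f, S f -> Cinfty f.
Proof.
move=> HS f Sf s; elim/last_ind: s f Sf => [|s u IH] f Sf z.
  by have [] := HS _ Sf.
rewrite foldr_rcons; apply: IH; by have [] := HS _ Sf.
Qed.

Lemma Cinfty_differentiable f x : Cinfty f -> differentiable f x.
Proof. by move=> /(_ [::] x). Qed.

Lemma Cinfty_derivable f x v : Cinfty f -> derivable f x v.
Proof. by move=> /(Cinfty_differentiable x); exact: diff_derivable. Qed.

Lemma Cinfty_continuous f : Cinfty f -> continuous f.
Proof.
by move=> Cf x; apply: differentiable_continuous; exact: Cinfty_differentiable.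
Qed.

Lemma Cinfty_derive f u : Cinfty f -> Cinfty ('D_u f).
Proof. by move=> Cf s z; have := Cf (rcons s u) z; rewrite foldr_rcons. Qed.

Lemma Cinfty_derive_along f s : Cinfty f -> Cinfty (derive_along s f).
Proof. by move=> Cf; elim: s => //= u s IH; exact: Cinfty_derive. Qed.

Lemma derive_scale f x (a : R) u : differentiable f x ->
  'D_(a *: u) f x = a * 'D_u f x.
Proof. by move=> df; rewrite !deriveE// linearZ. Qed.

Lemma derive_vsum I (r : seq I) (P : pred I) (F : I -> V) f x :
  differentiable f x ->
  'D_(\sum_(i <- r | P i) F i) f x = \sum_(i <- r | P i) 'D_(F i) f x.
Proof.
move=> df; rewrite deriveE// linear_sum/=; apply: eq_bigr => i _.
by rewrite deriveE.
Qed.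

Lemma Cinfty_cst (c : R) : Cinfty (cst c : V -> R).
Proof.
apply: (Cinfty_coind (S := [set f | exists c, f = cst c])) => [_ [k ->]|]; last by exists c.
split=> [x|u]; first exact: differentiable_cst.
by exists 0; apply/funext => x; rewrite derive_cst.
Qed.

Lemma deriveD_fun f g u : Cinfty f -> Cinfty g ->
  'D_u (f \+ g) = 'D_u f \+ 'D_u g.
Proof.
by move=> Cf Cg; apply/funext => x; rewrite deriveD//; exact: Cinfty_derivable.
Qed.

Lemma deriveM_fun f g u : Cinfty f -> Cinfty g ->
  'D_u (f \* g) = (f \* 'D_u g) \+ (g \* 'D_u f).
Proof.
by move=> Cf Cg; apply/funext => x; rewrite deriveM//; exact: Cinfty_derivable.
Qed.

Lemma CinftyD f g : Cinfty f -> Cinfty g -> Cinfty (f \+ g).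
Proof.
move=> Cf Cg; apply: (Cinfty_coind (S := [set k | exists f g,
  [/\ Cinfty f, Cinfty g & k = f \+ g]])); last by exists f, g.
move=> _ [{Cf}f [{Cg}g [Cf Cg ->]]]; split=> [x|u].
  by apply: differentiableD; exact: Cinfty_differentiable.
exists ('D_u f), ('D_u g); split; [exact: Cinfty_derive..|].
exact: deriveD_fun.
Qed.

Lemma Cinfty_sum I (r : seq I) (P : pred I) (F : I -> V -> R) :
  (forall i, P i -> Cinfty (F i)) ->
  Cinfty (fun x => \sum_(i <- r | P i) F i x).
Proof.
move=> CF; elim: r => [|i r IH].
  by under eq_fun do rewrite big_nil; exact: Cinfty_cst.
under eq_fun do rewrite big_cons.
by have [/CF Ci|_] := boolP (P i) => //; exact: CinftyD Ci IH.
Qed.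

Lemma CinftyM f g : Cinfty f -> Cinfty g -> Cinfty (f \* g).
Proof.
(* Products alone are not closed under derivation. Finite sums of products are, since the Leibniz
   rule replaces a pair by two pairs. *)
move=> Cf Cg; apply: (Cinfty_coind (S := [set k | exists r : seq ((V -> R) * (V -> R)),
   (forall p, p \in r -> Cinfty p.1 /\ Cinfty p.2) /\
   k = fun x => \sum_(p <- r) p.1 x * p.2 x])); last first.
  exists [:: (f, g)]; split=> [p|]; first by rewrite inE => /eqP ->.
  by apply/funext => x; rewrite big_seq1.
move=> _ [r [Hr ->]]; split.
  move=> x; elim: r Hr => [|p r IH] Hr.
    by under eq_fun do rewrite big_nil; exact: differentiable_cst.
  under eq_fun do rewrite big_cons.
  have [C1 C2] := Hr p (mem_head _ _).
  apply: differentiableD.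
    by apply: differentiableM; exact: Cinfty_differentiable.
  by apply: IH => q qr; apply: Hr; rewrite inE qr orbT.
move=> u; elim: r Hr => [|p r IH] Hr.
  exists [::]; split => //; apply/funext => x.
  under eq_fun do rewrite big_nil.
  by rewrite derive_cst big_nil.
have [C1 C2] := Hr p (mem_head _ _).
have Hr' q : q \in r -> Cinfty q.1 /\ Cinfty q.2.
  by move=> qr; apply: Hr; rewrite inE qr orbT.
have [r' [Hr'' E]] := IH Hr'.
exists [:: (p.1, 'D_u p.2), (p.2, 'D_u p.1) & r']; split.
  move=> q; rewrite !inE => /or3P[/eqP ->|/eqP ->|]; last exact: Hr''.
  - by split=> //; exact: Cinfty_derive.
  - by split=> //; exact: Cinfty_derive.
apply/funext => x; rewrite !big_cons/= addrA -(congr1 (@^~ x) E).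
rewrite (_ : (fun y => _) = (fun y => p.1 y * p.2 y) + (fun y => \sum_(j <- r) j.1 y * j.2 y)); last first.
  by apply/funext => y; rewrite big_cons.
rewrite deriveD.
- by rewrite (_ : (fun y => p.1 y * p.2 y) = p.1 * p.2)// deriveM//; exact: Cinfty_derivable.
- by apply: derivableM; exact: Cinfty_derivable.
- apply: diff_derivable; elim: r Hr' {IH Hr E} => [|q r IH] Hr'.
    by under eq_fun do rewrite big_nil; exact: differentiable_cst.
  under eq_fun do rewrite big_cons.
  have [D1 D2] := Hr' q (mem_head _ _).
  apply: differentiableD.
    by apply: differentiableM; exact: Cinfty_differentiable.
  by apply: IH => t qr; apply: Hr'; rewrite inE qr orbT.
Qed.

Lemma CinftyZ (c : R) f : Cinfty f -> Cinfty (fun x => c * f x).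
Proof. by move=> Cf; apply: (CinftyM (Cinfty_cst c) Cf). Qed.

Lemma CinftyN f : Cinfty f -> Cinfty (fun x => - f x).
Proof.
by move=> Cf; under eq_fun do rewrite -mulN1r; exact: CinftyZ.
Qed.

Lemma CinftyB f g : Cinfty f -> Cinfty g -> Cinfty (fun x => f x - g x).
Proof. by move=> Cf Cg; apply: CinftyD => //; exact: CinftyN. Qed.

Lemma Cinfty_prod I (r : seq I) (P : pred I) (F : I -> V -> R) :
  (forall i, P i -> Cinfty (F i)) ->
  Cinfty (fun x => \prod_(i <- r | P i) F i x).
Proof.
move=> CF; elim: r => [|i r IH].
  by under eq_fun do rewrite big_nil; exact: Cinfty_cst.
under eq_fun do rewrite big_cons.
by have [/CF Ci|_] := boolP (P i) => //; exact: CinftyM Ci IH.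
Qed.

Lemma CinftyX f n : Cinfty f -> Cinfty (fun x => f x ^+ n).
Proof.
move=> Cf; elim: n => [|n IH].
  by under eq_fun do rewrite expr0; exact: Cinfty_cst.
by under eq_fun do rewrite exprS; exact: CinftyM.
Qed.

Lemma deriveZ_fun (c : R) f u : Cinfty f -> 'D_u (fun x => c * f x) = fun x => c * 'D_u f x.
Proof.
move=> Cf; apply/funext => x; rewrite (_ : (fun _ => _) = c *: f)//.
by rewrite deriveZ//; exact: Cinfty_derivable.
Qed.

Lemma derive_sum_fun I (r : seq I) (P : pred I) (F : I -> V -> R) u :
  (forall i, P i -> Cinfty (F i)) ->
  'D_u (fun x => \sum_(i <- r | P i) F i x) =
  fun x => \sum_(i <- r | P i) 'D_u (F i) x.
Proof.
move=> CF; elim: r => [|i r IH].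
  apply/funext => x; rewrite big_nil (_ : (fun _ => _) = cst 0) ?derive_cst//.
  by apply/funext => y; rewrite big_nil.
rewrite (_ : (fun x => \sum_(j <- i :: r | P j) F j x) = (if P i then
   F i \+ (fun x => \sum_(j <- r | P j) F j x) else fun x => \sum_(j <- r | P j) F j x)); last first.
  by apply/funext => x; rewrite big_cons; case: ifP.
have [Pi|nPi] := boolP (P i).
  rewrite deriveD_fun ?IH; [|exact: CF|exact: Cinfty_sum].
  by apply/funext => x; rewrite big_cons Pi.
by rewrite IH; apply/funext => x; rewrite big_cons (negbTE nPi).
Qed.

Lemma deriveDx f g u x : Cinfty f -> Cinfty g ->
  'D_u (fun y => f y + g y) x = 'D_u f x + 'D_u g x.
Proof. by move=> Cf Cg; exact: (congr1 (@^~ x) (deriveD_fun u Cf Cg)). Qed.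

Lemma deriveMx f g u x : Cinfty f -> Cinfty g ->
  'D_u (fun y => f y * g y) x = f x * 'D_u g x + g x * 'D_u f x.
Proof. by move=> Cf Cg; exact: (congr1 (@^~ x) (deriveM_fun u Cf Cg)). Qed.

Lemma deriveZx (c : R) f u x : Cinfty f -> 'D_u (fun y => c * f y) x = c * 'D_u f x.
Proof. by move=> Cf; exact: (congr1 (@^~ x) (deriveZ_fun c u Cf)). Qed.

Lemma deriveNx f u x : Cinfty f -> 'D_u (fun y => - f y) x = - 'D_u f x.
Proof. by move=> Cf; apply: (@deriveN _ _ _ f); exact: Cinfty_derivable. Qed.

Lemma deriveBx f g u x : Cinfty f -> Cinfty g ->
  'D_u (fun y => f y - g y) x = 'D_u f x - 'D_u g x.
Proof.
by move=> Cf Cg; rewrite deriveDx ?deriveNx//; exact: CinftyN.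
Qed.

Lemma derive_sumx I (r : seq I) (P : pred I) (F : I -> V -> R) u x :
  (forall i, P i -> Cinfty (F i)) ->
  'D_u (fun x => \sum_(i <- r | P i) F i x) x = \sum_(i <- r | P i) 'D_u (F i) x.
Proof. by move=> CF; exact: (congr1 (@^~ x) (derive_sum_fun r u CF)). Qed.

Lemma Cinfty_linear (l : {linear V -> R}) : continuous l -> Cinfty l.
Proof.
move=> cl; suff H : forall f, (f = l \/ exists c, f = cst c) -> Cinfty f by apply: H; left.
apply: Cinfty_coind => _ [->|[c ->]].
  split=> [x|u]; first exact: linear_differentiable.
  right; exists (l u); apply/funext => x.
  by rewrite deriveE ?diff_lin//; exact: linear_differentiable.
split=> [x|u]; first exact: differentiable_cst.
by right; exists 0; apply/funext => x; rewrite derive_cst.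
Qed.

Lemma derive_linear (l : {linear V -> R}) u : continuous l -> 'D_u l = cst (l u).
Proof.
move=> cl; apply/funext => x.
by rewrite deriveE ?diff_lin//; exact: linear_differentiable.
Qed.

Lemma is_derive_line f x v (t : R) : derivable f (x + t *: v) v ->
  is_derive t 1 (fun s : R => f (x + s *: v)) ('D_v f (x + t *: v)).
Proof.
move=> df.
have E : (fun h : R => h^-1 *: (((fun s : R => f (x + s *: v)) \o shift t) (h *: 1) - f (x + t *: v)))
   = (fun h : R => h^-1 *: ((f \o shift (x + t *: v)) (h *: v) - f (x + t *: v))).
  apply/funext => h /=; congr (_ *: (f _ - _)).
  by rewrite /shift /= [h *: 1]mulr1 scalerDl addrCA.
by split; rewrite /derivable /derive E.
Qed.

Lemma mean_value f x v (t : R) : 0 < t ->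
  (forall s : R, derivable f (x + s *: v) v) ->
  exists2 s, 0 < s < t & f (x + t *: v) - f x = 'D_v f (x + s *: v) * t.
Proof.
move=> t0 df.
have D s : s \in `]0, t[%R -> is_derive s 1 (fun s : R => f (x + s *: v)) ('D_v f (x + s *: v)).
  by move=> _; exact: is_derive_line.
have [|s st E] := MVT t0 D.
  apply/continuous_subspaceT => s; apply: differentiable_continuous.
  by apply/derivable1_diffP; have [] := is_derive_line (df s).
by exists s; [rewrite in_itv/= in st | move: E; rewrite scale0r addr0 subr0].
Qed.

Lemma mean_value_abs f x v (t : R) :
  (forall s : R, derivable f (x + s *: v) v) ->
  exists2 s : R, `|s| <= `|t| & f (x + t *: v) - f x = 'D_v f (x + s *: v) * t.
Proof.
move=> df; have [t0|t0|->] := ltgtP t 0; last first.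
- by exists 0; rewrite // !scale0r addr0 subrr mulr0.
- have [s /andP[s0 st] E] := mean_value t0 df; exists s => //.
  by rewrite !gtr0_norm// ltW.
(* For negative [t] the positive case is run backwards from the end point. *)
- have nt0 : 0 < - t by rewrite oppr_gt0.
  have df' (s : R) : derivable f (x + t *: v + s *: v) v by rewrite -addrA -scalerDl.
  have [s /andP[s0 st]] := mean_value nt0 df'.
  rewrite -!addrA -!scalerDl subrr scale0r addr0 => E.
  exists (t + s); last by rewrite -opprB E; ring.
  by rewrite !ltr0_norm//; lra.
Qed.

Lemma mean_value_le f x v (t B : R) : 0 <= t ->
  (forall s : R, derivable f (x + s *: v) v) ->
  (forall s : R, 0 <= s <= t -> `|'D_v f (x + s *: v)| <= B) ->
  `|f (x + t *: v) - f x| <= B * t.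
Proof.
move=> t0 df HB; have [->|tn0] := eqVneq t 0.
  by rewrite scale0r addr0 subrr normr0 mulr0.
have tp : 0 < t by rewrite lt_neqAle eq_sym tn0.
have [s /andP[s0 st] ->] := mean_value tp df.
by rewrite normrM (ger0_norm t0) ler_wpM2r// HB// (ltW s0) ltW.
Qed.

Lemma dist_le_split (a b p e : R) :
  `|p - a| < e / 2 -> `|p - b| < e / 2 -> `|a - b| <= e.
Proof.
by rewrite !ltr_distl ler_distl => /andP[? ?] /andP[? ?]; apply/andP; split; lra.
Qed.

Lemma derive_comm f u v : Cinfty f -> 'D_u ('D_v f) = 'D_v ('D_u f).
Proof.
move=> Cf; apply/funext => x.
(* The second difference over the parallelogram with sides [h *: a] and [h *: b] is [h * h] times a
   mixed derivative at one of its points. The difference is symmetric in [a] and [b], so the two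
   orders of derivation agree at two points near [x], and continuity concludes. *)
have step (a b : V) h : 0 < h -> exists s t : R, [/\ 0 < s < h, 0 < t < h &
   f (x + h *: a + h *: b) - f (x + h *: a) - (f (x + h *: b) - f x) =
   'D_a ('D_b f) (x + s *: b + t *: a) * h * h].
  move=> h0.
  pose g := fun y => f (y + h *: a) - f y.
  have isd y : is_derive y b (fun y => f (y + h *: a)) ('D_b f (y + h *: a)).
    have df := @Cinfty_derivable f (y + h *: a) b Cf.
    have E : (fun k : R => k^-1 *: (((fun y => f (y + h *: a)) \o shift y) (k *: b) - f (y + h *: a)))
      = (fun k : R => k^-1 *: ((f \o shift (y + h *: a)) (k *: b) - f (y + h *: a))).
      by apply/funext => k /=; rewrite /shift /= addrA.
    by split; rewrite /derivable /derive E.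
  have dg y : derivable g y b.
    apply: derivableB; first by have [] := isd y.
    exact: Cinfty_derivable.
  have [s sh Es] := @mean_value g x b h h0 (fun s : R => dg (x + s *: b)).
  have Dg y : 'D_b g y = 'D_b f (y + h *: a) - 'D_b f y.
    rewrite /g (_ : (fun y => _) = (fun y => f (y + h *: a)) - f)// deriveB.
    - by have [_ ->] := isd y.
    - by have [] := isd y.
    - exact: Cinfty_derivable.
  have Cb := Cinfty_derive b Cf.
  have [t th Et] := @mean_value ('D_b f) (x + s *: b) a h h0
    (fun t => @Cinfty_derivable _ _ a Cb).
  exists s, t; split=> //.
  rewrite -Et -Dg -Es /g [x + h *: a + _]addrAC; ring.
apply/eqP; rewrite -subr_eq0 -normr_le0; apply/ler_addgt0Pl => e e0; rewrite addr0.
have e2 : 0 < e / 2 by rewrite divr_gt0.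
have near_small (w : V -> R) : continuous w -> exists2 d : R, 0 < d &
    forall y, `|y - x| < d -> `|w y - w x| < e / 2.
  move=> /(_ x) /cvgrPdist_lt /(_ _ e2) /nbhs_normP[d /= d0 Hd]; exists d => // y yx.
  by rewrite distrC; apply: Hd; rewrite /= distrC.
have [d1 d10 H1] := near_small _ (Cinfty_continuous (Cinfty_derive u (Cinfty_derive v Cf))).
have [d2 d20 H2] := near_small _ (Cinfty_continuous (Cinfty_derive v (Cinfty_derive u Cf))).
pose M := `|u| + `|v| + 1.
have M0 : 0 < M by rewrite /M ltr_wpDl// addr_ge0.
(* [M] exceeds the sum of the two norms by one, which keeps the parallelogram strictly inside the
   ball of radius [Num.min d1 d2] even if both directions vanish. *)
pose h := Num.min d1 d2 / M.
have h0 : 0 < h by rewrite divr_gt0// lt_min d10 d20.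
have small s t a b : `|a| + `|b| <= M - 1 -> 0 < s < h -> 0 < t < h ->
    `|x + s *: a + t *: b - x| < Num.min d1 d2.
  move=> ab /andP[s0 sh] /andP[t0 th].
  rewrite addrAC [x + _]addrC addrK.
  rewrite (le_lt_trans (ler_normD _ _))// !normrZ !gtr0_norm//.
  rewrite (@le_lt_trans _ _ (h * (`|a| + `|b|)))//.
    by rewrite mulrDr lerD// ler_wpM2r// ltW.
  rewrite (@le_lt_trans _ _ (h * (M - 1)))//; first by rewrite ler_wpM2l// ltW.
  rewrite -[ltRHS](@divfK _ M)// ?gt_eqF// -/h.
  by rewrite ltr_pM2l// ltrBlDr ltrDl.
have [s [t [sh th E1]]] := step u v h h0.
have [s' [t' [sh' th' E2]]] := step v u h h0.
have E : 'D_u ('D_v f) (x + s *: v + t *: u) = 'D_v ('D_u f) (x + s' *: u + t' *: v).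
  have hn : h != 0 by rewrite gt_eqF.
  move: E1 E2; move: ('D_u ('D_v f) _) ('D_v ('D_u f) _) => a b.
  rewrite [x + h *: v + _]addrAC => E1 E2.
  by apply: (mulIf hn); apply: (mulIf hn); rewrite -E1 -E2; ring.
have K1 := H1 _ (lt_le_trans (@small s t v u _ sh th) _).
have K2 := H2 _ (lt_le_trans (@small s' t' u v _ sh' th') _).
move: K1 K2; rewrite ge_min lexx /= ge_min lexx orbT /M addrK [_ + `|u|]addrC.
move=> /(_ (lexx _) isT) K1 /(_ (lexx _) isT) K2.
move: K1; rewrite E => K1.
move: K1 K2.
exact: dist_le_split.
Qed.

Lemma derive_along_derive f s u : Cinfty f ->
  derive_along s ('D_u f) = 'D_u (derive_along s f).
Proof.
move=> Cf; elim: s => //= v s ->; apply: derive_comm.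
exact: Cinfty_derive_along.
Qed.

Lemma derive_along_cat f s t :
  derive_along (s ++ t) f = derive_along s (derive_along t f).
Proof. by rewrite /derive_along foldr_cat. Qed.

Lemma derive_along_perm f (s t : seq V) : Cinfty f -> perm_eq s t ->
  derive_along s f = derive_along t f.
Proof.
move=> Cf; elim: s t => [|u s IH] t.
  by rewrite perm_sym => /perm_nilP ->.
move=> st; have : u \in t by rewrite -(perm_mem st) mem_head.
move=> /splitPr tE; case: tE st => t1 t2; rewrite perm_sym perm_catC/=.
rewrite perm_cons perm_catC perm_sym => /IH /= ->.
rewrite !derive_along_cat -derive_along_derive//.
exact: Cinfty_derive_along.
Qed.

Lemma derive_along_sum I (r : seq I) (P : pred I) (F : I -> V -> R) (s : seq V) :
  (forall i, P i -> Cinfty (F i)) ->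
  derive_along s (fun x => \sum_(i <- r | P i) F i x) =
  fun x => \sum_(i <- r | P i) derive_along s (F i) x.
Proof.
move=> CF; elim: s => //= u s ->; rewrite derive_sum_fun// => i Pi.
by apply: Cinfty_derive_along; exact: CF.
Qed.

Lemma derive_alongZ (c : R) f (s : seq V) : Cinfty f ->
  derive_along s (fun x => c * f x) = fun x => c * derive_along s f x.
Proof.
move=> Cf; elim: s => //= u s ->; rewrite deriveZ_fun//.
exact: Cinfty_derive_along.
Qed.

Lemma derive_alongD f g (s : seq V) : Cinfty f -> Cinfty g ->
  derive_along s (f \+ g) = derive_along s f \+ derive_along s g.
Proof.
move=> Cf Cg; elim: s => //= u s ->; rewrite deriveD_fun//;
exact: Cinfty_derive_along.
Qed.

Definition diff_quot (h : R) v f : V -> R := fun x => (f (x + h *: v) - f x) / h.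

Lemma diff_quot_le f v x (h B : R) : 0 < h ->
  (forall y, derivable f y v) -> (forall y, `|'D_v f y| <= B) ->
  `|diff_quot h v f x| <= B.
Proof.
move=> h0 df HB; rewrite /diff_quot normrM normfV (gtr0_norm h0) ler_pdivrMr//.
by apply: mean_value_le; [exact: ltW| |].
Qed.

Lemma diff_quot_derive f v x (h B : R) : 0 < h -> Cinfty f ->
  (forall y, `|'D_v ('D_v f) y| <= B) -> `|diff_quot h v f x - 'D_v f x| <= B * h.
Proof.
move=> h0 Cf HB.
have df (s : R) : derivable f (x + s *: v) v by exact: Cinfty_derivable.
have [s /andP[s0 sh] E] := mean_value h0 df.
rewrite /diff_quot E mulfK ?gt_eqF//.
apply: (@le_trans _ _ (B * s)).
  apply: (@mean_value_le ('D_v f) x v s B (ltW s0)).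
    by move=> t; apply: Cinfty_derivable; exact: Cinfty_derive.
  by move=> t _; exact: HB.
by rewrite ler_wpM2l//; [exact: le_trans (HB x)|exact: ltW].
Qed.

End calculus.

(** * Uniform limits of functions and of their derivatives *)

Section uniform_limit.
Context {R : realType} {V : normedModType R}.
Variables (F : nat -> V -> R) (e : nat -> R).
Hypothesis e0 : e @ \oo --> 0.

Lemma uniform_limit_continuous (f : V -> R) :
  (forall n x, `|F n x - f x| <= e n) -> (forall n, continuous (F n)) ->
  continuous f.
Proof.
move=> Ff cF x; apply/cvgrPdist_le => r r0.
have r3 : 0 < r / 3 by rewrite divr_gt0.
move/cvgrPdist_le : e0 => /(_ _ r3) [n _ /(_ n (leqnn _))] /=.
rewrite sub0r normrN => en.
move: (cF n x) => /cvgrPdist_le /(_ _ r3); apply: filterS => y.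
move: (Ff n x) (Ff n y) (ler_norm (e n)).
rewrite !ler_norml => /andP[? ?] /andP[? ?] ? /andP[? ?].
by move: en; rewrite ler_norml => /andP[? ?]; lra.
Qed.

(** The mean value theorem is applied to each [F n] before [n] tends to infinity. The resulting
    bound [|h| * (r + e n)] survives the limit, so two limits are never exchanged. *)
Lemma uniform_limit_derive (f g : V -> R) (v : V) :
  (forall x, (fun n => F n x) @ \oo --> f x) ->
  (forall n x, derivable (F n) x v) ->
  (forall n x, `|'D_v (F n) x - g x| <= e n) -> continuous g ->
  forall x, is_derive x v f (g x).
Proof.
move=> Ff dF DF cg x.
suff H : (fun h : R => h^-1 *: ((f \o shift x) (h *: v) - f x)) @ 0^' --> g x.
  by split; [apply/cvg_ex; exists (g x)|exact: cvg_lim H].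
apply/cvgrPdist_le => r r0.
have cgx : (fun h : R => g (x + h *: v)) @ 0 --> g x.
  rewrite -[in X in _ --> X](addr0 x) -(scale0r v).
  apply: (cvg_comp (fun h : R => x + h *: v) g); last exact: cg.
  by apply: cvgD; [exact: cvg_cst|apply: cvgZr_tmp; exact: cvg_id].
move/cvgrPdist_le : cgx => /(_ _ r0) /nbhs_normP[d /= d0 Hd].
apply/nbhs_ballP; exists d => //= h; rewrite /ball/= sub0r normrN => hd h0.
have B n : `|F n (x + h *: v) - F n x - h * g x| <= `|h| * (r + e n).
  have [s sh ->] := mean_value_abs h (fun s => dF n (x + s *: v)).
  rewrite [_ * h]mulrC -mulrBr normrM ler_wpM2l//.
  apply: (le_trans (ler_distD (g (x + s *: v)) _ _)); rewrite addrC lerD//.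
  by rewrite distrC; apply: Hd => /=; rewrite sub0r normrN (le_lt_trans sh).
have L : `|f (x + h *: v) - f x - h * g x| <= `|h| * (r + 0).
  apply: (@ler_cvg_to _ \oo _ _ (fun n => `|F n (x + h *: v) - F n x - h * g x|)
    (fun n => `|h| * (r + e n))); last by near=> n; exact: B.
  - apply: cvg_norm; apply: cvgB; last exact: cvg_cst.
    by apply: cvgB; exact: Ff.
  - by apply: cvgMr; apply: cvgD => //; exact: cvg_cst.
rewrite addr0 in L.
rewrite /= /shift /= [h *: v + x]addrC.
have -> : g x - h^-1 *: (f (x + h *: v) - f x) =
   - (h^-1 * (f (x + h *: v) - f x - h * g x)).
  by rewrite [_ *: _]/(_ * _) mulrBr mulKf// opprB.
by rewrite normrN normrM normfV ler_pdivrMl ?normr_gt0.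
Unshelve. all: by end_near. Qed.

End uniform_limit.

Section affine_composition.
Context {R : realType} {V W : normedModType R}.
Variables (l : {linear W -> V}) (b : V).
Hypothesis cl : continuous l.

Lemma derive_affine (f : V -> R) (u x : W) : Cinfty f ->
  'D_u (fun y => f (l y + b)) x = 'D_(l u) f (l x + b).
Proof.
move=> Cf.
have E : (fun h : R => h^-1 *: (((fun y => f (l y + b)) \o shift x) (h *: u) - f (l x + b)))
   = (fun h : R => h^-1 *: ((f \o shift (l x + b)) (h *: l u) - f (l x + b))).
  apply/funext => h /=; congr (_ *: (f _ - _)); rewrite /shift /=.
  by have /= -> := linearP l h u x; rewrite addrA.
by rewrite /derive E.
Qed.

Lemma Cinfty_affine (f : V -> R) : Cinfty f -> Cinfty (fun y => f (l y + b)).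
Proof.
move=> Cf; apply: (Cinfty_coind (S := [set g | exists f, Cinfty f /\
  g = fun y => f (l y + b)])); last by exists f.
move=> _ [{Cf}f [Cf ->]]; split=> [x|u].
  apply: (@differentiable_comp _ _ _ _ (fun y => l y + b) f).
    apply: differentiableD; last exact: differentiable_cst.
    exact: linear_differentiable.
  exact: Cinfty_differentiable.
exists ('D_(l u) f); split; first exact: Cinfty_derive.
by apply/funext => x; exact: derive_affine.
Qed.

Lemma derive_along_affine (f : V -> R) (s : seq W) : Cinfty f ->
  derive_along s (fun y => f (l y + b)) =
  fun y => derive_along (map l s) f (l y + b).
Proof.
move=> Cf; elim: s => //= u s ->; apply/funext => x; apply: derive_affine.
exact: Cinfty_derive_along.
Qed.

End affine_composition.

Section translation.
Context {R : realType} {V : normedModType R}.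

Lemma Cinfty_shift (f : V -> R) b : Cinfty f -> Cinfty (fun y => f (y + b)).
Proof. by apply: (@Cinfty_affine _ _ _ (idfun : {linear V -> V})) => x; exact: cvg_id. Qed.

Lemma derive_along_shift (f : V -> R) b (s : seq V) : Cinfty f ->
  derive_along s (fun y => f (y + b)) = fun y => derive_along s f (y + b).
Proof.
by move=> Cf; rewrite (@derive_along_affine _ _ _ idfun b f s Cf) map_id.
Qed.

Lemma derive_shift (f : V -> R) b u : Cinfty f ->
  'D_u (fun y => f (y + b)) = fun y => 'D_u f (y + b).
Proof. exact: (@derive_along_shift f b [:: u]). Qed.

Lemma derive_shiftx (f : V -> R) b u x : Cinfty f ->
  'D_u (fun y => f (y + b)) x = 'D_u f (x + b).
Proof. by move=> Cf; exact: (congr1 (@^~ x) (derive_shift b u Cf)). Qed.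

End translation.

(** * Differentiability in coordinates *)

Section row_calculus.
Context {R : realType} {d : nat}.
Local Notation V := 'rV[R]_d.

Lemma row_ebase (v : V) : v = \sum_i v ord0 i *: ebase i.
Proof. exact: row_sum_delta. Qed.

Lemma row_norm_le (v : V) i : `|v ord0 i| <= `|v|.
Proof.
rewrite [leRHS]/Num.norm/= mx_normrE; apply/bigmax_geP; right => /=.
by exists (ord0, i).
Qed.

Lemma derive_row (f : V -> R) x v : differentiable f x ->
  'D_v f x = \sum_i v ord0 i * partial i f x.
Proof.
move=> df; rewrite {1}(row_ebase v) derive_vsum//.
by apply: eq_bigr => i _; rewrite derive_scale.
Qed.

(** [Cinfty] asks for differentiability, while the objects obtained by limits and integrals
    ([poisson_sol], [moment]) come with directional derivatives only. Continuity of the partial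
    derivatives bridges the gap. *)
Lemma partials_differentiable (f : V -> R) (G : 'I_d -> V -> R) :
  (forall i, continuous (G i)) ->
  (forall x v, is_derive x v f (\sum_i v ord0 i * G i x)) ->
  forall x, differentiable f x.
Proof.
move=> cG dG x.
pose L0 := fun v : V => \sum_i v ord0 i * G i x.
have linL : linear L0.
  move=> a u v; rewrite /L0 [X in _ = X + _]mulr_sumr -big_split/=.
  by apply: eq_bigr => i _; rewrite !mxE; ring.
pose L : {linear V -> R^o} := HB.pack L0 (@GRing.isLinear.Build R V R^o *:%R L0 linL).
have cL : continuous L.
  have -> : (L : V -> R) = fun v => \sum_i v ord0 i * G i x by [].
  move=> v; apply: (@cvg_bigsum _ _ (nbhs v)) => i; apply: cvgM; last exact: cvg_cst.
  exact: coord_continuous.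
suff E : f \o shift x = cst (f x) + L +o_ 0 id.
  apply/diff_locallyP; have dL := diff_unique cL E.
  by rewrite dL; split.
apply/eqaddoP => _/posnumP[e].
(* The error collects [d] terms; [d.+1] keeps the quotient meaningful for [d = 0]. *)
pose e' := e%:num / d.+1%:R.
have e'0 : 0 < e' by rewrite divr_gt0.
have [r r0 Hr] : exists2 r : R, 0 < r & forall y, `|y - x| < r ->
    forall i, `|G i y - G i x| <= e'.
  have : \forall y \near x, forall i, `|G i y - G i x| <= e'.
    apply: (@filter_forall V 'I_d (fun i y => `|G i y - G i x| <= e') (nbhs x) _) => i.
    move/cvgrPdist_le : (cG i x) => /(_ _ e'0); apply: filterS => y.
    by rewrite distrC.
  move=> /nbhs_normP[r /= r0 Hr]; exists r => // y xy; apply: Hr.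
  by rewrite /= distrC.
near=> v.
have vr : `|v| < r.
  by near: v; exact: (@nbhs0_lt R V r r0).
rewrite !fctE /=.
have df s : derivable f (x + s *: v) v by have [] := dG (x + s *: v) v.
have [s sh E] := mean_value_abs 1 df.
rewrite scale1r mulr1 in E; rewrite normr1 in sh.
rewrite -[v + x]addrC opprD addrA E.
have [_ ->] := dG (x + s *: v) v.
rewrite /L/= /L0 -sumrB.
apply: (le_trans (ler_norm_sum _ _ _)).
apply: (@le_trans _ _ (\sum_(i < d) `|v| * e')).
  apply: ler_sum => i _; rewrite -mulrBr normrM ler_pM//; first exact: row_norm_le.
  apply: Hr; rewrite addrAC subrr add0r normrZ (le_lt_trans _ vr)//.
  by rewrite ler_piMl.
rewrite sumr_const card_ord -mulr_natr -mulrA [leRHS]mulrC ler_wpM2l//.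
by rewrite /e' -mulrA ler_piMr// mulrC ler_pdivrMr// mul1r ler_nat.
Unshelve. all: by end_near. Qed.

End row_calculus.

(** * The discrete Laplacian on a finite abelian group *)

Section discrete_torus.
Context {R : realType} {X : finZmodType} {d : nat}.
Variables (e : 'I_d -> X) (N : nat).
Hypothesis N0 : (0 < N)%N.
Hypothesis eN : forall i, e i *+ N = 0.
Hypothesis gen : forall m : X, exists2 k : 'I_d -> nat,
  (forall i, k i <= N)%N & m = \sum_i e i *+ k i.
Implicit Types (c : X -> R) (k m a : X).

(** The scaling makes [1 / N] the mesh: the group models a torus of side 1, and the estimates hold
    with constants independent of [N]. *)
Definition gdiff (i : 'I_d) c k : R := N%:R * (c (k + e i) - c k).
Definition glap c k : R :=
  \sum_i N%:R ^+ 2 * (c (k + e i) + c (k - e i) - 2 * c k).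
Definition gdiffs (p : seq 'I_d) c : X -> R := foldl (fun c i => gdiff i c) c p.
(** Applied to [enum 'I_d], this lists the square-free multi-indices, [2 ^ d] in number. *)
Fixpoint subs (I : seq 'I_d) : seq (seq 'I_d) :=
  if I is i :: I' then subs I' ++ map (cons i) (subs I') else [:: [::]].

Let NR0 : 0 < N%:R :> R. Proof. by rewrite ltr0n. Qed.
Let NRn0 : N%:R != 0 :> R. Proof. by rewrite gt_eqF. Qed.

Let XR0 : #|X|%:R != 0 :> R.
Proof. by rewrite pnatr_eq0 -lt0n; apply/card_gt0P; exists 0. Qed.

Let avgN (a : R) : N%:R^-1 * \sum_(j < N) a = a.
Proof. by rewrite sumr_const card_ord -(mulr_natl a) mulKf. Qed.

Let avgX (a : R) : #|X|%:R^-1 * \sum_(k : X) a = a.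
Proof. by rewrite sumr_const -(mulr_natl a) mulKf. Qed.

Let sumX (a : R) : \sum_(k : X) #|X|%:R^-1 * a = a.
Proof. by rewrite -mulr_sumr avgX. Qed.

Lemma sum_translate c a : \sum_k c (k + a) = \sum_k c k.
Proof. by rewrite [RHS](reindex_inj (addIr a)). Qed.

(* The squared l^2 modulus of continuity; summed over all translations it is the
   variance, which is how the Poincare inequality comes out of subadditivity. *)
Definition osc c a : R := \sum_k (c (k + a) - c k) ^+ 2.

(** Cauchy-Schwarz with the weights [n + 1] and [(n + 1) / n], the ones for which the factor
    [size s] reproduces itself in the induction. Translation invariance allows [osc c S] to be
    computed at the points [k + a]. *)
Lemma osc_sum c (s : seq X) :
  osc c (\sum_(a <- s) a) <= (size s)%:R * \sum_(a <- s) osc c a.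
Proof.
elim: s => [|a s IH].
  rewrite !big_nil mulr0 /osc big1// => k _; by rewrite addr0 subrr expr0n.
rewrite !big_cons; set S := \sum_(b <- s) b in IH *.
have [s0|sn0] := posnP (size s).
  have -> : S = 0 by rewrite /S (size0nil s0) big_nil.
  by rewrite (size0nil s0) big_nil !addr0 mul1r.
have n0 : 0 < (size s)%:R :> R by rewrite ltr0n.
pose n : R := (size s)%:R; rewrite -/n in n0 IH.
have -> : (size (a :: s))%:R = n + 1 :> R by rewrite /= -natr1.
have : osc c (a + S) <= (n + 1) * osc c a + (n + 1) / n * osc c S.
  rewrite /osc -[X in _ + _ * X](sum_translate _ a) !mulr_sumr -big_split/=.
  apply: ler_sum => k _.
  have -> : k + (a + S) = k + a + S by rewrite addrA.
  set x := c (k + a + S); set y := c (k + a); set z := c k.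
  (* The last square is the exact defect of the weighted inequality. *)
  have -> : (n + 1) * (y - z) ^+ 2 + (n + 1) / n * (x - y) ^+ 2 =
     (x - z) ^+ 2 + (n * (y - z) - (x - y)) ^+ 2 / n.
    by field; rewrite gt_eqF.
  by rewrite lerDl divr_ge0 ?sqr_ge0// ltW.
move=> /le_trans; apply; rewrite mulrDr lerD2l -mulrA ler_wpM2l//.
  by rewrite addr_ge0// ltW.
by rewrite ler_pdivrMl.
Qed.

Lemma osc_muln c a j : osc c (a *+ j) <= j%:R ^+ 2 * osc c a.
Proof.
have := osc_sum c (nseq j a).
rewrite size_nseq !big_nseq !iter_addr_0 => /le_trans; apply.
by rewrite -[osc c a *+ j]mulr_natl mulrA -expr2.
Qed.

(** By [gen], a translation is a sum of [d] multiples of generators, each at most [N]-fold.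
    Subadditivity over the directions costs [d], within one direction [N ^ 2]. *)
Lemma osc_bound c m : osc c m <= d%:R * \sum_i N%:R ^+ 2 * osc c (e i).
Proof.
have [k kN ->] := gen m.
have := osc_sum c [seq e i *+ k i | i <- index_enum 'I_d].
have -> : size [seq e i *+ k i | i <- index_enum 'I_d] = d.
  by rewrite size_map /index_enum -enumT size_enum_ord.
rewrite !big_map => /le_trans; apply.
rewrite ler_wpM2l//; apply: ler_sum => i _.
apply: (le_trans (osc_muln _ _ _)); rewrite ler_wpM2r//.
  by apply: sumr_ge0 => *; exact: sqr_ge0.
by rewrite lerXn2r ?nnegrE ?ler0n// ler_nat.
Qed.

(** Summation by parts; on a group the translations leave no boundary terms. *)
Lemma osc_energy c i : N%:R ^+ 2 * osc c (e i) =
  - \sum_k c k * (N%:R ^+ 2 * (c (k + e i) + c (k - e i) - 2 * c k)).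
Proof.
rewrite /osc mulr_sumr -sumrN.
have E1 := sum_translate (fun k => N%:R ^+ 2 * (c k ^+ 2)) (e i).
have E2 := sum_translate (fun k => N%:R ^+ 2 * (c k * c (k - e i))) (e i).
apply/eqP; rewrite -subr_eq0 -sumrB.
transitivity ((\sum_k N%:R ^+ 2 * c (k + e i) ^+ 2 - \sum_k N%:R ^+ 2 * c k ^+ 2)
  - (\sum_k N%:R ^+ 2 * (c (k + e i) * c (k + e i - e i)) -
     \sum_k N%:R ^+ 2 * (c k * c (k - e i))) == 0).
  congr (_ == _); rewrite -!sumrB; apply: eq_bigr => k _; rewrite addrK; ring.
by rewrite E1 E2 !subrr eqxx.
Qed.

Lemma sum_osc c : \sum_k c k = 0 -> \sum_m osc c m = 2 * #|X|%:R * \sum_k c k ^+ 2.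
Proof.
move=> c0; rewrite /osc exchange_big/=.
transitivity (\sum_(k : X) ((\sum_m c m ^+ 2 - 2 * c k * \sum_m c m) + #|X|%:R * c k ^+ 2)).
  apply: eq_bigr => k _.
  rewrite -(sum_translate (fun m => c m ^+ 2) k) -(sum_translate c k).
  rewrite mulr_sumr -sumrB [#|X|%:R * _]mulr_natl -sumr_const -big_split/=.
  apply: eq_bigr => m _; rewrite [k + m]addrC; ring.
rewrite c0 big_split/= -mulr_sumr.
under eq_bigr do rewrite mulr0 subr0.
by rewrite sumr_const -mulr_natl; ring.
Qed.

(** Lagrange's identity: the difference of the two sides is half the sum of all
    [(f k - f l) ^+ 2]. *)
Lemma sqr_sum_le (I : finType) (f : I -> R) :
  (\sum_k f k) ^+ 2 <= #|I|%:R * \sum_k f k ^+ 2.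
Proof.
have : 0 <= \sum_k \sum_l (f k - f l) ^+ 2.
  by do 2 (apply: sumr_ge0 => ? _); exact: sqr_ge0.
have -> : \sum_k \sum_l (f k - f l) ^+ 2 =
    2 * (#|I|%:R * \sum_k f k ^+ 2 - (\sum_k f k) ^+ 2).
  transitivity (\sum_k (#|I|%:R * f k ^+ 2 - 2 * f k * (\sum_l f l) + \sum_l f l ^+ 2)).
    apply: eq_bigr => k _; rewrite mulr_sumr [#|I|%:R * _]mulr_natl -sumr_const -sumrB -big_split/=.
    by apply: eq_bigr => l _; ring.
  rewrite big_split sumrB/= sumr_const -mulr_suml -!mulr_sumr -[_ *+ _]mulr_natl; ring.
by rewrite pmulr_rge0// subr_ge0.
Qed.

(** Energy estimate. With [S] the sum of the [|c k|], summing [osc] over all translations bounds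
    [2 * #|X|] times the sum of squares by [#|X| * d * S * B]. Cauchy-Schwarz bounds [S ^+ 2] by
    [#|X|] times the sum of squares, and one factor [S] cancels. *)
Lemma poincare c (B : R) : \sum_k c k = 0 -> (forall k, `|glap c k| <= B) ->
  \sum_k `|c k| <= #|X|%:R * (d%:R * B).
Proof.
move=> c0 HB.
have X0 : 0 < #|X|%:R :> R by rewrite ltr0n; apply/card_gt0P; exists 0.
have B0 : 0 <= B by exact: le_trans (HB 0).
set S := \sum_k `|c k|.
have S0 : 0 <= S by exact: sumr_ge0.
have P : 2 * #|X|%:R * (\sum_k c k ^+ 2) <= #|X|%:R * (d%:R * (S * B)).
  rewrite -sum_osc// mulr_natl -sumr_const; apply: ler_sum => m _.
  apply: (le_trans (osc_bound c m)); rewrite ler_wpM2l//.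
  under eq_bigr do rewrite osc_energy.
  rewrite sumrN exchange_big/= -sumrN mulr_suml; apply: ler_sum => k _.
  rewrite -mulr_sumr -/(glap c k) (le_trans (ler_norm _))// normrN normrM.
  by rewrite ler_wpM2l.
have Q : S ^+ 2 <= #|X|%:R * \sum_k c k ^+ 2.
  apply: (le_trans (sqr_sum_le (fun k => `|c k|))).
  by under eq_bigr do rewrite real_normK ?num_real//.
have T : S * (2 * S) <= S * (#|X|%:R * (d%:R * B)).
  by move: P Q; move: (\sum_k _) => q P Q; lra.
have [->|Sn0] := eqVneq S 0; first by apply: mulr_ge0; [exact: ltW|exact: mulr_ge0].
have Sp : 0 < S by rewrite lt_neqAle eq_sym Sn0.
move: T; rewrite ler_pM2l// => T; lra.
Qed.

Definition pavg (i : 'I_d) c k : R := N%:R^-1 * \sum_(j < N) c (k + e i *+ j).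

Lemma pavg_le i c1 c2 k : (forall m, c1 m <= c2 m) -> pavg i c1 k <= pavg i c2 k.
Proof.
by move=> H; rewrite ler_wpM2l ?invr_ge0//; apply: ler_sum => j _; exact: H.
Qed.

Lemma pavgD i c1 c2 k :
  pavg i (fun m => c1 m + c2 m) k = pavg i c1 k + pavg i c2 k.
Proof. by rewrite /pavg big_split mulrDr. Qed.

(** One-dimensional Sobolev inequality of type L^1: the value at [k] is compared with every other
    value on its coordinate circle by telescoping, and the comparison is averaged over the
    circle. *)
Lemma le_pavg i c k :
  `|c k| <= pavg i (fun m => `|c m|) k + pavg i (fun m => `|gdiff i c m|) k.
Proof.
have H (j : 'I_N) : `|c k| <= `|c (k + e i *+ j)| +
    N%:R^-1 * \sum_(l < N) `|gdiff i c (k + e i *+ l)|.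
  have -> : c k = c (k + e i *+ j) - \sum_(0 <= l < j) (c (k + e i *+ l.+1) - c (k + e i *+ l)).
    by rewrite telescope_sumr//= mulr0n addr0; ring.
  rewrite (le_trans (ler_normB _ _))// lerD2l (le_trans (ler_norm_sum _ _ _))//.
  rewrite mulr_sumr -(big_mkord predT (fun l => N%:R^-1 * `|gdiff i c (k + e i *+ l)|)).
  rewrite [leRHS](big_cat_nat _ (n := j))//=; last exact: ltnW.
  rewrite (@eq_bigr _ _ _ _ _ _ _ (fun l => N%:R^-1 * `|gdiff i c (k + e i *+ l)|)); last first.
    move=> l _; rewrite /gdiff normrM normr_nat mulKf//.
    by rewrite -addrA -mulrSr.
  by rewrite lerDl; apply: sumr_ge0 => l _; rewrite mulr_ge0// invr_ge0.
have -> : `|c k| = N%:R^-1 * \sum_(j < N) `|c k|.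
  by rewrite avgN.
rewrite {2}/pavg.
set M := _ * \sum_(j < N) `|gdiff _ _ _|.
have -> : M = N%:R^-1 * \sum_(j < N) M.
  by rewrite avgN.
by rewrite /pavg -mulrDr -big_split ler_wpM2l ?invr_ge0//; apply: ler_sum => j _; exact: H.
Qed.

Definition pavgs (I : seq 'I_d) c : X -> R := foldr pavg c I.

Lemma pavgsD I c1 c2 :
  pavgs I (fun m => c1 m + c2 m) = fun k => pavgs I c1 k + pavgs I c2 k.
Proof. by elim: I => //= i I ->; apply/funext => k; rewrite pavgD. Qed.

(** One direction at a time. Each direction either contributes a difference or does not, which is
    how the subsequences of [I] appear. *)
Lemma le_pavgs I c k :
  `|c k| <= pavgs I (fun m => \sum_(p <- subs I) `|gdiffs p c m|) k.
Proof.
elim: I c k => [|i I IH] c k /=; first by rewrite big_seq1.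
apply: (le_trans (le_pavg i c k)).
rewrite -pavgD; apply: pavg_le => m.
rewrite (_ : (fun _ => _) = fun m => \sum_(p <- subs I) `|gdiffs p c m| +
   \sum_(p <- subs I) `|gdiffs p (gdiff i c) m|); last first.
  by apply/funext => l; rewrite big_cat big_map.
rewrite pavgsD; apply: lerD; [exact: IH|exact: IH].
Qed.

Lemma pavgs_sum I c : \sum_k pavgs I c k = \sum_k c k.
Proof.
elim: I => //= i I <-; rewrite /pavg -mulr_sumr exchange_big/=.
under eq_bigr do rewrite (sum_translate (pavgs I c)).
by rewrite avgN.
Qed.

Lemma pavg_shift i c a k : pavg i c (k + a) = pavg i (fun m => c (m + a)) k.
Proof. by congr (_ * _); apply: eq_bigr => j _; rewrite addrAC. Qed.

Lemma pavg_invariant i c k : pavg i c (k + e i) = pavg i c k.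
Proof.
congr (_ * _).
(* The first term is split off one side and the last term off the other; by [eN] both equal
   [c k]. *)
have E : \sum_(j < N.+1) c (k + e i *+ j) = \sum_(j < N.+1) c (k + e i *+ j) by [].
rewrite {1}big_ord_recl big_ord_recr/= mulr0n addr0 eN addr0 in E.
apply: (addrI (c k)); rewrite [RHS]addrC -E; congr (_ + _).
by apply: eq_bigr => j _; rewrite /bump /= add1n mulrS addrA.
Qed.

Lemma pavgs_invariant I c i k : i \in I -> pavgs I c (k + e i) = pavgs I c k.
Proof.
elim: I k => //= j I IH k; rewrite inE => /orP[/eqP ->|iI].
  exact: pavg_invariant.
by rewrite pavg_shift; congr (pavg _ _ _); apply/funext => m; exact: IH.
Qed.

(** After averaging in every direction the function is invariant under all generators, hence
    constant by [gen]; averaging preserves the sum, which identifies the constant. *)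
Lemma pavgs_const c k : pavgs (enum 'I_d) c k = #|X|%:R^-1 * \sum_m c m.
Proof.
have H m : pavgs (enum 'I_d) c (k + m) = pavgs (enum 'I_d) c k.
  have [l _ ->] := gen m.
  elim: (index_enum _) => [|i I IH]; first by rewrite big_nil addr0.
  rewrite big_cons [_ + \sum_(j <- _) _]addrC addrA -IH.
  elim: (l i) => [|n IHn]; first by rewrite mulr0n addr0.
  by rewrite mulrSr addrA pavgs_invariant ?mem_enum.
rewrite -(pavgs_sum (enum 'I_d)) -(sum_translate _ k).
under eq_bigr do rewrite addrC H.
by rewrite avgX.
Qed.

Lemma sum_gdiffs c p : \sum_k c k = 0 -> \sum_k gdiffs p c k = 0.
Proof.
elim: p c => //= i p IH c c0; apply: IH.
by rewrite /gdiff -mulr_sumr sumrB sum_translate subrr mulr0.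
Qed.

Lemma glap_gdiffs c p : glap (gdiffs p c) = gdiffs p (glap c).
Proof.
elim: p c => //= i p IH c; rewrite IH; congr (gdiffs _ _).
apply/funext => k; rewrite /gdiff /glap -sumrB mulr_sumr; apply: eq_bigr => j _.
by rewrite [k + e j + _]addrAC [k - e j + _]addrAC; ring.
Qed.

Lemma size_subs I : size (subs I) = (2 ^ size I)%N.
Proof.
by elim: I => //= i I IH; rewrite size_cat size_map IH expnS mul2n addnn.
Qed.

(** [le_pavgs] reduces the value at [k] to the means of the square-free differences of [c]. These
    commute with [glap], so the Poincare inequality applies to each of the [2 ^ d] words and costs a
    factor [d]. *)
Theorem discrete_elliptic c (B : R) k : \sum_k c k = 0 ->
  (forall p, p \in subs (enum 'I_d) -> forall k, `|gdiffs p (glap c) k| <= B) ->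
  `|c k| <= (2 ^ d * d)%:R * B.
Proof.
move=> c0 HB; apply: (le_trans (le_pavgs (enum 'I_d) c k)).
have X0 : 0 < #|X|%:R :> R by rewrite ltr0n; apply/card_gt0P; exists 0.
rewrite pavgs_const exchange_big/= ler_pdivrMl//.
rewrite big_seq_cond.
apply: (@le_trans _ _ (\sum_(p <- subs (enum 'I_d) | (p \in subs (enum 'I_d)) && true)
   (#|X|%:R * (d%:R * B)))).
  apply: ler_sum => p; rewrite andbT => pI.
  by apply: poincare; [exact: sum_gdiffs|rewrite glap_gdiffs; exact: HB].
rewrite -big_seq_cond big_const_seq count_predT size_subs -cardE card_ord.
by rewrite iter_addr_0 natrM -[_ *+ _]mulr_natl; nra.
Qed.

Lemma sum_glap c : \sum_k glap c k = 0.
Proof.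
rewrite /glap exchange_big/= big1// => i _.
by rewrite -mulr_sumr sumrB big_split/= !sum_translate -mulr_sumr; ring.
Qed.

Lemma glap_adjoint c1 c2 : \sum_k c1 k * glap c2 k = \sum_k glap c1 k * c2 k.
Proof.
rewrite /glap; under eq_bigr do rewrite mulr_sumr.
under [RHS]eq_bigr do rewrite mulr_suml.
rewrite exchange_big [RHS]exchange_big/=; apply: eq_bigr => i _.
have E1 := sum_translate (fun k => N%:R ^+ 2 * (c1 k * c2 (k - e i))) (e i).
have E2 := sum_translate (fun k => N%:R ^+ 2 * (c1 (k - e i) * c2 k)) (e i).
apply/eqP; rewrite -subr_eq0 -sumrB.
transitivity ((\sum_k N%:R ^+ 2 * (c1 k * c2 (k - e i)) -
     \sum_k N%:R ^+ 2 * (c1 (k + e i) * c2 (k + e i - e i)))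
  + (\sum_k N%:R ^+ 2 * (c1 (k + e i - e i) * c2 (k + e i)) -
     \sum_k N%:R ^+ 2 * (c1 (k - e i) * c2 k)) == 0).
  congr (_ == _); rewrite -!sumrB -big_split; apply: eq_bigr => k _ /=; rewrite addrK; ring.
by rewrite E1 E2 !subrr addr0 eqxx.
Qed.

(** Linear algebra in place of an explicit kernel. The Poincare inequality with [B = 0] makes [glap]
    injective on functions of zero sum; subtracting the mean gives an injective operator on all
    functions, which is surjective in finite dimension. *)
Lemma discrete_green : exists G : X -> R, \sum_k G k = 0 /\
  forall k, glap G k = (k == 0)%:R - #|X|%:R^-1.
Proof.
pose F (c : {ffun X -> R^o}) : {ffun X -> R^o} :=
  [ffun k => glap c k - #|X|%:R^-1 * \sum_m c m].
have linF : linear F.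
  move=> a u v; apply/ffunP => k; rewrite !ffunE /= /glap.
  have S (b : R) (y : R^o) : b *: y = b * y by [].
  rewrite S mulrBr [a * \sum_i _]mulr_sumr addrACA -big_split/= -opprD; congr (_ - _).
    by apply: eq_bigr => i _; rewrite !ffunE !S; ring.
  rewrite [a * _]mulrCA -mulrDr; congr (_ * _); rewrite mulr_sumr -big_split/=.
  by apply: eq_bigr => i _; rewrite !ffunE.
pose FL : {linear {ffun X -> R^o} -> {ffun X -> R^o}} :=
  HB.pack F (@GRing.isLinear.Build R _ _ *:%R F linF).
have ker0 : lker (linfun FL) == 0%VS.
  apply/eqP/vspaceP => c; rewrite memv_ker memv0 lfunE/=; apply/eqP/eqP => [Fc0|->]; last first.
    by rewrite -[F 0]/(FL 0) linear0.
  have Ek k : glap c k = #|X|%:R^-1 * \sum_m c m.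
    by apply/eqP; rewrite -subr_eq0; move/ffunP : Fc0 => /(_ k); rewrite !ffunE => ->.
  have s0 : \sum_m c m = 0.
    have := sum_glap c; under eq_bigr do rewrite Ek.
    by rewrite sumX.
  have := @poincare c 0 s0; rewrite !mulr0 => H.
  have S0 : \sum_k `|c k| <= 0 by apply: H => k; rewrite Ek s0 mulr0 normr0.
  apply/ffunP => k; rewrite !ffunE; apply/eqP; rewrite -normr_le0.
  by apply: le_trans S0; rewrite (bigD1 k)//= lerDl sumr_ge0.
pose D : {ffun X -> R^o} := [ffun k => (k == 0)%:R - #|X|%:R^-1].
have : D \in limg (linfun FL) by rewrite (lker0_limgf ker0) memvf.
move=> /memv_imgP[G _]; rewrite lfunE/= => /ffunP E.
have Ek k : glap G k - #|X|%:R^-1 * \sum_m G m = (k == 0)%:R - #|X|%:R^-1.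
  by have := E k; rewrite !ffunE => ->.
(* Summing the equation over the group: [glap G] and the right-hand side both sum to zero, so the
   mean term vanishes as well. *)
have s0 : \sum_m G m = 0.
  have := eq_bigr _ (fun k (_ : true) => Ek k).
  move=> /(_ 0 +%R (index_enum X)).
  rewrite sumrB sum_glap sumX sub0r.
  have s1 : \sum_(k : X) #|X|%:R^-1 = 1 :> R.
    by rewrite -[RHS](sumX 1); apply: eq_bigr => k _; rewrite mulr1.
  have d1 : \sum_(k : X) (k == 0)%:R = 1 :> R.
    by rewrite (bigD1 0)//= eqxx big1 ?addr0// => k /negbTE ->.
  by rewrite sumrB s1 d1 subrr => /eqP; rewrite oppr_eq0 => /eqP.
by exists G; split=> // k; have := Ek k; rewrite s0 mulr0 subr0.
Qed.

End discrete_torus.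

Lemma finite_bound (R : realType) (T : eqType) (l : seq T) (P : T -> R -> Prop) :
  (forall p M M', M <= M' -> P p M -> P p M') ->
  (forall p, p \in l -> exists M, P p M) ->
  exists M, 0 <= M /\ forall p, p \in l -> P p M.
Proof.
move=> Pmono; elim: l => [|p l IH] H; first by exists 0.
have [M1 [M10 H1]] : exists M, 0 <= M /\ forall p, p \in l -> P p M.
  by apply: IH => q ql; apply: H; rewrite inE ql orbT.
have [M2 H2] := H p (mem_head _ _).
exists (Num.max M1 M2); split=> [|q]; first by rewrite le_max M10.
rewrite inE => /orP[/eqP ->|ql].
  by apply: Pmono H2; rewrite le_max lexx orbT.
by apply: Pmono (H1 q ql); rewrite le_max lexx.
Qed.

(** * Periodic functions *)

Section periodic_functions.
Context {R : realType} {d : nat}.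
Local Notation V := 'rV[R]_d.
Implicit Types (g f w : V -> R) (x y z v : V).

Definition torus_smooth g := Cinfty g /\ space_periodic g.

(** Congruence modulo the period lattice, encoded as indistinguishability by periodic functions.
    This form needs no quotient and can be used directly to rewrite under a periodic function. *)
Definition peq y z := forall g, space_periodic g -> forall x, g (x + y) = g (x + z).

Lemma peq_add y z y' z' : peq y z -> peq y' z' -> peq (y + y') (z + z').
Proof.
by move=> E E' g pg x; rewrite !addrA E'// [x + y + _]addrAC E// addrAC.
Qed.

Lemma peq_opp y z : peq y z -> peq (- y) (- z).
Proof.
move=> E g pg x; have := E g pg (x - y - z).
by rewrite subrK addrAC subrK => ->.
Qed.

Lemma peq_sum I (r : seq I) (P : pred I) (F G : I -> V) :
  (forall i, P i -> peq (F i) (G i)) ->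
  peq (\sum_(i <- r | P i) F i) (\sum_(i <- r | P i) G i).
Proof.
move=> H; elim: r => [|i r IH]; first by rewrite !big_nil => g _ x.
by rewrite !big_cons; case: ifP => // /H Pi; exact: peq_add.
Qed.

Lemma peq_period (m : int) i : peq ((2 * pi * m%:~R) *: ebase i) 0.
Proof.
have N (n : nat) : peq ((2 * pi * n%:R) *: ebase i) 0.
  move=> g pg x; elim: n => [|n IH]; first by rewrite mulr0 scale0r.
  by rewrite -(natr1 n) mulrDr mulr1 scalerDl addrA pg IH.
case: m => n; first exact: N.
by rewrite NegzE mulrNz mulrN scaleNr -[X in peq _ X]oppr0; apply: peq_opp; exact: N.
Qed.

Lemma peq_row y z :
  (forall i, exists m : int, y ord0 i - z ord0 i = 2 * pi * m%:~R) -> peq y z.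
Proof.
move=> /choice[m Hm].
suff : peq (z + (y - z)) (z + 0) by rewrite addrC subrK addr0.
apply: peq_add => //.
have : peq (\sum_i (y - z) ord0 i *: ebase i) (\sum_(i < d) (0 : V)).
  by apply: peq_sum => i _; rewrite !mxE Hm; exact: peq_period.
by rewrite -row_ebase big1.
Qed.

(** Serves twice: periodic functions are bounded by compactness of the cell, and the Sobolev
    inequality for [circle_measure] applies only at points of the cell. *)
Lemma cell_point x : exists y, (forall i, 0 <= y ord0 i <= 2 * pi) /\
  forall g, space_periodic g -> g x = g y.
Proof.
have p0 : 0 < 2 * pi :> R by rewrite mulr_gt0// pi_gt0.
pose m i := Num.floor (x ord0 i / (2 * pi)).
pose y : V := \row_i (x ord0 i - 2 * pi * (m i)%:~R).
exists y; split=> [i|g pg].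
  have /andP[H1 H2] := floor_itv (x ord0 i / (2 * pi)).
  rewrite ler_pdivlMr// in H1; rewrite ltr_pdivrMr// intrD mulrDl mul1r in H2.
  rewrite mxE /m mulrC subr_ge0 H1/= lerBlDl; exact: ltW.
rewrite -[x]add0r -[y]add0r; apply: peq_row => // i; exists (m i).
by rewrite mxE; ring.
Qed.

Lemma cell_compact : compact [set y : V | forall i, 0 <= y ord0 i <= 2 * pi].
Proof.
rewrite (_ : mkset _ = [set y : V | forall i, `[0, 2 * pi : R]%classic (y ord0 i)]).
  by apply: (@rV_compact _ d (fun=> `[0, 2 * pi : R]%classic)) => i; exact: segment_compact.
by apply/seteqP; split=> y /= H i; have := H i; rewrite /= in_itv/=.
Qed.

Lemma periodic_bounded g : continuous g -> space_periodic g ->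
  exists M, forall x, `|g x| <= M.
Proof.
move=> cg pg.
have : compact (g @` [set y : V | forall i, 0 <= y ord0 i <= 2 * pi]).
  by apply: continuous_compact; [exact: continuous_subspaceT|exact: cell_compact].
move=> /compact_bounded[M [_ HM]]; exists (M + 1) => x.
have [y [Hy E]] := cell_point x; rewrite E//; apply: (HM (M + 1)); first by rewrite ltrDl.
by exists y.
Qed.

Lemma torus_bounded g : torus_smooth g -> exists M, forall x, `|g x| <= M.
Proof. by case=> Cg pg; apply: periodic_bounded => //; exact: Cinfty_continuous. Qed.

Lemma derive_periodic g v : Cinfty g -> space_periodic g -> space_periodic ('D_v g).
Proof.
move=> Cg pg i x.
have /= <- := congr1 (@^~ x) (derive_shift ((2 * pi) *: ebase i) v Cg).
by rewrite (_ : (fun y => _) = g)//; apply/funext => y; exact: pg.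
Qed.

Lemma torus_derive g v : torus_smooth g -> torus_smooth ('D_v g).
Proof. by case=> Cg pg; split; [exact: Cinfty_derive|exact: derive_periodic]. Qed.

Lemma torus_derive_along g (s : seq V) : torus_smooth g -> torus_smooth (derive_along s g).
Proof. by move=> Tg; elim: s => //= v s; exact: torus_derive. Qed.

Lemma torusD f g : torus_smooth f -> torus_smooth g -> torus_smooth (f \+ g).
Proof.
by move=> [Cf pf] [Cg pg]; split; [exact: CinftyD|move=> i x/=; rewrite pf pg].
Qed.

Lemma torusM f g : torus_smooth f -> torus_smooth g -> torus_smooth (f \* g).
Proof.
by move=> [Cf pf] [Cg pg]; split; [exact: CinftyM|move=> i x/=; rewrite pf pg].
Qed.

Lemma torusZ (c : R) f : torus_smooth f -> torus_smooth (fun x => c * f x).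
Proof. by move=> [Cf pf]; split; [exact: CinftyZ|move=> i x/=; rewrite pf]. Qed.

Lemma torusB f g : torus_smooth f -> torus_smooth g -> torus_smooth (fun x => f x - g x).
Proof.
by move=> [Cf pf] [Cg pg]; split; [exact: CinftyB|move=> i x/=; rewrite pf pg].
Qed.

Lemma torus_cst (c : R) : torus_smooth (fun=> c).
Proof. by split=> [|i x//]; exact: Cinfty_cst. Qed.

Lemma torus_sum I (r : seq I) (F : I -> V -> R) :
  (forall i, torus_smooth (F i)) -> torus_smooth (fun x => \sum_(i <- r) F i x).
Proof.
move=> TF; split; first by apply: Cinfty_sum => i _; have [] := TF i.
by move=> i x; apply: eq_bigr => j _; have [_ ->] := TF j.
Qed.

Lemma torus_shift g v : torus_smooth g -> torus_smooth (fun x => g (x + v)).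
Proof.
move=> [Cg pg]; split; first exact: Cinfty_shift.
by move=> i x; rewrite addrAC pg.
Qed.

Lemma laplacianE g : laplacian g = fun x => \sum_(i < d) 'D_(ebase i) ('D_(ebase i) g) x.
Proof. by []. Qed.

Lemma torus_laplacian g : torus_smooth g -> torus_smooth (laplacian g).
Proof. by move=> Tg; apply: torus_sum => i; do 2 apply: torus_derive. Qed.

Lemma derive_along_laplacian g (s : seq V) : torus_smooth g ->
  derive_along s (laplacian g) = laplacian (derive_along s g).
Proof.
move=> [Cg _]; rewrite laplacianE derive_along_sum.
  apply/funext => x; apply: eq_bigr => i _.
  rewrite derive_along_derive; last exact: Cinfty_derive.
  by rewrite derive_along_derive.
by move=> i _; do 2 apply: Cinfty_derive.
Qed.

Lemma row_lipschitz f (B : R) x v : Cinfty f -> (forall i y, `|partial i f y| <= B) ->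
  `|f (x + v) - f x| <= B * \sum_i `|v ord0 i|.
Proof.
move=> Cf HB.
have [s _] := @mean_value_abs _ _ f x v 1 (fun s => @Cinfty_derivable _ _ f _ _ Cf).
rewrite scale1r mulr1 => ->; rewrite derive_row; last exact: Cinfty_differentiable.
apply: (le_trans (ler_norm_sum _ _ _)); rewrite mulr_sumr; apply: ler_sum => i _.
by rewrite normrM mulrC ler_wpM2r.
Qed.

Lemma Cinfty_diff_quot (h : R) v f : Cinfty f -> Cinfty (diff_quot h v f).
Proof.
move=> Cf; rewrite (_ : diff_quot h v f = fun x => h^-1 * (f (x + h *: v) - f x)).
  by apply: CinftyZ; apply: CinftyB => //; exact: Cinfty_shift.
by apply/funext => x; rewrite /diff_quot mulrC.
Qed.

Lemma derive_diff_quot (h : R) v u f : Cinfty f ->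
  'D_u (diff_quot h v f) = diff_quot h v ('D_u f).
Proof.
move=> Cf.
have C1 := Cinfty_shift (h *: v) Cf.
have -> : diff_quot h v f = fun x => h^-1 * (f (x + h *: v) - f x).
  by apply/funext => x; rewrite /diff_quot mulrC.
apply/funext => x; rewrite deriveZx; last exact: CinftyB.
by rewrite deriveBx// derive_shiftx// /diff_quot mulrC.
Qed.

(** The central second difference at [x] is the forward quotient taken twice at [x - h *: v]. The
    three errors of size [B * h] come from the inner quotient, from the outer quotient and from the
    shift of the base point. *)
Lemma second_diff_derive (h B : R) v f x : 0 < h -> Cinfty f ->
  (forall y, `|'D_v ('D_v ('D_v f)) y| <= B) ->
  `|(f (x + h *: v) + f (x - h *: v) - 2 * f x) / h ^+ 2 - 'D_v ('D_v f) x| <= 3 * h * B.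
Proof.
move=> h0 Cf HB; have hn0 : h != 0 by rewrite gt_eqF.
pose y := x - h *: v.
have -> : (f (x + h *: v) + f (x - h *: v) - 2 * f x) / h ^+ 2 =
    diff_quot h v (diff_quot h v f) y.
  by rewrite /diff_quot /y subrK; field.
have C1 := Cinfty_derive v Cf; have C2 := Cinfty_derive v C1.
have H1 z : `|diff_quot h v ('D_v f) z - 'D_v ('D_v f) z| <= B * h.
  exact: diff_quot_derive.
(* The quotient of the error function is bounded by the derivative of that function, and this
   derivative is the error estimated in [H1]. *)
have H2 : `|diff_quot h v (fun z => diff_quot h v f z - 'D_v f z) y| <= B * h.
  have CB : Cinfty (fun z => diff_quot h v f z - 'D_v f z).
    by apply: CinftyB => //; exact: Cinfty_diff_quot.
  apply: diff_quot_le => // z; first exact: Cinfty_derivable.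
  have -> : 'D_v (fun z => diff_quot h v f z - 'D_v f z) z =
     diff_quot h v ('D_v f) z - 'D_v ('D_v f) z.
    rewrite deriveBx//; last exact: Cinfty_diff_quot.
    by rewrite (congr1 (@^~ z) (derive_diff_quot h v v Cf)).
  exact: H1.
have H3 : `|'D_v ('D_v f) (y + h *: v) - 'D_v ('D_v f) y| <= B * h.
  apply: (@mean_value_le _ _ ('D_v ('D_v f)) y v h B (ltW h0)) => s; last by move=> _; exact: HB.
  exact: Cinfty_derivable.
rewrite /y subrK -/y in H3.
have := H1 y; move: H2 H3.
have -> : diff_quot h v (fun z => diff_quot h v f z - 'D_v f z) y =
   diff_quot h v (diff_quot h v f) y - diff_quot h v ('D_v f) y.
  by rewrite /diff_quot; field.
move: (diff_quot h v (diff_quot h v f) y) (diff_quot h v ('D_v f) y)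
  ('D_v ('D_v f) x) ('D_v ('D_v f) y) => a b c e.
have -> : 3 * h * B = B * h + B * h + B * h by ring.
move: (B * h) => t; clear; rewrite !ler_norml.
by move=> /andP[? ?] /andP[? ?] /andP[? ?]; apply/andP; split; lra.
Qed.

(** Finite combinations of translates. They commute with derivatives, with the grid Laplacian and
    with one another; grid averages and grid solutions are instances, and these commutations carry
    the convergence proof. *)
Definition sop (I : finType) (c : I -> R) (b : I -> V) g x : R :=
  \sum_(i : I) c i * g (x + b i).

Lemma sop_torus (I : finType) (c : I -> R) b g : torus_smooth g -> torus_smooth (sop c b g).
Proof. by move=> Tg; apply: torus_sum => i; apply: torusZ; exact: torus_shift. Qed.

Lemma derive_along_sop (I : finType) (c : I -> R) b g s : torus_smooth g ->
  derive_along s (sop c b g) = sop c b (derive_along s g).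
Proof.
move=> [Cg _]; rewrite /sop derive_along_sum.
  apply/funext => x; apply: eq_bigr => i _.
  rewrite derive_alongZ; last exact: Cinfty_shift.
  by rewrite derive_along_shift.
by move=> i _; apply: CinftyZ; exact: Cinfty_shift.
Qed.

Lemma sopC (I J : finType) (c : I -> R) b (c' : J -> R) b' g :
  sop c b (sop c' b' g) = sop c' b' (sop c b g).
Proof.
apply/funext => x; rewrite /sop.
under eq_bigr do rewrite mulr_sumr; rewrite exchange_big/=.
apply: eq_bigr => j _; rewrite mulr_sumr; apply: eq_bigr => i _.
by rewrite mulrCA [x + b i + _]addrAC.
Qed.

Lemma sop_sum (I : finType) (c : I -> R) b J (r : seq J) (F : J -> V -> R) :
  sop c b (fun x => \sum_(j <- r) F j x) = fun x => \sum_(j <- r) sop c b (F j) x.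
Proof.
apply/funext => x; rewrite /sop exchange_big; apply: eq_bigr => i _.
by rewrite mulr_sumr.
Qed.

Lemma sopB (I : finType) (c : I -> R) b f g :
  sop c b (fun x => f x - g x) = fun x => sop c b f x - sop c b g x.
Proof. by apply/funext => x; rewrite /sop -sumrB; apply: eq_bigr => i _; rewrite mulrBr. Qed.

Lemma sopZ (I : finType) (c : I -> R) b a g :
  sop c b (fun x => a * g x) = fun x => a * sop c b g x.
Proof.
by apply/funext => x; rewrite /sop mulr_sumr; apply: eq_bigr => i _; rewrite mulrCA.
Qed.

End periodic_functions.

(** * Finite-difference approximation *)

Section grid.
Context {R : realType} {d : nat}.
Local Notation V := 'rV[R]_d.
Variable n : nat.
Implicit Types (g f w : V -> R) (x y z v : V).

Local Notation grid := 'rV['I_n.+1]_d.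

Definition step : R := 2 * pi / n.+1%:R.
Definition pos (k : grid) : V := \row_i (step * (k ord0 i)%:R).
Definition gen (i : 'I_d) : grid := \row_j (if j == i then inZp 1 else 0).

Lemma step_gt0 : 0 < step.
Proof. by rewrite divr_gt0// mulr_gt0// pi_gt0. Qed.

Lemma stepN : n.+1%:R * step = 2 * pi.
Proof. by rewrite /step mulrC divfK. Qed.

Lemma posD (k l : grid) : peq (pos (k + l)) (pos k + pos l).
Proof.
apply: peq_row => i; rewrite !mxE /=.
set a := (k ord0 i : nat); set b := (l ord0 i : nat).
(* The number of full turns dropped by addition modulo [n.+1]. *)
exists (- (((a + b) %/ n.+1)%N%:Z)).
have := congr1 (fun m => m%:R : R) (divn_eq (a + b) n.+1).
rewrite natrD natrD natrM => E.
rewrite mulrNz -pmulrn -stepN -mulrDr E; ring.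
Qed.

Lemma pos_gen i : peq (pos (gen i)) (step *: ebase i).
Proof.
apply: peq_row => j; rewrite /ebase !mxE /=.
have [_|ji] := eqVneq j i; last by exists 0; rewrite /= !mulr0 subrr.
(* Nonzero only for [n = 0]: the grid is then one point, [gen i] is zero, and [step] is a full
   period. *)
exists (- ((1 %/ n.+1)%N%:Z)).
have := congr1 (fun m => m%:R : R) (divn_eq 1 n.+1).
rewrite natrD natrM => E; rewrite mulrNz -pmulrn -stepN /=.
rewrite [X in _ - step * X]E; ring.
Qed.

Lemma pos0 : pos 0 = 0.
Proof. by apply/rowP => i; rewrite !mxE mulr0. Qed.

Lemma gen_period i : gen i *+ n.+1 = 0.
Proof.
apply/rowP => j; rewrite mulmxnE !mxE; case: ifP => _; last by rewrite mul0rn.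
by rewrite Zp_mulrn; apply/val_inj => /=; rewrite modnMl.
Qed.

Lemma gen_generates (m : grid) : exists2 k : 'I_d -> nat,
  (forall i, k i <= n.+1)%N & m = \sum_i gen i *+ k i.
Proof.
exists (fun i => m ord0 i : nat) => [i|]; first exact/ltnW/ltn_ord.
apply/rowP => j; rewrite summxE (bigD1 j)//= big1 => [|i ij].
  rewrite addr0 mulmxnE !mxE eqxx Zp_mulrn; apply/val_inj => /=.
  by rewrite modnMml mul1n modn_small.
by rewrite mulmxnE !mxE eq_sym (negbTE ij) mul0rn.
Qed.

Definition grid_green : grid -> R :=
  sval (cid (discrete_green gen_generates)).

Definition grid_avg g : V -> R := sop (fun=> #|{: grid}|%:R^-1) pos g.
(** Convolution with the discrete Green function on the translate of the grid through the argument.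
    It is thus defined at every point of the torus, not only on one grid, and inherits smoothness
    from [g]. The factor [(2 * pi) ^+ 2] converts the mesh [1 / n.+1] of [glap] to the mesh [step]
    of [grid_lap]. *)
Definition grid_sol g : V -> R := sop (fun k => (2 * pi) ^+ 2 * grid_green k) pos g.
Definition grid_lap g x : R :=
  \sum_i (g (x + step *: ebase i) + g (x - step *: ebase i) - 2 * g x) / step ^+ 2.

Definition sample g x (k : grid) : R := g (x + pos k).

Lemma sample_gen g x k i : space_periodic g ->
  sample g x (k + gen i) = g (x + pos k + step *: ebase i).
Proof.
by move=> pg; rewrite /sample (posD k (gen i))// addrA (pos_gen i).
Qed.

Lemma sample_genN g x k i : space_periodic g ->
  sample g x (k - gen i) = g (x + pos k - step *: ebase i).
Proof.
move=> pg; rewrite /sample.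
have := @posD (k - gen i) (gen i) g pg (x - step *: ebase i).
rewrite subrK addrA (pos_gen i)// [x - _ + pos k]addrAC => ->.
by rewrite [x - _ + _]addrAC subrK.
Qed.

Lemma glap_sample g x : space_periodic g ->
  glap gen n.+1 (sample g x) = sample (fun y => (2 * pi) ^+ 2 * grid_lap g y) x.
Proof.
move=> pg; apply/funext => k; rewrite /glap /sample /grid_lap mulr_sumr.
apply: eq_bigr => i _; rewrite -!/(sample g x _) sample_gen// sample_genN//.
have s0 : step != 0 by rewrite gt_eqF// step_gt0.
by rewrite -stepN /sample; field.
Qed.

Lemma gdiff_sample g x i : space_periodic g ->
  gdiff gen n.+1 i (sample g x) = sample (fun y => 2 * pi * diff_quot step (ebase i) g y) x.
Proof.
move=> pg; apply/funext => k; rewrite /gdiff sample_gen// /sample /diff_quot.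
have s0 : step != 0 by rewrite gt_eqF// step_gt0.
by rewrite -stepN; field.
Qed.

Lemma torus_diff_quot i g : torus_smooth g ->
  torus_smooth (fun y => 2 * pi * diff_quot step (ebase i) g y).
Proof.
move=> [Cg pg]; apply: torusZ; split; first exact: Cinfty_diff_quot.
by move=> j x; rewrite /diff_quot pg addrAC pg.
Qed.

(** A discrete difference of a sample is the sample of a difference quotient, which the mean value
    theorem bounds by a derivative. Quotients commute with derivatives, so the induction can absorb
    one letter into [g]. *)
Lemma gdiffs_sample_le p g x (B : R) : torus_smooth g ->
  (forall y, `|derive_along (map ebase p) g y| <= B) ->
  forall k, `|gdiffs gen n.+1 p (sample g x) k| <= (2 * pi) ^+ size p * B.
Proof.
elim: p g B => [|i p IH] g B Tg HB k; first by rewrite expr0 mul1r; exact: HB.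
have [Cg pg] := Tg.
rewrite /= gdiff_sample// exprSr -[_ * _ * B]mulrA.
apply: (IH _ _ (torus_diff_quot i Tg)) => y; rewrite derive_alongZ; last exact: Cinfty_diff_quot.
have p0 : 0 <= 2 * pi :> R by rewrite mulr_ge0// pi_ge0.
rewrite normrM (ger0_norm p0) ler_wpM2l//.
have -> : derive_along (map ebase p) (diff_quot step (ebase i) g) =
    diff_quot step (ebase i) (derive_along (map ebase p) g).
  elim: p {IH HB} => //= j p ->; apply: derive_diff_quot.
  exact: Cinfty_derive_along.
apply: diff_quot_le; [exact: step_gt0| |exact: HB].
by move=> z; apply: Cinfty_derivable; exact: Cinfty_derive_along.
Qed.

Lemma torus_grid_lap g : torus_smooth g -> torus_smooth (grid_lap g).
Proof.
move=> Tg; apply: torus_sum => i.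
rewrite (_ : (fun x => _) = fun x => step ^- 2 * (g (x + step *: ebase i) +
   g (x - step *: ebase i) - 2 * g x)); last by apply/funext => x; rewrite mulrC.
apply: torusZ; apply: torusB; last exact: torusZ.
by apply: torusD; exact: torus_shift.
Qed.

Lemma derive_along_grid_lap g (s : seq V) : torus_smooth g ->
  derive_along s (grid_lap g) = grid_lap (derive_along s g).
Proof.
move=> Tg; elim: s => //= v s ->.
have [Cg _] := torus_derive_along s Tg.
move: (derive_along s g) Cg => {Tg}g Cg; apply/funext => x.
have C1 (b : V) : Cinfty (fun x => g (x + b)) by exact: Cinfty_shift.
have C2 := CinftyZ 2 Cg.
have C3 i : Cinfty (fun x => g (x + step *: ebase i) + g (x - step *: ebase i)).
  exact: CinftyD.
have -> : grid_lap g = fun x => \sum_i step ^- 2 * (g (x + step *: ebase i) +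
   g (x - step *: ebase i) - 2 * g x).
  by apply/funext => y; apply: eq_bigr => i _; rewrite mulrC.
rewrite derive_sumx; last by move=> i _; apply: CinftyZ; exact: CinftyB.
apply: eq_bigr => i _; rewrite deriveZx; last exact: CinftyB.
by rewrite deriveBx// deriveDx// !derive_shiftx// deriveZx// mulrC.
Qed.

Lemma sop_grid_lap (I : finType) (c : I -> R) b g :
  grid_lap (sop c b g) = sop c b (grid_lap g).
Proof.
apply/funext => x; rewrite /grid_lap /sop.
under [RHS]eq_bigr do rewrite mulr_sumr.
rewrite exchange_big/=; apply: eq_bigr => i _.
rewrite -big_split/= [2 * _]mulr_sumr -sumrB mulr_suml; apply: eq_bigr => j _.
by rewrite [x + _ *: _ + b j]addrAC [x - _ *: _ + b j]addrAC; ring.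
Qed.

Lemma grid_avg_gen g x i : space_periodic g ->
  grid_avg g (x + step *: ebase i) = grid_avg g x.
Proof.
move=> pg; rewrite /grid_avg /sop -!mulr_sumr; congr (_ * _).
have := @sum_translate R grid (sample g x) (gen i).
rewrite /sample => <-; apply: eq_bigr => k _.
by rewrite -!/(sample g x _) sample_gen// addrAC.
Qed.

Lemma grid_lap_avg g : space_periodic g -> grid_lap (grid_avg g) = fun=> 0.
Proof.
move=> pg; apply/funext => x; rewrite /grid_lap big1// => i _.
have := @grid_avg_gen g (x - step *: ebase i) i pg; rewrite subrK => <-.
by rewrite grid_avg_gen//; ring.
Qed.

Lemma sum_sample g x : \sum_k sample g x k = #|{: grid}|%:R * grid_avg g x.
Proof.
rewrite /grid_avg /sop -mulr_sumr mulVKf// pnatr_eq0 -lt0n.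
by apply/card_gt0P; exists 0.
Qed.

(** [2 ^ d * d] is the constant of [discrete_elliptic]. Two powers of [2 * pi] come from rescaling
    the Laplacian, and at most [d] from the differences in a square-free word. *)
Definition elliptic_cst : R := (2 ^ d * d)%:R * (2 * pi) ^+ d.+2.

Lemma elliptic_cst_ge0 : 0 <= elliptic_cst.
Proof. by rewrite mulr_ge0// exprn_ge0// mulr_ge0// pi_ge0. Qed.

Lemma subs_size (I : seq 'I_d) p : p \in subs I -> (size p <= size I)%N.
Proof.
elim: I p => [|i I IH] p /=; first by rewrite inE => /eqP ->.
rewrite mem_cat => /orP[/IH /leq_trans|/mapP[q /IH qI ->]] //; exact.
Qed.

(** The discrete estimate on the grid through [x]. The constant does not depend on [n], so the mesh
    may tend to zero. *)
Lemma grid_elliptic w x (B : R) : torus_smooth w -> grid_avg w x = 0 ->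
  (forall p, p \in subs (enum 'I_d) -> forall y,
     `|derive_along (map ebase p) (grid_lap w) y| <= B) ->
  `|w x| <= elliptic_cst * B.
Proof.
move=> Tw w0 HB.
have p1 : 1 <= 2 * pi :> R.
  by have := @pi_ge2 R; lra.
have B0 : 0 <= B.
  have : [::] \in subs (enum 'I_d).
    by elim: (enum 'I_d) => //= i I IH; rewrite mem_cat IH.
  by move=> /HB /(_ 0); exact: le_trans.
have [Cw pw] := Tw.
have -> : w x = sample w x 0 by rewrite /sample pos0 addr0.
rewrite /elliptic_cst -mulrA.
apply: (discrete_elliptic (ltn0Sn n) gen_period gen_generates).
  by rewrite sum_sample w0 mulr0.
move=> p pI k; rewrite glap_sample//.
have Tl := torus_grid_lap Tw.
apply: (@le_trans _ _ ((2 * pi) ^+ size p * ((2 * pi) ^+ 2 * B))).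
  apply: gdiffs_sample_le; first exact: torusZ.
  move=> y; rewrite derive_alongZ; last by have [] := Tl.
  rewrite normrM ger0_norm ?exprn_ge0 ?(le_trans ler01)//.
  by rewrite ler_wpM2l ?exprn_ge0 ?(le_trans ler01)//; exact: HB.
rewrite mulrA ler_wpM2r// -exprD ler_weXn2l// addn2 !ltnS.
by have := subs_size pI; rewrite size_enum_ord.
Qed.

(** By symmetry [glap] moves from the sample of [g] onto the Green function, where it is a point
    mass minus its mean. *)
Lemma grid_lap_sol g x : torus_smooth g ->
  grid_lap (grid_sol g) x = g x - grid_avg g x.
Proof.
move=> [Cg pg]; rewrite /grid_sol sop_grid_lap /sop.
rewrite (eq_bigr (fun k => grid_green k * glap gen n.+1 (sample g x) k)).
  rewrite glap_adjoint /grid_green.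
  case: (cid _) => G [_ HG] /=.
  under eq_bigr do rewrite HG mulrBl.
  rewrite sumrB (bigD1 0)//= eqxx mul1r big1 ?addr0 => [|k /negbTE ->]; last by rewrite mul0r.
  by rewrite /sample pos0 addr0.
by move=> k _; rewrite glap_sample// /sample; ring.
Qed.

Lemma grid_avg_translate g x k : space_periodic g ->
  grid_avg g (x + pos k) = grid_avg g x.
Proof.
move=> pg; rewrite /grid_avg /sop -!mulr_sumr; congr (_ * _).
rewrite -(@sum_translate R grid (fun l => g (x + pos l)) k).
by apply: eq_bigr => l _; rewrite (posD l k)// addrA addrAC.
Qed.

Lemma grid_avg_sol g x : torus_smooth g -> grid_avg (grid_sol g) x = 0.
Proof.
move=> [Cg pg]; rewrite /grid_avg /grid_sol sopC -/(grid_avg g) /sop.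
under eq_bigr do rewrite grid_avg_translate//.
rewrite -mulr_suml -mulr_sumr /grid_green.
by case: (cid _) => G [G0 _] /=; rewrite G0 mulr0 mul0r.
Qed.

Lemma grid_avg_le g (B : R) x : (forall k, `|g (x + pos k)| <= B) ->
  `|grid_avg g x| <= B.
Proof.
move=> HB; rewrite /grid_avg /sop -mulr_sumr normrM normfV normr_nat.
rewrite ler_pdivrMl ?ltr0n; last by apply/card_gt0P; exists 0.
apply: (le_trans (ler_norm_sum _ _ _)).
apply: (@le_trans _ _ (\sum_(k : grid) B)); first by apply: ler_sum => k _.
by rewrite sumr_const mulr_natl.
Qed.

Lemma grid_avg_cst (c : R) x : grid_avg (fun=> c) x = c.
Proof.
rewrite /grid_avg /sop -mulr_sumr sumr_const -(mulr_natl c) mulKf// pnatr_eq0 -lt0n.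
by apply/card_gt0P; exists 0.
Qed.

Lemma grid_sol_le g x (B : R) : torus_smooth g ->
  (forall p, p \in subs (enum 'I_d) -> forall y,
     `|derive_along (map ebase p) g y| <= B) ->
  `|grid_sol g x| <= elliptic_cst * (2 * B).
Proof.
move=> Tg HB; apply: grid_elliptic; first exact: sop_torus.
  exact: grid_avg_sol.
move=> p pI y.
have Ts : torus_smooth (grid_sol g) by exact: sop_torus.
rewrite derive_along_grid_lap// derive_along_sop// grid_lap_sol; last first.
  exact: torus_derive_along.
apply: (le_trans (ler_normB _ _)); rewrite mulr_natl mulr2n lerD//; first exact: HB.
by apply: grid_avg_le => k; exact: HB.
Qed.

(** The average is invariant under grid steps, so the average of a difference quotient is zero. The
    derivative of the average is therefore the average of derivative minus quotient, of order
    [step]. This makes grid averages almost constant without comparing them with an integral. *)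
Lemma partial_grid_avg_le g i x (B : R) : torus_smooth g ->
  (forall y, `|partial i (partial i g) y| <= B) ->
  `|partial i (grid_avg g) x| <= B * step.
Proof.
move=> Tg HB; have [Cg pg] := Tg.
have -> : partial i (grid_avg g) = grid_avg (partial i g).
  exact: (@derive_along_sop _ _ _ _ _ _ [:: ebase i]).
have -> : grid_avg (partial i g) x =
    grid_avg (fun y => partial i g y - diff_quot step (ebase i) g y) x.
  rewrite /grid_avg sopB -!/(grid_avg _) (_ : grid_avg (diff_quot _ _ _) x = 0) ?subr0//.
  transitivity (diff_quot step (ebase i) (grid_avg g) x); last first.
    by rewrite /diff_quot grid_avg_gen// subrr mul0r.
  rewrite /diff_quot /grid_avg /sop -sumrB mulr_suml; apply: eq_bigr => k _.
  by rewrite [x + _ *: _ + _]addrAC; ring.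
apply: grid_avg_le => y; rewrite distrC; apply: diff_quot_derive => //.
exact: step_gt0.
Qed.

Lemma grid_avg_lipschitz g x v (B : R) : torus_smooth g ->
  (forall i y, `|partial i (partial i g) y| <= B) ->
  `|grid_avg g (x + v) - grid_avg g x| <= B * step * \sum_i `|v ord0 i|.
Proof.
move=> Tg HB; apply: row_lipschitz; first by have [] : torus_smooth (grid_avg g) by exact: sop_torus.
by move=> i y; exact: partial_grid_avg_le.
Qed.

Lemma grid_lap_laplacian g x (B : R) : torus_smooth g ->
  (forall i y, `|partial i (partial i (partial i g)) y| <= B) ->
  `|grid_lap g x - laplacian g x| <= d%:R * (3 * B) * step.
Proof.
move=> [Cg pg] HB; rewrite /grid_lap /laplacian -sumrB.
apply: (le_trans (ler_norm_sum _ _ _)).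
apply: (@le_trans _ _ (\sum_(i < d) 3 * step * B)).
  by apply: ler_sum => i _; apply: second_diff_derive; [exact: step_gt0|exact: Cg|exact: HB].
by rewrite sumr_const card_ord -[_ *+ d]mulr_natl; lra.
Qed.

Lemma pos_sum_le k : \sum_i `|pos k ord0 i| <= d%:R * (2 * pi).
Proof.
apply: (@le_trans _ _ (\sum_(i < d) (2 * pi))).
  apply: ler_sum => i _; rewrite mxE ger0_norm; last exact: mulr_ge0 (ltW step_gt0) (ler0n _ _).
  rewrite -stepN mulrC ler_wpM2r ?(ltW step_gt0)// ler_nat; exact: ltnW.
by rewrite sumr_const card_ord -[_ *+ d]mulr_natl.
Qed.

End grid.

Lemma cvg_step (R : realType) : (@step R) @ \oo --> (0 : R).
Proof.
rewrite -[X in _ --> X](mulr0 (2 * pi)).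
by apply: cvgM; [exact: cvg_cst|exact: cvg_harmonic].
Qed.

(** Letting [m] tend to infinity keeps the rate in [n]. A rate independent of the point of
    evaluation is what later makes the convergence uniform. *)
Lemma cauchy_rate (R : realType) (a h : nat -> R) (M : R) :
  h @ \oo --> (0 : R) -> 0 <= M ->
  (forall n m, `|a n - a m| <= M * (h n + h m)) ->
  exists l, a @ \oo --> l /\ forall n, `|a n - l| <= M * h n.
Proof.
move=> h0 M0 Ha.
have /cauchy_cvgP /cvg_ex[l al] : cauchy (a @ \oo).
  apply/cauchy_ballP => e e0.
  pose e' := e / (2 * (M + 1)).
  have e'0 : 0 < e' by rewrite divr_gt0// mulr_gt0// ltr_wpDl.
  move/cvgrPdist_lt : h0 => /(_ _ e'0) [N _ HN].
  exists (fun x => exists2 n, (N <= n)%N & x = a n, fun x => exists2 n, (N <= n)%N & x = a n).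
    by split; exists N => // n /= Nn; exists n.
  move=> [x y] /= [[n Nn ->] [m Nm ->]]; rewrite /ball/=.
  apply: (le_lt_trans (Ha n m)).
  have := HN n Nn; have := HN m Nm; rewrite /= !sub0r !normrN => Hm Hn.
  have S : h n + h m < 2 * e'.
    have := ler_norm (h n); have := ler_norm (h m); lra.
  apply: (@le_lt_trans _ _ (M * (2 * e'))); first by rewrite ler_wpM2l// ltW.
  have -> : M * (2 * e') = e * (M / (M + 1)).
    by rewrite /e'; field; rewrite gt_eqF// ltr_wpDl.
  by rewrite gtr_pMr// ltr_pdivrMr ?ltr_wpDl// mul1r ltrDl.
exists l; split=> // n.
rewrite -[h n]addr0.
apply: (@ler_cvg_to _ \oo _ _ (fun m => `|a n - a m|) (fun m => M * (h n + h m))).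
- by apply: cvg_norm; apply: cvgB => //; exact: cvg_cst.
- by apply: cvgM; [exact: cvg_cst|apply: cvgD => //; exact: cvg_cst].
- by near=> m; exact: Ha.
Unshelve. all: by end_near. Qed.

Lemma le0_of_rate (R : realType) (h : nat -> R) (a M : R) :
  h @ \oo --> (0 : R) -> (forall n, a <= M * h n) -> a <= 0.
Proof.
move=> h0 Ha; rewrite -(mulr0 M).
apply: (@ler_cvg_to _ \oo _ _ (fun=> a) (fun n => M * h n)).
- exact: cvg_cst.
- by apply: cvgM => //; exact: cvg_cst.
- by near=> n; exact: Ha.
Unshelve. all: by end_near. Qed.

(** * The Poisson equation on the torus *)

Section poisson.
Context {R : realType} {d : nat}.
Local Notation V := 'rV[R]_d.
Implicit Types (g f w : V -> R) (x y z v : V).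
Local Notation h := (@step R).
Local Notation K := (@elliptic_cst R d).

Lemma torus_bounds (l : seq (seq V)) g : torus_smooth g ->
  exists M, 0 <= M /\ forall s, s \in l -> forall x, `|derive_along s g x| <= M.
Proof.
move=> Tg; apply: (finite_bound (P := fun s M => forall x, `|derive_along s g x| <= M)).
  by move=> s M M' MM' H x; exact: le_trans (H x) MM'.
by move=> s _; apply: torus_bounded; exact: torus_derive_along.
Qed.

Lemma torus_bounds2 (l l' : seq (seq V)) g : torus_smooth g ->
  exists M, 0 <= M /\ forall s t, s \in l -> t \in l' -> forall x,
    `|derive_along s (derive_along t g) x| <= M.
Proof.
move=> Tg; have [M [M0 HM]] := torus_bounds (allpairs cat l l') Tg.
exists M; split=> // s t sl tl x; rewrite -derive_along_cat; apply: HM.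
by apply/allpairsP; exists (s, t).
Qed.

Definition elliptic_multi : seq (seq V) := map (map ebase) (subs (enum 'I_d)).

Lemma mem_elliptic p : p \in subs (enum 'I_d) -> map ebase p \in elliptic_multi.
Proof. exact: map_f. Qed.

Lemma grid_sol_bounded g : torus_smooth g ->
  exists M, 0 <= M /\ forall n x, `|grid_sol n g x| <= M.
Proof.
move=> Tg; have [M [M0 HM]] := torus_bounds elliptic_multi Tg.
exists (K * (2 * M)); split.
  by rewrite mulr_ge0 ?elliptic_cst_ge0// mulr_ge0.
by move=> n x; apply: grid_sol_le => // p pI; apply: HM; exact: mem_elliptic.
Qed.

Lemma grid_sol_bounds (l : seq (seq V)) g : torus_smooth g ->
  exists M, 0 <= M /\ forall s, s \in l -> forall n x, `|derive_along s (grid_sol n g) x| <= M.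
Proof.
move=> Tg; apply: (finite_bound (P := fun s M => forall n x, `|derive_along s (grid_sol n g) x| <= M)).
  by move=> s M M' MM' H n x; exact: le_trans (H n x) MM'.
move=> s _; have [M [_ HM]] := grid_sol_bounded (torus_derive_along s Tg).
by exists M => n x; rewrite derive_along_sop//; exact: HM.
Qed.

Lemma grid_avgB n f g x :
  grid_avg n (fun y => f y - g y) x = grid_avg n f x - grid_avg n g x.
Proof. exact: (congr1 (@^~ x) (sopB _ _ f g)). Qed.

(** Both averages are close to the double average over the two grids, which does not depend on the
    order because the two averages commute. *)
Lemma grid_avg_compare g n m x (M : R) : torus_smooth g -> 0 <= M ->
  (forall i y, `|partial i (partial i g) y| <= M) ->
  `|grid_avg n g x - grid_avg m g x| <= M * (d%:R * (2 * pi)) * (h n + h m).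
Proof.
move=> Tg M0 HM.
have H n' m' : `|grid_avg m' (grid_avg n' g) x - grid_avg n' g x| <= M * h n' * (d%:R * (2 * pi)).
  have -> : grid_avg m' (grid_avg n' g) x - grid_avg n' g x =
      grid_avg m' (fun y => grid_avg n' g y - grid_avg n' g x) x.
    by rewrite grid_avgB grid_avg_cst.
  apply: grid_avg_le => k; apply: (le_trans (grid_avg_lipschitz _ _ _ Tg HM)).
  by rewrite ler_wpM2l ?pos_sum_le// mulr_ge0// ltW// step_gt0.
have := H n m; have := H m n.
have -> : grid_avg n (grid_avg m g) = grid_avg m (grid_avg n g) by exact: sopC.
move: (grid_avg m _ x) (grid_avg n g x) (grid_avg m g x) (h n) (h m) => a b c p q.
clear; rewrite !ler_norml => /andP[? ?] /andP[? ?]; apply/andP; split; lra.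
Qed.

Lemma grid_lapB n f g : grid_lap n (fun x => f x - g x) =
  fun x => grid_lap n f x - grid_lap n g x.
Proof.
by apply/funext => x; rewrite /grid_lap -sumrB; apply: eq_bigr => i _; ring.
Qed.

Lemma grid_avg_idem n g x : space_periodic g ->
  grid_avg n (grid_avg n g) x = grid_avg n g x.
Proof.
move=> pg; rewrite -[RHS](@grid_avg_cst R d n _ x) {1 3}/grid_avg /sop.
by apply: eq_bigr => k _; congr (_ * _); exact: grid_avg_translate.
Qed.

(** The difference [w] of two grid solutions is split on the [m]-grid into its average and the rest.
    The rest is controlled by its grid Laplacian: both grid Laplacians of the [n]-solution are close
    to its Laplacian, with third derivatives bounded uniformly in [n] because derivation commutes
    with [grid_sol]. *)
Lemma grid_sol_cauchy g : torus_smooth g ->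
  exists M, 0 <= M /\ forall n m x,
    `|grid_sol n g x - grid_sol m g x| <= M * (h n + h m).
Proof.
move=> Tg; have [Cg pg] := Tg.
pose l2 : seq (seq V) := [seq [:: ebase i; ebase i] | i <- enum 'I_d].
pose l3 : seq (seq V) := [seq [:: ebase i; ebase i; ebase i] | i <- enum 'I_d].
have [M1 [M10 HM1]] := grid_sol_bounds (allpairs cat l3 elliptic_multi) Tg.
have [M2 [M20 HM2]] := torus_bounds2 l2 elliptic_multi Tg.
have [M3 [M30 HM3]] := grid_sol_bounds l2 Tg.
have m2 i : [:: ebase i; ebase i] \in l2 by apply/mapP; exists i; rewrite ?mem_enum.
have m3 i : [:: ebase i; ebase i; ebase i] \in l3 by apply/mapP; exists i; rewrite ?mem_enum.
pose D : R := d%:R * (2 * pi).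
have D0 : 0 <= D by rewrite mulr_ge0// mulr_ge0// pi_ge0.
pose B := d%:R * (3 * M1) + M2 * D.
have B0 : 0 <= B by rewrite addr_ge0// mulr_ge0// mulr_ge0.
exists (M3 * D + K * B); split.
  by rewrite addr_ge0// mulr_ge0// elliptic_cst_ge0.
move=> n m x.
have Tu k : torus_smooth (grid_sol k g) by exact: sop_torus.
pose w := fun y => grid_sol n g y - grid_sol m g y.
have Tw : torus_smooth w by exact: torusB.
have Tv : torus_smooth (grid_avg m w) by exact: sop_torus.
(* Each solution has zero average on its own grid, so only the discrepancy of two averages of one
   function remains. *)
have A1 : `|grid_avg m w x| <= M3 * D * (h n + h m).
  have -> : grid_avg m w x = grid_avg m (grid_sol n g) x - grid_avg n (grid_sol n g) x.
    by rewrite [grid_avg n _ x]grid_avg_sol// grid_avgB [grid_avg m (grid_sol m g) x]grid_avg_sol.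
  rewrite [h n + _]addrC; apply: grid_avg_compare => // i y.
  exact: (HM3 _ (m2 i) n y).
have A2 : `|w x - grid_avg m w x| <= K * (B * (h n + h m)).
  apply: (@grid_elliptic _ _ m (fun y => w y - grid_avg m w y)); first exact: torusB.
    rewrite grid_avgB.
    by rewrite grid_avg_idem ?subrr//; have [] := Tw.
  move=> p pI y.
  rewrite grid_lapB grid_lap_avg; last by have [] := Tw.
  rewrite (_ : (fun x => grid_lap m w x - 0) = grid_lap m w); last by apply/funext => z; rewrite subr0.
  rewrite derive_along_grid_lap//.
  set s := map ebase p; pose G := derive_along s g.
  have TG : torus_smooth G by exact: torus_derive_along.
  have TuG k : torus_smooth (grid_sol k G) by exact: sop_torus.
  have -> : derive_along s w = fun y => grid_sol n G y - grid_sol m G y.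
    have -> : w = (grid_sol n g) \+ (fun y => -1 * grid_sol m g y).
      by apply/funext => z; rewrite /w /= mulN1r.
    have [C1 _] := Tu n; have [C2 _] := Tu m.
    rewrite derive_alongD//; last exact: CinftyZ.
    rewrite derive_alongZ// !derive_along_sop//.
    by apply/funext => z /=; rewrite mulN1r.
  rewrite grid_lapB (grid_lap_sol m)//.
  have b1 k : `|grid_lap k (grid_sol n G) y - laplacian (grid_sol n G) y| <= d%:R * (3 * M1) * h k.
    apply: grid_lap_laplacian => // i z.
    have := HM1 ([:: ebase i; ebase i; ebase i] ++ s).
    move=> /(_ _ n z); rewrite derive_along_cat derive_along_sop// => H; apply: H.
    by apply/allpairsP; exists ([:: ebase i; ebase i; ebase i], s); split; [exact: m3|exact: mem_elliptic|by []].
  (* The two discrete equations are solved up to the averages of the right-hand side on different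
     grids; these differ by the order of the mesh. *)
  have b2 : `|grid_avg m G y - grid_avg n G y| <= M2 * D * (h m + h n).
    by apply: grid_avg_compare => // i z; apply: (HM2 _ _ (m2 i) (mem_elliptic pI)).
  have := b1 n; have := b1 m; rewrite grid_lap_sol//; move: b2; rewrite /B.
  move: (grid_lap m _ y) (laplacian _ y) (grid_avg m G y) (grid_avg n G y) (G y) (h n) (h m).
  move=> a b c e q p1 p2; clear; rewrite !ler_norml => /andP[? ?] /andP[? ?] /andP[? ?].
  by apply/andP; split; lra.
move: A1 A2; rewrite -/(w x).
have -> : (M3 * D + K * B) * (h n + h m) = M3 * D * (h n + h m) + K * (B * (h n + h m)) by ring.
move: (grid_avg m w x) (w x) (M3 * D * _) (K * _) => a b p q; clear.
rewrite !ler_norml => /andP[? ?] /andP[? ?]; apply/andP; split; lra.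
Qed.

Definition poisson_sol g x : R := lim (grid_sol n g x @[n --> \oo]).

Lemma poisson_sol_rate g : torus_smooth g ->
  exists M, forall n x, `|grid_sol n g x - poisson_sol g x| <= M * h n.
Proof.
move=> Tg; have [M [M0 HM]] := grid_sol_cauchy Tg.
exists M => n x; have [l [al Hl]] := cauchy_rate (@cvg_step R) M0 (fun n m => HM n m x).
by rewrite /poisson_sol (cvg_lim _ al).
Qed.

Lemma poisson_sol_cvg g x : torus_smooth g ->
  grid_sol n g x @[n --> \oo] --> poisson_sol g x.
Proof.
move=> Tg; have [M [M0 HM]] := grid_sol_cauchy Tg.
have [l [al Hl]] := cauchy_rate (@cvg_step R) M0 (fun n m => HM n m x).
by rewrite /poisson_sol (cvg_lim _ al).
Qed.

Lemma cvg_step_mul (M : R) : (fun n => M * h n) @ \oo --> (0 : R).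
Proof. by rewrite -(mulr0 M); apply: cvgM; [exact: cvg_cst|exact: cvg_step]. Qed.

Lemma poisson_sol_continuous g : torus_smooth g -> continuous (poisson_sol g).
Proof.
move=> Tg; have [M HM] := poisson_sol_rate Tg.
apply: (uniform_limit_continuous (cvg_step_mul M) HM) => n.
by apply: Cinfty_continuous; have [] : torus_smooth (grid_sol n g) by exact: sop_torus.
Qed.

Lemma poisson_sol_sum (I : Type) (r : seq I) (F : I -> V -> R) x :
  (forall i, torus_smooth (F i)) ->
  poisson_sol (fun y => \sum_(i <- r) F i y) x = \sum_(i <- r) poisson_sol (F i) x.
Proof.
move=> TF; apply: cvg_lim => //.
under eq_fun do rewrite /grid_sol (congr1 (@^~ x) (sop_sum _ _ _ _)).
by apply: cvg_bigsum => i; exact: poisson_sol_cvg.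
Qed.

Lemma poisson_solZ (a : R) g x : torus_smooth g ->
  poisson_sol (fun y => a * g y) x = a * poisson_sol g x.
Proof.
move=> Tg; apply: cvg_lim => //.
under eq_fun do rewrite /grid_sol (congr1 (@^~ x) (sopZ _ _ _ _)).
by apply: cvgM; [exact: cvg_cst|exact: poisson_sol_cvg].
Qed.

Lemma is_derive_poisson_sol g v x : torus_smooth g ->
  is_derive x v (poisson_sol g) (poisson_sol ('D_v g) x).
Proof.
move=> Tg; have TD := torus_derive v Tg.
have [M HM] := poisson_sol_rate TD.
apply: (uniform_limit_derive (F := fun n => grid_sol n g) (cvg_step_mul M)).
- by move=> y; exact: poisson_sol_cvg.
- by move=> n y; apply: Cinfty_derivable; have [] : torus_smooth (grid_sol n g) by exact: sop_torus.
- move=> n y; have E : 'D_v (grid_sol n g) = grid_sol n ('D_v g).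
    exact: (@derive_along_sop _ _ _ _ _ _ [:: v]).
  by rewrite (congr1 (@^~ y) E).
- exact: poisson_sol_continuous.
Qed.

Lemma derive_poisson_sol g v : torus_smooth g ->
  'D_v (poisson_sol g) = poisson_sol ('D_v g).
Proof. by move=> Tg; apply/funext => x; have [_ ->] := is_derive_poisson_sol v x Tg. Qed.

(** The derivative of a solution is the solution for the derivative of [g], so the solutions form a
    class closed under derivation. *)
Lemma poisson_sol_torus g : torus_smooth g -> torus_smooth (poisson_sol g).
Proof.
move=> Tg; split.
  apply: (Cinfty_coind (S := [set u | exists g, torus_smooth g /\ u = poisson_sol g])); last by exists g.
  move=> _ [{Tg}g [Tg ->]]; split=> [|u]; last first.
    by exists ('D_u g); split; [exact: torus_derive|exact: derive_poisson_sol].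
  apply: (partials_differentiable (G := fun i => poisson_sol (partial i g))).
    by move=> i; apply: poisson_sol_continuous; exact: torus_derive.
  move=> x v; have := is_derive_poisson_sol v x Tg.
  have -> // : poisson_sol ('D_v g) x = \sum_i v ord0 i * poisson_sol (partial i g) x.
  transitivity (poisson_sol (fun y => \sum_i v ord0 i * partial i g y) x).
    congr (poisson_sol _ x); apply/funext => y; apply: derive_row.
    by apply: Cinfty_differentiable; have [] := Tg.
  rewrite poisson_sol_sum; last by move=> i; apply: torusZ; exact: torus_derive.
  by apply: eq_bigr => i _; rewrite poisson_solZ//; exact: torus_derive.
move=> i x; rewrite /poisson_sol (_ : (fun n => grid_sol n g (x + _)) = fun n => grid_sol n g x)//.
apply/funext => n; by have [_ ->] : torus_smooth (grid_sol n g) by exact: sop_torus.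
Qed.

Lemma laplacian_poisson_sol g x : torus_smooth g ->
  laplacian (poisson_sol g) x = poisson_sol (laplacian g) x.
Proof.
move=> Tg; rewrite poisson_sol_sum; last by move=> i; do 2 apply: torus_derive.
apply: eq_bigr => i _; rewrite /partial derive_poisson_sol//.
by rewrite (congr1 (@^~ x) (derive_poisson_sol _ _))//; exact: torus_derive.
Qed.

Lemma grid_lap_rate g : torus_smooth g -> exists M, 0 <= M /\
  forall p, p \in subs (enum 'I_d) -> forall n x,
  `|derive_along (map ebase p) (fun y => grid_lap n g y - laplacian g y) x| <= M * h n.
Proof.
move=> Tg; have [Cg _] := Tg.
pose l3 : seq (seq V) := [seq [:: ebase i; ebase i; ebase i] | i <- enum 'I_d].
have m3 i : [:: ebase i; ebase i; ebase i] \in l3 by apply/mapP; exists i; rewrite ?mem_enum.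
have [M [M0 HM]] := torus_bounds2 l3 elliptic_multi Tg.
exists (d%:R * (3 * M)); split; first by rewrite mulr_ge0// mulr_ge0.
move=> p pI n x.
have [C1 _] := torus_grid_lap n Tg; have [C2 _] := torus_laplacian Tg.
have -> : (fun y => grid_lap n g y - laplacian g y) = grid_lap n g \+ (fun y => -1 * laplacian g y).
  by apply/funext => y; rewrite /= mulN1r.
rewrite derive_alongD//; last exact: CinftyZ.
rewrite derive_alongZ// derive_along_grid_lap// derive_along_laplacian//= mulN1r.
apply: grid_lap_laplacian; first exact: torus_derive_along.
by move=> i y; apply: (HM _ _ (m3 i) (mem_elliptic pI)).
Qed.

(** The Laplacian passes through [poisson_sol], and on the grid it may be replaced by [grid_lap],
    whose solution is exactly [g - grid_avg n g]. Hence the averages converge, and by their small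
    Lipschitz constant the limit is the same at every point. *)
Theorem poisson_existence g : torus_smooth g ->
  exists c : R, forall x, laplacian (poisson_sol g) x = g x - c.
Proof.
move=> Tg; have TL := torus_laplacian Tg.
have [M [M0 HM]] := grid_lap_rate Tg.
have Tn n : torus_smooth (fun y => laplacian g y - grid_lap n g y).
  by apply: torusB => //; exact: torus_grid_lap.
have lim_avg x : (fun n => g x - grid_avg n g x) @ \oo --> laplacian (poisson_sol g) x.
  rewrite laplacian_poisson_sol//.
  have S n : `|(g x - grid_avg n g x) - grid_sol n (laplacian g) x| <= K * (2 * (M * h n)).
    rewrite -grid_lap_sol// /grid_sol sop_grid_lap -(congr1 (@^~ x) (sopB _ _ _ _)).
    apply: grid_sol_le; first by apply: torusB => //; exact: torus_grid_lap.
    by move=> p pI y; exact: HM.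
  have : (fun n => (g x - grid_avg n g x) - grid_sol n (laplacian g) x) @ \oo --> (0 : R).
    apply/norm_cvg0P.
    apply: (@squeeze_cvgr _ _ _ _ (fun=> 0) (fun n => K * (2 * M) * h n)).
    - by near=> n; rewrite normr_ge0 /= (le_trans (S n))// !mulrA.
    - exact: cvg_cst.
    - exact: cvg_step_mul.
  move=> H; rewrite -[X in _ --> X]add0r.
  rewrite (_ : (fun n => _) = (fun n => (g x - grid_avg n g x) - grid_sol n (laplacian g) x)
     \+ (fun n => grid_sol n (laplacian g) x)); last by apply/funext => n /=; rewrite subrK.
  exact: cvgD H (@poisson_sol_cvg _ x TL).
have [M2 [M20 HM2]] := torus_bounds [seq [:: ebase i; ebase i] | i <- enum 'I_d] Tg.
(* This is the limit of the grid averages at 0. It is not identified with an integral here;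
   [inv_laplacianP] shows it to vanish for [g] of zero mean. *)
exists (g 0 - laplacian (poisson_sol g) 0) => x.
suff : (g x - laplacian (poisson_sol g) x) - (g 0 - laplacian (poisson_sol g) 0) = 0.
  by move/eqP; rewrite subr_eq0 => /eqP <-; rewrite opprB addrCA subrr addr0.
have L : (fun n => grid_avg n g x - grid_avg n g 0) @ \oo -->
   (g x - laplacian (poisson_sol g) x) - (g 0 - laplacian (poisson_sol g) 0).
  have H y : (fun n => grid_avg n g y) @ \oo --> g y - laplacian (poisson_sol g) y.
    rewrite (_ : (fun n => _) = (fun n => g y - (g y - grid_avg n g y))).
      by apply: cvgB => //; exact: cvg_cst.
    by apply/funext => n; rewrite opprB addrCA subrr addr0.
  by apply: cvgB; exact: H.
have L0 : (fun n => grid_avg n g x - grid_avg n g 0) @ \oo --> (0 : R).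
  apply/norm_cvg0P.
  apply: (@squeeze_cvgr _ _ _ _ (fun=> 0) (fun n => M2 * (\sum_i `|x ord0 i|) * h n)).
  - near=> n; rewrite normr_ge0 /= -[x in grid_avg n g x]add0r.
    rewrite mulrAC; apply: grid_avg_lipschitz => // i y.
    by apply: (HM2 [:: ebase i; ebase i]); apply/mapP; exists i; rewrite ?mem_enum.
  - exact: cvg_cst.
  - exact: cvg_step_mul.
exact: (cvg_unique _ L L0).
Unshelve. all: by end_near. Qed.

(** On the grid, [w] minus its average obeys the elliptic estimate with [B] enlarged by the
    consistency error, and the averages at [x] and [y] differ by the order of the mesh. A bound on
    the oscillation is the natural form, as constants have zero Laplacian. *)
Theorem poisson_bound w (B : R) x y : torus_smooth w ->
  (forall p, p \in subs (enum 'I_d) -> forall z,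
     `|derive_along (map ebase p) (laplacian w) z| <= B) ->
  `|w x - w y| <= 2 * (K * B).
Proof.
move=> Tw HB; have [Cw pw] := Tw.
have [M [M0 HM]] := grid_lap_rate Tw.
have [M2 [M20 HM2]] := torus_bounds [seq [:: ebase i; ebase i] | i <- enum 'I_d] Tw.
have HA n z : `|w z - grid_avg n w z| <= K * (B + M * h n).
  have Ta : torus_smooth (grid_avg n w) by exact: sop_torus.
  apply: (@grid_elliptic _ _ n (fun z => w z - grid_avg n w z)); first exact: torusB.
    rewrite grid_avgB.
    by rewrite grid_avg_idem ?subrr.
  move=> p pI u; rewrite grid_lapB grid_lap_avg//.
  rewrite (_ : (fun x => grid_lap n w x - 0) = grid_lap n w); last by apply/funext => q; rewrite subr0.
  have := HM p pI n u; have := HB p pI u.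
  have [C1 _] := torus_grid_lap n Tw; have [C2 _] := torus_laplacian Tw.
  have -> : (fun y => grid_lap n w y - laplacian w y) = grid_lap n w \+ (fun y => -1 * laplacian w y).
    by apply/funext => q; rewrite /= mulN1r.
  rewrite derive_alongD//; last exact: CinftyZ.
  rewrite derive_alongZ//= mulN1r => b1 b2.
  rewrite -[X in `|X|](subrK (derive_along (map ebase p) (laplacian w) u)) addrC [B + _]addrC.
  by apply: (le_trans (ler_normD _ _)); rewrite addrC lerD.
rewrite -subr_le0.
pose S := \sum_i `|(x - y) ord0 i|.
apply: (@le0_of_rate R _ _ (2 * (K * M) + M2 * S) (@cvg_step R)) => n.
have := HA n x; have := HA n y.
have : `|grid_avg n w (y + (x - y)) - grid_avg n w y| <= M2 * h n * S.
  apply: grid_avg_lipschitz => // i z.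
  by apply: (HM2 [:: ebase i; ebase i]); apply/mapP; exists i; rewrite ?mem_enum.
rewrite [y + _]addrC subrK.
move: (grid_avg n w x) (grid_avg n w y) (w x) (w y) (h n) (K) => a b p q t k; clear.
rewrite !ler_norml => /andP[? ?] /andP[? ?] /andP[? ?].
by rewrite lerBlDr ler_norml; apply/andP; split; lra.
Qed.

End poisson.

(** * Integration on product spaces *)

Section measurability.
Context {R : realType}.

(** The sigma-algebra on rows is generated by the coordinates, not by the topology. Rational boxes
    form a countable base of sets measurable in this sense, so open sets and continuous functions
    are measurable. *)
Definition rat_box n (p : 'rV[rat]_n * nat) : set 'rV[R]_n :=
  [set y | forall i, `|y ord0 i - ratr (p.1 ord0 i)| < p.2.+1%:R^-1].

Lemma measurable_rat_box n (p : 'rV[rat]_n * nat) : measurable (rat_box p).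
Proof.
rewrite (_ : rat_box p = \bigcap_(i in [set: 'I_n])
    (row_coord i @^-1` ball (ratr (p.1 ord0 i) : R) (p.2.+1%:R^-1 : R))).
  apply: fin_bigcap_measurable => // i _.
  rewrite -[X in measurable X]setTI; apply: measurable_row_coord => //.
  by apply: open_measurable; exact: ball_open.
apply/seteqP; split=> y /= H i.
  by move=> _; rewrite /ball/= distrC; exact: H.
by have := H i I; rewrite /ball/= distrC.
Qed.

Lemma rat_box_mem n (y : 'rV[R]_n) k : exists q, rat_box (q, k) y.
Proof.
have H i : exists q : rat, `|y ord0 i - ratr q| < k.+1%:R^-1.
  have [|q] := @rat_in_itvoo R (y ord0 i - k.+1%:R^-1) (y ord0 i + k.+1%:R^-1).
    by rewrite ltrBlDr -addrA ltrDl addr_gt0// invr_gt0.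
  rewrite in_itv/= => /andP[q1 q2]; exists q; rewrite ltr_norml.
  move: q1 q2; move: (ratr q : R) (k.+1%:R^-1 : R) (y ord0 i) => a e b; clear => q1 q2.
  by apply/andP; split; lra.
move/choice : H => [q Hq].
by exists (\row_i q i) => i /=; rewrite mxE.
Qed.

Lemma rat_box_dist n (y z : 'rV[R]_n) p : rat_box p y -> rat_box p z ->
  `|y - z| <= 2 * p.2.+1%:R^-1.
Proof.
move=> Hy Hz; rewrite [leLHS]/Num.norm/= mx_normrE; apply/bigmax_leP; split.
  by rewrite mulr_ge0// invr_ge0.
move=> [i j] _ /=; rewrite ord1 !mxE; have := Hy j; have := Hz j.
move: (y _ _) (z _ _) (ratr _) (_^-1) => a b c e; clear.
by rewrite !ltr_norml ler_norml => /andP[? ?] /andP[? ?]; apply/andP; split; lra.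
Qed.

Lemma small_inv (e : R) : 0 < e -> exists k : nat, 2 * k.+1%:R^-1 < e.
Proof.
move=> e0; have e2 : 0 < e / 2 by rewrite divr_gt0.
have [k _ /(_ k (leqnn k)) /= H] := near_infty_natSinv_lt (PosNum e2).
by exists k; rewrite mulrC -ltr_pdivlMr.
Qed.

Lemma open_measurable_row n (U : set 'rV[R]_n) : open U -> measurable U.
Proof.
move=> oU; pose F p := if `[< rat_box p `<=` U >] then rat_box p else set0.
rewrite (_ : U = \bigcup_p F p).
  apply: countable_bigcupT_measurable; first exact: countableP.
  by move=> p; rewrite /F; case: ifP => _; [exact: measurable_rat_box|exact: measurable0].
apply/seteqP; split=> [y Uy|y [p _]]; last first.
  by rewrite /F; case: asboolP => // H /H.
have /nbhs_ballP[e /= e0 He] := open_nbhs_nbhs (conj oU Uy : open_nbhs y U).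
have [k Hk] := small_inv e0.
have [q Hq] := rat_box_mem y k.
exists (q, k) => //; rewrite /F; case: asboolP => // nH; exfalso; apply: nH => z Hz.
apply: He; rewrite -ball_normE /ball_/=.
exact: le_lt_trans (rat_box_dist Hq Hz) Hk.
Qed.

Lemma open_measurable_phase n (U : set ('rV[R]_n * 'rV[R]_n)) : open U -> measurable U.
Proof.
move=> oU; pose B (p : 'rV[rat]_n * 'rV[rat]_n * nat) : set ('rV[R]_n * 'rV[R]_n) :=
  rat_box (p.1.1, p.2) `*` rat_box (p.1.2, p.2).
pose F p := if `[< B p `<=` U >] then B p else set0.
rewrite (_ : U = \bigcup_p F p).
  apply: countable_bigcupT_measurable; first exact: countableP.
  move=> p; rewrite /F; case: ifP => _; last exact: measurable0.
  by apply: measurableX; exact: measurable_rat_box.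
apply/seteqP; split=> [y Uy|y [p _]]; last first.
  by rewrite /F; case: asboolP => // H /H.
have /nbhs_ballP[e /= e0 He] := open_nbhs_nbhs (conj oU Uy : open_nbhs y U).
have [k Hk] := small_inv e0.
have [q1 Hq1] := rat_box_mem y.1 k; have [q2 Hq2] := rat_box_mem y.2 k.
exists (q1, q2, k) => //; rewrite /F; case: asboolP => // nH; exfalso; apply: nH => z [Hz1 Hz2].
apply: He; split; rewrite -ball_normE /ball_/=.
  exact: le_lt_trans (rat_box_dist Hq1 Hz1) Hk.
exact: le_lt_trans (rat_box_dist Hq2 Hz2) Hk.
Qed.

Lemma continuous_measurable_row n (f : 'rV[R]_n -> R) :
  continuous f -> measurable_fun setT (f : 'rV[R]_n -> measurableTypeR R).
Proof.
move=> /continuousP cf; apply: (measurability _ (RGenOpens.measurableE R)).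
move=> _ [_ [a [b ->] <-]]; rewrite setTI; apply: open_measurable_row; apply: cf.
exact: interval_open.
Qed.

Lemma continuous_measurable_phase n (f : 'rV[R]_n * 'rV[R]_n -> R) :
  continuous f -> measurable_fun setT (f : 'rV[R]_n * 'rV[R]_n -> measurableTypeR R).
Proof.
move=> /continuousP cf; apply: (measurability _ (RGenOpens.measurableE R)).
move=> _ [_ [a [b ->] <-]]; rewrite setTI; apply: open_measurable_phase; apply: cf.
exact: interval_open.
Qed.

End measurability.

Lemma continuous_bigprod (R : realType) (T : topologicalType) I (r : seq I)
    (f : I -> T -> R) :
  (forall i, continuous (f i)) -> continuous (fun x => \prod_(i <- r) f i x).
Proof.
move=> cf x; elim: r => [|i r IH].
  by under eq_fun do rewrite big_nil; exact: cvg_cst.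
under eq_fun do rewrite big_cons; apply: cvgM; [exact: cf|exact: IH].
Qed.

Section fubini_real.
Context {R : realType} {d1 d2} {T1 : measurableType d1} {T2 : measurableType d2}.
Variables (m1 : {sigma_finite_measure set T1 -> \bar R})
  (m2 : {sigma_finite_measure set T2 -> \bar R}).

(** Integrability is asked of every section, not of almost every one, so that the inner real
    integral never falls back on the default value of [fine]. *)
Lemma Rfubini12 (f : T1 * T2 -> R) :
  (m1 \x m2)%E.-integrable setT (EFin \o f) ->
  (forall x, m2.-integrable setT (fun y => (f (x, y))%:E)) ->
  \int[(m1 \x m2)%E]_z f z = \int[m1]_x \int[m2]_y f (x, y).
Proof.
move=> If If2; rewrite /Rintegral -integral12_prod_meas1//; congr fine.
apply: eq_integral => x _; rewrite /fubini_F /= fineK//.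
exact: integrable_fin_num (If2 x).
Qed.

Lemma Rfubini21 (f : T1 * T2 -> R) :
  (m1 \x m2)%E.-integrable setT (EFin \o f) ->
  (forall y, m1.-integrable setT (fun x => (f (x, y))%:E)) ->
  \int[(m1 \x m2)%E]_z f z = \int[m2]_y \int[m1]_x f (x, y).
Proof.
move=> If If2; rewrite /Rintegral -integral21_prod_meas1//; congr fine.
apply: eq_integral => x _; rewrite /fubini_G /= fineK//.
exact: integrable_fin_num (If2 x).
Qed.

End fubini_real.

Lemma continuous_affine (R : realType) (V W : normedModType R)
    (l : {linear W -> V}) (b : V) (f : V -> R) :
  continuous l -> continuous f -> continuous (fun y => f (l y + b)).
Proof.
move=> cl cf y; apply: (@continuous_comp _ _ _ (fun y => l y + b) f); last exact: cf.
by apply: cvgD; [exact: cl|exact: cvg_cst].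
Qed.

Section row_cons.
Context {R : realType} {n : nat}.

Lemma row_cons0E (p : R * 'rV[R]_n) : row_cons p ord0 ord0 = p.1.
Proof.
have -> : (ord0 : 'I_n.+1) = lshift n (ord0 : 'I_1) by exact/val_inj.
exact: (etrans (row_mxEl (const_mx p.1 : 'rV[R]_1) p.2 _ _) (mxE _ _ _ _)).
Qed.

Lemma row_consSE (p : R * 'rV[R]_n) i : row_cons p ord0 (lift ord0 i) = p.2 ord0 i.
Proof.
have -> : lift ord0 i = rshift 1 i by exact/val_inj.
exact: (row_mxEr (const_mx p.1 : 'rV[R]_1) p.2).
Qed.

Lemma row_consP (x : 'rV[R]_n.+1) : exists t y, x = row_cons (t, y).
Proof.
exists (x ord0 ord0), (\row_i x ord0 (lift ord0 i)); apply/rowP => i.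
case: (unliftP ord0 i) => [j|] ->; last by rewrite row_cons0E.
by rewrite row_consSE mxE.
Qed.

(** The linear part of [row_cons]: with [row_consE], adjoining a coordinate becomes an affine map
    and falls under [derive_along_affine]. *)
Definition row_cons_zero (y : 'rV[R]_n) : 'rV[R]_n.+1 := row_cons (0, y).

Fact row_cons_zero_linear : linear row_cons_zero.
Proof.
move=> a u v; apply/rowP => i; rewrite /row_cons_zero.
rewrite [RHS]mxE [X in _ = X + _]mxE.
case: (unliftP ord0 i) => [j|] ->; first by rewrite !row_consSE /= !mxE.
by rewrite !row_cons0E mulr0 addr0.
Qed.
HB.instance Definition _ := @GRing.isLinear.Build R 'rV[R]_n 'rV[R]_n.+1 _
  row_cons_zero row_cons_zero_linear.

Lemma row_norm_leP m (v : 'rV[R]_m) (c : R) : 0 <= c ->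
  (forall i, `|v ord0 i| <= c) -> `|v| <= c.
Proof.
move=> c0 H; rewrite [leLHS]/Num.norm/= mx_normrE; apply/bigmax_leP; split=> //.
by move=> [i j] _ /=; rewrite ord1.
Qed.

Lemma row_cons_zero_continuous : continuous row_cons_zero.
Proof.
apply/linear_bounded_continuous/linear_boundedP.
near=> r => x; apply: (@le_trans _ _ `|x|); last first.
  by rewrite ler_peMl//; near: r; exact: nbhs_pinfty_ge.
apply: row_norm_leP => // i; rewrite /row_cons_zero.
case: (unliftP ord0 i) => [j|] ->; first by rewrite row_consSE; exact: row_norm_le.
by rewrite row_cons0E normr0.
Unshelve. all: by end_near. Qed.

Lemma row_consE (t : R) (y : 'rV[R]_n) :
  row_cons (t, y) = row_cons_zero y + t *: ebase ord0.
Proof.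
apply/rowP => i; rewrite /row_cons_zero /ebase [RHS]mxE [X in _ = _ + X]mxE.
case: (unliftP ord0 i) => [j|] ->; first by rewrite !row_consSE mxE /= mulr0 addr0.
by rewrite !row_cons0E mxE /= mulr1 add0r.
Qed.

Lemma row_cons_zero_ebase i : row_cons_zero (ebase i) = ebase (lift ord0 i) :> 'rV[R]_n.+1.
Proof.
apply/rowP => j; rewrite /row_cons_zero /ebase.
case: (unliftP ord0 j) => [k|] ->; last by rewrite row_cons0E !mxE.
by rewrite row_consSE !mxE (inj_eq lift_inj).
Qed.

Lemma continuous_row_cons (f : 'rV[R]_n.+1 -> R) t :
  continuous f -> continuous (fun y => f (row_cons (t, y))).
Proof.
move=> cf; rewrite (_ : (fun _ => _) = fun y => f (row_cons_zero y + t *: ebase ord0)).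
  by apply: (@continuous_affine _ _ _ row_cons_zero) => //; exact: row_cons_zero_continuous.
by apply/funext => z; rewrite row_consE.
Qed.

Lemma Cinfty_row_cons (f : 'rV[R]_n.+1 -> R) t :
  Cinfty f -> Cinfty (fun y => f (row_cons (t, y))).
Proof.
move=> Cf; rewrite (_ : (fun _ => _) = fun y => f (row_cons_zero y + t *: ebase ord0)).
  by apply: (@Cinfty_affine _ _ _ row_cons_zero) => //; exact: row_cons_zero_continuous.
by apply/funext => z; rewrite row_consE.
Qed.

Lemma derive_along_row_cons (f : 'rV[R]_n.+1 -> R) t (s : seq 'I_n) : Cinfty f ->
  derive_along (map ebase s) (fun y => f (row_cons (t, y))) =
  fun y => derive_along (map ebase (map (lift ord0) s)) f (row_cons (t, y)).
Proof.
move=> Cf; rewrite (_ : (fun y => f _) = fun y => f (row_cons_zero y + t *: ebase ord0)).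
  rewrite (@derive_along_affine _ _ _ row_cons_zero)// -!map_comp.
  apply/funext => y; rewrite row_consE.
  by congr (derive_along _ f _); apply: eq_map => i /=; rewrite row_cons_zero_ebase.
by apply/funext => z; rewrite row_consE.
Qed.

End row_cons.

Section line.
Context {R : realType} {V : normedModType R}.

Lemma continuous_line (f : V -> R) x v : continuous f ->
  continuous (fun t : R => f (x + t *: v)).
Proof.
move=> cf t; apply: (@continuous_comp _ _ _ (fun t : R => x + t *: v) f); last exact: cf.
by apply: cvgD; [exact: cvg_cst|apply: cvgZr_tmp; exact: cvg_id].
Qed.

End line.

(** * Integration against powers of a one-dimensional measure *)

Section power.
Context {R : realType}.
Local Notation RR := (measurableTypeR R).
Variables (mu : {sigma_finite_measure set RR -> \bar R}) (w : R -> R).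
Hypothesis wc : continuous w.
Hypothesis w0 : forall t, 0 < w t.
Hypothesis wint : (\int[mu]_t (w t)%:E < +oo)%E.

Definition weight n (x : 'rV[R]_n) : R := \prod_i w (x ord0 i).

Lemma weight_continuous n : continuous (@weight n).
Proof.
apply: continuous_bigprod => i x.
by apply: (@continuous_comp _ _ _ (fun x : 'rV[R]_n => x ord0 i) w);
  [exact: coord_continuous|exact: wc].
Qed.

Lemma weight_gt0 n (x : 'rV[R]_n) : 0 < weight x.
Proof. by apply: prodr_gt0 => i _; exact: w0. Qed.

Lemma weight_row_cons n (p : R * 'rV[R]_n) : weight (row_cons p) = w p.1 * weight p.2.
Proof.
rewrite /weight big_ord_recl row_cons0E; congr (_ * _).
by apply: eq_bigr => i _; rewrite row_consSE.
Qed.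

Lemma measurable_row_fun n (f : 'rV[R]_n -> R) : continuous f ->
  measurable_fun setT (EFin \o f).
Proof. by move=> cf; apply/measurable_EFinP; exact: continuous_measurable_row. Qed.

Lemma power_ge0_integral n (f : 'rV[R]_n.+1 -> \bar R) :
  measurable_fun setT f -> (forall x, 0 <= f x)%E ->
  (\int[power_measure mu n.+1]_x f x =
   \int[mu]_t \int[power_measure mu n]_y f (row_cons (t, y)))%E.
Proof.
move=> mf f0.
rewrite /= [LHS](@ge0_integral_pushforward _ _ _ _ _ _ (@measurable_row_cons R n) (mu \x power_measure mu n)%E setT f)//.
rewrite preimage_setT fubini_tonelli1//=.
by apply: measurableT_comp => //; exact: measurable_row_cons.
Qed.

Lemma weight_integral n : (\int[power_measure mu n]_x (weight x)%:E < +oo)%E.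
Proof.
elim: n => [|n IH].
  rewrite /= integral_dirac//; last exact: (measurable_row_fun (@weight_continuous 0)).
  by rewrite diracT mul1e ltry.
rewrite power_ge0_integral; last 2 first.
- exact: (measurable_row_fun (@weight_continuous n.+1)).
- by move=> x; rewrite lee_fin ltW// weight_gt0.
have -> : (\int[mu]_t \int[power_measure mu n]_y (weight (row_cons (t, y)))%:E =
    \int[mu]_t ((w t)%:E * \int[power_measure mu n]_y (weight y)%:E))%E.
  apply: eq_integral => t _.
  transitivity (\int[power_measure mu n]_y ((w t)%:E * (weight y)%:E))%E.
    by apply: eq_integral => y _; rewrite weight_row_cons EFinM.
  apply: ge0_integralZl => //.
  - exact: (measurable_row_fun (@weight_continuous n)).
  - by move=> y _; rewrite lee_fin ltW// weight_gt0.
  - by rewrite lee_fin ltW.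
rewrite ge0_integralZr//.
- apply: lte_mul_pinfty => //.
  + by apply: integral_ge0 => t _; rewrite lee_fin ltW.
  + by rewrite ge0_fin_numE//; apply: integral_ge0 => t _; rewrite lee_fin ltW.
- by apply/measurable_EFinP; exact: continuous_measurable_fun.
- by move=> t _; rewrite lee_fin ltW.
- by apply: integral_ge0 => y _; rewrite lee_fin ltW// weight_gt0.
Qed.

(** A pointwise bound by the product weight passes to every section, unlike integrability; the
    induction on the dimension rests on this. The weight is 1 on the circle and [vweight] on the
    line. *)
Definition wbounded n (a : 'rV[R]_n -> R) :=
  continuous a /\ exists C, forall x, `|a x| <= C * weight x.

Lemma wbounded_integrable n (a : 'rV[R]_n -> R) : wbounded a ->
  (power_measure mu n).-integrable setT (EFin \o a).
Proof.
move=> [ca [C HC]].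
apply: (@le_integrable _ _ _ _ setT _ _ (fun x => C%:E * (weight x)%:E)%E) => //.
- exact: measurable_row_fun.
- by move=> x _; rewrite /= lee_fin (le_trans (HC x))// ler_norm.
apply: integrableZl => //; apply/integrableP; split.
  exact: (measurable_row_fun (@weight_continuous n)).
under eq_integral => x _ do rewrite gee0_abs ?lee_fin ?(ltW (weight_gt0 x))//.
exact: weight_integral.
Qed.

Lemma wbounded_section n (a : 'rV[R]_n.+1 -> R) t : wbounded a ->
  wbounded (fun y => a (row_cons (t, y))).
Proof.
move=> [ca [C HC]]; split; first exact: continuous_row_cons.
by exists (C * w t) => y; rewrite -mulrA -(weight_row_cons (t, y)).
Qed.

Lemma w_integrable (G : R -> R) (C : R) : continuous G ->
  (forall t, `|G t| <= C * w t) -> mu.-integrable setT (EFin \o G).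
Proof.
move=> cG HC.
apply: (@le_integrable _ RR R mu setT measurableT (EFin \o G) (fun x => C%:E * (w x)%:E)%E) => //.
- by apply/measurable_EFinP; exact: continuous_measurable_fun.
- by move=> x _; rewrite /= lee_fin (le_trans (HC x))// ler_norm.
apply: integrableZl => //; apply/integrableP; split.
  by apply/measurable_EFinP; exact: continuous_measurable_fun.
by under eq_integral => x _ do rewrite gee0_abs ?lee_fin ?(ltW (w0 x))//.
Qed.

Lemma power_integrable_comp n (a : 'rV[R]_n.+1 -> R) : wbounded a ->
  (mu \x power_measure mu n)%E.-integrable setT (EFin \o (fun p => a (row_cons p))).
Proof.
move=> wa; have := wbounded_integrable wa.
move=> /integrableP[ma Ia]; apply/integrableP; split.
  by apply: (measurableT_comp ma); exact: measurable_row_cons.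
move: Ia; rewrite /= [X in (X < _)%E -> _](@ge0_integral_pushforward _ _ _ _ _ _
  (@measurable_row_cons R n) (mu \x power_measure mu n)%E setT) //.
by apply/measurable_EFinP; apply: measurableT_comp => //; exact/measurable_EFinP.
Qed.

Lemma power_integral12 n (a : 'rV[R]_n.+1 -> R) : wbounded a ->
  \int[power_measure mu n.+1]_x a x =
  \int[mu]_t \int[power_measure mu n]_y a (row_cons (t, y)).
Proof.
move=> wa; rewrite -(@Rfubini12 _ _ _ _ _ mu (power_measure mu n) (fun p => a (row_cons p))); last 2 first.
- exact: power_integrable_comp.
- by move=> t; exact: (wbounded_integrable (wbounded_section t wa)).
rewrite /Rintegral; congr fine.
rewrite /= [LHS](@integral_pushforward _ _ _ _ _ _ (@measurable_row_cons R n) (mu \x power_measure mu n)%E setT)//.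
- by have [ca _] := wa; exact: measurable_row_fun.
- exact: power_integrable_comp.
Qed.

Lemma power_integral21 n (a : 'rV[R]_n.+1 -> R) : wbounded a ->
  \int[power_measure mu n.+1]_x a x =
  \int[power_measure mu n]_y \int[mu]_t a (row_cons (t, y)).
Proof.
move=> wa; rewrite -(@Rfubini21 _ _ _ _ _ mu (power_measure mu n) (fun p => a (row_cons p))); last 2 first.
- exact: power_integrable_comp.
- move=> y; have [ca [C HC]] := wa.
  apply: (@w_integrable _ (C * weight y)).
    rewrite (_ : (fun t => _) = fun t => a (row_cons_zero y + t *: ebase ord0)).
      exact: continuous_line.
    by apply/funext => t; rewrite row_consE.
  by move=> t; rewrite -mulrA [weight y * _]mulrC -(weight_row_cons (t, y)).
rewrite power_integral12//; rewrite -(@Rfubini12 _ _ _ _ _ mu (power_measure mu n) (fun p => a (row_cons p)))//.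
- exact: power_integrable_comp.
- by move=> t; exact: (wbounded_integrable (wbounded_section t wa)).
Qed.

Variable P : set (R -> R).
Hypothesis null1 : forall (G dG : R -> R) (C : R), continuous dG ->
  (forall t : R, is_derive t (1 : R) G (dG t)) ->
  (forall t, `|G t| <= C * w t) -> (forall t, `|dG t| <= C * w t) -> P G ->
  \int[mu]_t dG t = 0.

(** Fubini in the order that integrates the variable of derivation first. [P] is the condition on
    restrictions to lines under which a derivative has zero integral in one dimension: periodicity
    on the circle, and no condition on the line, where the decay suffices. *)
Theorem integral_partial n (a : 'rV[R]_n -> R) i : Cinfty a ->
  (forall i x, P (fun t => a (x + t *: ebase i))) ->
  wbounded a -> (forall j, wbounded (partial j a)) ->
  \int[power_measure mu n]_x partial i a x = 0.
Proof.
elim: n a i => [a [] //|n IH] a i Ca Pa wa wda.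
case: (unliftP ord0 i) => [j|] ->.
  rewrite power_integral12; last exact: wda.
  rewrite (_ : (fun t => _) = fun=> 0).
    by rewrite /Rintegral integral0.
  apply/funext => t.
  have E k : (fun y => partial (lift ord0 k) a (row_cons (t, y))) = partial k (fun y => a (row_cons (t, y))).
    exact: (esym (@derive_along_row_cons R n a t [:: k] Ca)).
  transitivity (\int[power_measure mu n]_y partial j (fun y => a (row_cons (t, y))) y).
    by rewrite -E.
  apply: IH.
  - exact: Cinfty_row_cons.
  - move=> k x; have := Pa (lift ord0 k) (row_cons (t, x)).
    rewrite (_ : (fun t0 : R => _) = fun s : R => a (row_cons (t, x + s *: ebase k)))//.
    apply/funext => s; congr (a _).
    by rewrite !row_consE linearD linearZ/= row_cons_zero_ebase addrAC.
  - exact: wbounded_section.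
  - by move=> k; rewrite -E; exact: wbounded_section.
rewrite power_integral21; last exact: wda.
rewrite (_ : (fun y => _) = fun=> 0).
  by rewrite /Rintegral integral0.
apply/funext => y.
have [ca [C1 H1]] := wa; have [cd [C2 H2]] := wda ord0.
apply: (null1 (G := fun t => a (row_cons (t, y))) (C := (Num.max C1 C2) * weight y)).
- rewrite (_ : (fun t => _) = fun t => partial ord0 a (row_cons_zero y + t *: ebase ord0)).
    exact: continuous_line.
  by apply/funext => t; rewrite row_consE.
- move=> t; rewrite row_consE.
  rewrite (_ : (fun t => _) = fun t => a (row_cons_zero y + t *: ebase ord0)).
    by apply: is_derive_line; exact: Cinfty_derivable.
  by apply/funext => s; rewrite row_consE.
- move=> t; rewrite -mulrA [weight y * _]mulrC -(weight_row_cons (t, y)).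
  apply: (le_trans (H1 _)); rewrite ler_wpM2r ?(ltW (weight_gt0 _))//.
  by rewrite le_max lexx.
- move=> t; rewrite -mulrA [weight y * _]mulrC -(weight_row_cons (t, y)).
  apply: (le_trans (H2 _)); rewrite ler_wpM2r ?(ltW (weight_gt0 _))//.
  by rewrite le_max lexx orbT.
- have := Pa ord0 (row_cons_zero y).
  rewrite (_ : (fun t : R => _) = fun t => a (row_cons (t, y)))//.
  by apply/funext => t; rewrite row_consE.
Qed.

End power.

(** * One-dimensional integrals, on the circle and on the line *)

Section one_dimension.
Context {R : realType}.
Local Notation RR := (measurableTypeR R).
Local Notation leb := (@lebesgue_measure R).
Implicit Types (G dG : R -> R).

Lemma segment_integrable (f : R -> R) (a b : R) : continuous f ->
  leb.-integrable `[a, b] (EFin \o f).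
Proof.
move=> cf; apply: continuous_compact_integrable; first exact: segment_compact.
exact: continuous_subspaceT.
Qed.

Lemma segment_EFin (f : R -> R) (a b : R) : continuous f ->
  ((\int[leb]_(t in `[a, b]) f t)%:E = \int[leb]_(t in `[a, b]) (f t)%:E)%E.
Proof.
move=> cf; rewrite /Rintegral fineK//; apply: integrable_fin_num => //.
exact: segment_integrable.
Qed.

Lemma is_derive_continuous G dG : (forall t : R, is_derive t (1 : R) G (dG t)) -> continuous G.
Proof.
move=> H t; apply: differentiable_continuous; apply/derivable1_diffP.
by have [] := H t.
Qed.

Lemma FTC_segment G dG (a b : R) : a < b -> continuous dG ->
  (forall t : R, is_derive t (1 : R) G (dG t)) ->
  \int[leb]_(t in `[a, b]) dG t = G b - G a.
Proof.
move=> ab cdG HG; have cG := is_derive_continuous HG.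
rewrite /Rintegral (@continuous_FTC2 _ dG G a b)//.
- exact: continuous_subspaceT.
- split; first by move=> x _; have [] := HG x.
  + by apply: cvg_at_right_filter; exact: cG.
  + by apply: cvg_at_left_filter; exact: cG.
- by move=> x _; rewrite derive1E; have [_ ->] := HG x.
Qed.

Lemma segment_integral_le (f g : R -> R) (a b c e : R) : a <= c -> e <= b ->
  continuous f -> continuous g -> (forall t, f t <= g t) -> (forall t, 0 <= g t) ->
  \int[leb]_(t in `[c, e]) f t <= \int[leb]_(t in `[a, b]) g t.
Proof.
move=> ac eb cf cg fg g0.
apply: (@le_trans _ _ (\int[leb]_(t in `[c, e]) g t)).
  by apply: le_Rintegral => //; exact: segment_integrable.
rewrite /Rintegral; apply: fine_le.
- by apply: integrable_fin_num => //; exact: segment_integrable.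
- by apply: integrable_fin_num => //; exact: segment_integrable.
apply: ge0_subset_integral => //.
- by apply/measurable_EFinP; apply: measurable_funTS; exact: continuous_measurable_fun.
- by move=> x _; rewrite lee_fin.
- by move=> x /=; rewrite !in_itv/= => /andP[? ?]; apply/andP; split; lra.
Qed.

(** The derivative of [G ^+ 2] is [2 G G'], at most [G ^+ 2 + G' ^+ 2] in absolute value, so
    [G ^+ 2] oscillates on the segment by at most the integral [Q]. Averaging over the segment adds
    its mean, which is at most [Q / (b - a)]. *)
Lemma sqr_le_segment G dG (a b t : R) : a < b -> a <= t <= b -> continuous dG ->
  (forall t : R, is_derive t (1 : R) G (dG t)) ->
  G t ^+ 2 <= (1 + (b - a)^-1) * \int[leb]_(s in `[a, b]) (G s ^+ 2 + dG s ^+ 2).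
Proof.
move=> ab /andP[at_ tb] cdG HG; have cG := is_derive_continuous HG.
set q := fun s => G s ^+ 2 + dG s ^+ 2.
have cM (f g : R -> R) : continuous f -> continuous g -> continuous (fun s => f s * g s).
  by move=> cf cg s; apply: cvgM; [exact: cf|exact: cg].
have cq : continuous q.
  by move=> s; apply: cvgD; [exact: (cM G G)|exact: (cM dG dG)].
have q0 s : 0 <= q s by rewrite addr_ge0// sqr_ge0.
set Q := \int[leb]_(s in `[a, b]) q s.
pose F s := G s * G s.
have HF (s : R) : is_derive s (1 : R) F (2 * (G s * dG s)).
  have := is_deriveM (HG s) (HG s).
  have -> : G s *: dG s + G s *: dG s = 2 * (G s * dG s).
    by rewrite -[_ *: _]/(_ * _); ring.
  by [].
have c2 (k : R) : continuous (fun s => k * (G s * dG s)).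
  by apply: (cM (fun=> k)); [move=> s; exact: cvg_cst|exact: cM].
have osc c e : a <= c -> c < e -> e <= b -> `|F e - F c| <= Q.
  move=> ac ce eb; rewrite ler_norml; apply/andP; split.
    rewrite lerNl -mulN1r -(FTC_segment ce (c2 2) HF) -RintegralZl//; last first.
      exact: (segment_integrable _ _ (c2 2)).
    apply: segment_integral_le => //.
    - by apply: (cM (fun=> -1)); [move=> s; exact: cvg_cst|exact: c2].
    - by move=> s; rewrite /q; have := sqr_ge0 (G s + dG s); nra.
  rewrite -(FTC_segment ce (c2 2) HF); apply: segment_integral_le => //.
  by move=> s; rewrite /q; have := sqr_ge0 (G s - dG s); nra.
have osc2 s : a <= s <= b -> F t <= F s + Q.
  move=> /andP[as_ sb]; have Q0 : 0 <= Q by apply: Rintegral_ge0 => s' _.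
  have [st|ts|->] := ltgtP s t; last by rewrite lerDl.
    have := osc _ _ as_ st tb; rewrite ler_norml => /andP[_]; lra.
  have := osc _ _ at_ ts sb; rewrite ler_norml => /andP[+ _]; lra.
have ba : 0 < b - a by rewrite subr_gt0.
have cF : continuous F by exact: cM.
have Lc (k : R) : \int[leb]_(s in `[a, b]) k = k * (b - a).
  rewrite Rintegral_cst//; congr (_ * _); rewrite [X in fine X](_ : _ = (b - a)%:E)//.
  by have := lebesgue_measure_itv `[a, b]; rewrite /= lte_fin ab => ->.
have H : F t * (b - a) <= Q + Q * (b - a).
  rewrite -!Lc; apply: (@le_trans _ _ (\int[leb]_(s in `[a, b]) (F s + Q))).
    apply: le_Rintegral => //.
    - by apply: segment_integrable => s; exact: cvg_cst.
    - by apply: segment_integrable => s; apply: cvgD; [exact: cF|exact: cvg_cst].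
  rewrite RintegralD//; last 2 first.
  - exact: segment_integrable.
  - by apply: segment_integrable => s; exact: cvg_cst.
  rewrite lerD2r; apply: segment_integral_le => // s.
  by rewrite /F /q -expr2 lerDl sqr_ge0.
have -> : (1 + (b - a)^-1) * Q = (Q + Q * (b - a)) / (b - a) by field; rewrite gt_eqF.
by rewrite ler_pdivlMr// expr2.
Qed.

Lemma circle_complement : (@circle_measure R) (~` `[0, 2 * pi]) = 0%E.
Proof. by rewrite /circle_measure /mrestr setICl measure0. Qed.

Lemma circle_integral (f : R -> R) : continuous f ->
  (circle_measure.-integrable setT (EFin \o f) : Prop) ->
  \int[circle_measure]_t f t = \int[leb]_(t in `[0, 2 * pi]) f t.
Proof.
move=> cf If; rewrite /Rintegral; congr fine.
rewrite [LHS](@negligible_integral _ RR R circle_measure setT (~` `[0, 2 * pi]%classic))//; last 2 first.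
- exact: measurableC.
- exact: circle_complement.
rewrite setDE setCK setTI; apply: eq_measure_integral => A mA A02.
by rewrite /= /circle_measure /mrestr (setIidl A02).
Qed.

Lemma circle_ge0_integral (f : R -> R) : continuous f -> (forall t, 0 <= f t) ->
  (\int[circle_measure]_t (f t)%:E = \int[leb]_(t in `[0%R, (2 * pi)%R]) (f t)%:E)%E.
Proof.
move=> cf f0.
rewrite [LHS](@ge0_negligible_integral _ RR R circle_measure setT (~` `[0, 2 * pi]%classic))//; last 4 first.
- exact: measurableC.
- by apply/measurable_EFinP; exact: continuous_measurable_fun.
- by move=> t _; rewrite lee_fin.
- exact: circle_complement.
rewrite setDE setCK setTI; apply: eq_measure_integral => A mA A02.
by rewrite /= /circle_measure /mrestr (setIidl A02).
Qed.

Lemma twopi_gt0 : 0 < 2 * pi :> R.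
Proof. by rewrite mulr_gt0// pi_gt0. Qed.

Lemma circle_weight_integral : (\int[circle_measure]_t (1 : R)%:E < +oo)%E.
Proof.
rewrite circle_ge0_integral//; last by move=> t; exact: cvg_cst.
rewrite integral_cst//= lebesgue_measure_itv/= lte_fin twopi_gt0 mul1e.
by rewrite -EFinD ltry.
Qed.

Lemma circle_null G dG (C : R) : continuous dG ->
  (forall t : R, is_derive t (1 : R) G (dG t)) ->
  (forall t, `|G t| <= C * 1) -> (forall t, `|dG t| <= C * 1) ->
  (forall t, G (t + 2 * pi) = G t) ->
  \int[circle_measure]_t dG t = 0.
Proof.
move=> cdG HG _ HC PG; rewrite circle_integral//.
  rewrite (FTC_segment twopi_gt0 cdG HG).
  by rewrite -[2 * pi]add0r PG subrr.
apply: (@w_integrable _ circle_measure (fun=> 1) _ _ _ dG C) => //.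
- by move=> t; exact: cvg_cst.
- exact: circle_weight_integral.
Qed.

Lemma circle_sobolev G dG (t : R) : 0 <= t <= 2 * pi -> continuous dG ->
  (forall t : R, is_derive t (1 : R) G (dG t)) ->
  ((G t ^+ 2)%:E <= (1 + (2 * pi)^-1)%:E *
     \int[circle_measure]_s (G s ^+ 2 + dG s ^+ 2)%:E)%E.
Proof.
move=> tI cdG HG; have cG := is_derive_continuous HG.
have cq : continuous (fun s => G s ^+ 2 + dG s ^+ 2).
  by move=> s; apply: cvgD; apply: cvgM; (exact: cG || exact: cdG).
rewrite circle_ge0_integral//; last by move=> s; rewrite addr_ge0// sqr_ge0.
rewrite -segment_EFin// -EFinM lee_fin.
by have := sqr_le_segment twopi_gt0 tI cdG HG; rewrite subr0.
Qed.

Definition vweight (t : R) : R := (1 + t ^+ 2)^-1.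

Lemma vweight_gt0 t : 0 < vweight t.
Proof. by rewrite invr_gt0 ltr_wpDr// sqr_ge0. Qed.

Lemma vweight_continuous : continuous vweight.
Proof. exact: continuous_oneDsqrV. Qed.

Lemma vweight_integral : (\int[leb]_t (vweight t)%:E < +oo)%E.
Proof.
rewrite ge0_symfun_integralT; last 3 first.
- by move=> t; exact/ltW/vweight_gt0.
- exact: vweight_continuous.
- by move=> t; rewrite /vweight /= sqrrN.
have -> : [set x : R | 0 <= x] = `[0, +oo[%classic.
  by apply/seteqP; split=> x /=; rewrite in_itv/= andbT.
by rewrite integral0y_oneDsqr -EFinM ltry.
Qed.

(** The segment inequality on [[t, t + 1]]; its length 1 explains the constant [1 + 1]. *)
Lemma lebesgue_sobolev G dG (t : R) : continuous dG ->
  (forall t : R, is_derive t (1 : R) G (dG t)) ->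
  ((G t ^+ 2)%:E <= (1 + 1)%:E * \int[leb]_s (G s ^+ 2 + dG s ^+ 2)%:E)%E.
Proof.
move=> cdG HG; have cG := is_derive_continuous HG.
have cq : continuous (fun s => G s ^+ 2 + dG s ^+ 2).
  by move=> s; apply: cvgD; apply: cvgM; (exact: cG || exact: cdG).
have tt : t < t + 1 by rewrite ltrDl.
have tI : t <= t <= t + 1 by rewrite lexx ltW.
have := sqr_le_segment tt tI cdG HG.
rewrite [t + 1 - t]addrAC subrr add0r invr1 -lee_fin => /le_trans; apply.
rewrite EFinM segment_EFin//; apply: lee_wpmul2l => //.
apply: ge0_subset_integral => //.
- by apply/measurable_EFinP; exact: continuous_measurable_fun.
- by move=> s _; rewrite lee_fin addr_ge0// sqr_ge0.
Qed.

(** The integrals over [[- n.+1, n.+1]] converge by domination, and by the fundamental theorem they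
    equal boundary values that vanish in the limit because of the weight. *)
Lemma lebesgue_null G dG (C : R) : continuous dG ->
  (forall t : R, is_derive t (1 : R) G (dG t)) ->
  (forall t, `|G t| <= C * vweight t) -> (forall t, `|dG t| <= C * vweight t) ->
  \int[leb]_t dG t = 0.
Proof.
move=> cdG HG HC HdC; have cG := is_derive_continuous HG.
have Iw : leb.-integrable setT (fun t => C%:E * (vweight t)%:E)%E.
  apply: integrableZl => //; apply/integrableP; split.
    apply/measurable_EFinP; exact: continuous_measurable_fun vweight_continuous.
  under eq_integral => x _ do rewrite gee0_abs ?lee_fin ?(ltW (vweight_gt0 x))//.
  exact: vweight_integral.
pose A n : set R := `[- n.+1%:R, n.+1%:R]%classic.
pose F n t := ((dG \_ (A n)) t)%:E.
have mdG : measurable_fun setT dG by exact: continuous_measurable_fun.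
have mA n : measurable (A n) by exact: measurable_itv.
have L : (fun n => \int[leb]_t F n t)%E @ \oo --> (\int[leb]_t (dG t)%:E)%E.
  apply: (@dominated_cvg _ _ _ leb setT measurableT F (fun t => (dG t)%:E)
    (fun t => C%:E * (vweight t)%:E)%E) => //.
  - move=> n; apply/measurable_EFinP; apply/(measurable_restrictT _ (mA n)).
    exact: measurable_funTS.
  - move=> t _; apply: cvg_near_cst.
    exists (Num.truncn `|t|).+1 => // n /= tn; rewrite /F patchE mem_set//.
    rewrite /A /= in_itv/= -ler_norml.
    apply: (le_trans (ltW (truncnS_gt _))); rewrite ler_nat.
    exact: leq_trans tn (leqnSn _).
  - move=> n t _; rewrite /F patchE; case: ifP => _; rewrite lee_fin//.
    by rewrite normr0 (le_trans _ (HdC t)).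
have E n : (\int[leb]_t F n t)%E = (G n.+1%:R - G (- n.+1%:R))%:E.
  rewrite -(FTC_segment (a := - n.+1%:R) _ cdG HG); last first.
    by rewrite gtrN// ltr0n.
  rewrite /Rintegral fineK; last first.
    by apply: integrable_fin_num => //; exact: segment_integrable.
  rewrite [RHS]integral_mkcond; apply: eq_integral => t _.
  by rewrite restrict_EFin.
have L2 : (fun n => \int[leb]_t F n t)%E @ \oo --> (0 : R)%:E.
  under eq_fun do rewrite E; apply: cvg_EFin; first exact: nearW.
  have vw : (fun n : nat => vweight n.+1%:R) @ \oo --> (0 : R).
    apply: (@squeeze_cvgr _ _ _ _ (fun=> 0) (@harmonic R)).
    - near=> n; rewrite ltW ?vweight_gt0//= /harmonic /vweight.
      rewrite lef_pV2 ?posrE ?ltr_wpDr ?sqr_ge0//.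
      rewrite (@le_trans _ _ (n.+1%:R ^+ 2))//; last by rewrite lerDr.
      by rewrite expr2 ler_peMl// ler1n.
    - exact: cvg_cst.
    - exact: cvg_harmonic.
  apply/norm_cvg0P.
  apply: (@squeeze_cvgr _ _ _ _ (fun=> 0) (fun n => 2 * C * vweight n.+1%:R)).
  - near=> n; rewrite normr_ge0 /=; apply: (le_trans (ler_normB _ _)).
    have := HC n.+1%:R; have := HC (- n.+1%:R); rewrite {1}/vweight sqrrN -/(vweight _).
    by move: (vweight _) => v; lra.
  - exact: cvg_cst.
  - by rewrite -(mulr0 (2 * C)); apply: cvgM => //; exact: cvg_cst.
by rewrite /Rintegral (cvg_unique _ L L2).
Unshelve. all: by end_near. Qed.

End one_dimension.

Lemma continuous_sqr (R : realType) (T : topologicalType) (f : T -> R) :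
  continuous f -> continuous (fun x => f x ^+ 2).
Proof. by move=> cf x; apply: cvgM; exact: cf. Qed.

(** * Sobolev inequality *)

Section power_sobolev.
Context {R : realType}.
Local Notation RR := (measurableTypeR R).
Variables (mu : {sigma_finite_measure set RR -> \bar R}) (D : set R) (C0 : R).
Hypothesis C00 : 0 <= C0.
Hypothesis sobolev1 : forall (G dG : R -> R) t, D t -> continuous dG ->
  (forall t : R, is_derive t (1 : R) G (dG t)) ->
  ((G t ^+ 2)%:E <= C0%:E * \int[mu]_s (G s ^+ 2 + dG s ^+ 2)%:E)%E.

(* The square-free multi-indices, as words. *)
Fixpoint mixed n : seq (seq 'I_n) :=
  match n with
  | 0 => [:: [::]]
  | n'.+1 => map (map (lift ord0)) (mixed n') ++
             map (fun s => rcons (map (lift ord0) s) ord0) (mixed n')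
  end.

Local Open Scope ereal_scope.

Lemma measurable_row_sqr n (f : 'rV[R]_n -> R) : continuous f ->
  measurable_fun setT (fun y => (f y ^+ 2)%:E).
Proof. by move=> cf; apply: measurable_row_fun; exact: continuous_sqr. Qed.

(** The one-dimensional inequality in the first variable, then the induction hypothesis in the
    others under the integral. In the extended reals no integrability of [F] is required: an
    infinite right-hand side is harmless. *)
Theorem power_sobolev n (F : 'rV[R]_n -> R) (x : 'rV[R]_n) : Cinfty F ->
  (forall i, D (x ord0 i)) ->
  (F x ^+ 2)%:E <= (C0 ^+ n)%:E *
    \sum_(s <- mixed n) \int[power_measure mu n]_y (derive_along (map ebase s) F y ^+ 2)%:E.
Proof.
elim: n F x => [|n IH] F x CF Dx.
  rewrite /= big_seq1 expr0 mul1e integral_dirac//.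
    by rewrite diracT mul1e (_ : x = 0%R)//; apply/rowP => -[].
  by apply: measurable_row_sqr; exact: Cinfty_continuous.
have [t [y xE]] := row_consP x.
have Dt : D t by have := Dx ord0; rewrite xE row_cons0E.
have Dy i : D (y ord0 i) by have := Dx (lift ord0 i); rewrite xE row_consSE.
(* [J F] and [J (partial ord0 F)] are the two halves of the sum over [mixed n.+1]: words without and
   with the first letter. *)
pose J (H : 'rV[R]_n.+1 -> R) := \sum_(s <- mixed n) \int[power_measure mu n.+1]_z
   (derive_along (map ebase (map (lift ord0) s)) H z ^+ 2)%:E.
have cline (H : 'rV[R]_n.+1 -> R) : Cinfty H -> continuous (fun s : R => H (row_cons (s, y))).
  move=> CH; rewrite (_ : (fun s => _) = fun s => H (row_cons_zero y + s *: ebase ord0)%R).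
    by apply: continuous_line; exact: Cinfty_continuous.
  by apply/funext => s; rewrite row_consE.
have mline (H : 'rV[R]_n.+1 -> R) : Cinfty H ->
    measurable_fun setT (fun s : RR => (H (row_cons (s, y)) ^+ 2)%:E).
  move=> CH; apply/measurable_EFinP; apply: continuous_measurable_fun.
  by apply: continuous_sqr; exact: cline.
have J0 H : 0 <= J H.
  by apply: sume_ge0 => s _; apply: integral_ge0 => z _; rewrite lee_fin sqr_ge0.
have step (H : 'rV[R]_n.+1 -> R) : Cinfty H ->
    \int[mu]_s (H (row_cons (s, y)) ^+ 2)%:E <= (C0 ^+ n)%:E * J H.
  move=> CH.
  have mI (s : seq 'I_n) : measurable_fun setT (fun r : RR => \int[power_measure mu n]_z
      (derive_along (map ebase (map (lift ord0) s)) H (row_cons (r, z)) ^+ 2)%:E).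
    apply: (measurable_fun_fubini_tonelli_F (fun p : RR * 'rV[R]_n =>
      (derive_along (map ebase (map (lift ord0) s)) H (row_cons p) ^+ 2)%:E)).
    - apply: (@measurableT_comp _ _ _ _ _ _ (fun z => (derive_along (map ebase (map (lift ord0) s)) H z ^+ 2)%:E)).
        by apply: measurable_row_sqr; apply: Cinfty_continuous; exact: Cinfty_derive_along.
      exact: measurable_row_cons.
    - by move=> p; rewrite lee_fin sqr_ge0.
  have I0 (s : seq 'I_n) r : 0 <= \int[power_measure mu n]_z
      (derive_along (map ebase (map (lift ord0) s)) H (row_cons (r, z)) ^+ 2)%:E.
    by apply: integral_ge0 => z _; rewrite lee_fin sqr_ge0.
  apply: (@le_trans _ _ (\int[mu]_r ((C0 ^+ n)%:E * \sum_(s <- mixed n)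
     \int[power_measure mu n]_z (derive_along (map ebase (map (lift ord0) s)) H (row_cons (r, z)) ^+ 2)%:E))).
    apply: ge0_le_integral => //.
    - by move=> r _; rewrite lee_fin sqr_ge0.
    - exact: mline.
    - by apply: measurable_funeM; apply: emeasurable_sum => s.
    - move=> r _; have := IH (fun z => H (row_cons (r, z))) y (Cinfty_row_cons r CH) Dy.
      move=> /le_trans; apply; rewrite le_eqVlt; apply/orP; left; apply/eqP.
      congr (_ * _); apply: eq_bigr => s _; apply: eq_integral => z _.
      by rewrite (congr1 (@^~ z) (derive_along_row_cons r s CH)).
  rewrite ge0_integralZl//; last 3 first.
  - exact: emeasurable_sum.
  - by move=> r _; apply: sume_ge0.
  - by rewrite lee_fin exprn_ge0.
  rewrite ge0_integral_sum// /J le_eqVlt; apply/orP; left; apply/eqP.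
  congr (_ * _); apply: eq_bigr => s _.
  rewrite power_ge0_integral//; last by move=> z; rewrite lee_fin sqr_ge0.
  by apply: measurable_row_sqr; apply: Cinfty_continuous; exact: Cinfty_derive_along.
have CdF : Cinfty (partial ord0 F) by exact: Cinfty_derive.
have H1 : (F x ^+ 2)%:E <= C0%:E * (\int[mu]_s (F (row_cons (s, y)) ^+ 2)%:E +
    \int[mu]_s (partial ord0 F (row_cons (s, y)) ^+ 2)%:E).
  rewrite -ge0_integralD//; last 4 first.
  - by move=> s _; rewrite lee_fin sqr_ge0.
  - exact: mline.
  - by move=> s _; rewrite lee_fin sqr_ge0.
  - exact: mline.
  rewrite xE; apply: (sobolev1 (G := fun s => F (row_cons (s, y)))) => //.
    exact: cline.
  move=> s; rewrite row_consE.
  rewrite (_ : (fun t => _) = fun t => F (row_cons_zero y + t *: ebase ord0)%R).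
    by apply: is_derive_line; exact: Cinfty_derivable.
  by apply/funext => r; rewrite row_consE.
apply: (le_trans H1).
rewrite exprS EFinM -muleA; apply: lee_wpmul2l; first by rewrite lee_fin.
apply: (@le_trans _ _ ((C0 ^+ n)%:E * (J F + J (partial ord0 F)))).
  rewrite ge0_muleDr//; apply: leeD; exact: step.
apply: lee_wpmul2l; first by rewrite lee_fin exprn_ge0.
rewrite /= big_cat !big_map /J le_eqVlt; apply/orP; left; apply/eqP.
congr (_ + _); apply: eq_bigr => s _; apply: eq_integral => z _.
by rewrite map_rcons derive_along_rcons.
Qed.

End power_sobolev.

(** * Sections and coordinates of phase space *)

Section phase_calculus.
Context {R : realType} {d : nat}.
Local Notation V := 'rV[R]_d.
Local Notation phase := ('rV[R]_d * 'rV[R]_d)%type.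

Definition pair_x (x : V) : phase := (x, 0).
Definition pair_v (v : V) : phase := (0, v).
Definition proj_x (z : phase) : V := z.1.
Definition coord_v (i : 'I_d) (z : phase) : R := z.2 ord0 i.

Fact pair_x_linear : linear pair_x.
Proof. by move=> a u v; rewrite /pair_x; congr pair; rewrite /= scaler0 addr0. Qed.
HB.instance Definition _ := @GRing.isLinear.Build R V phase _ pair_x pair_x_linear.

Fact pair_v_linear : linear pair_v.
Proof. by move=> a u v; rewrite /pair_v; congr pair; rewrite /= scaler0 addr0. Qed.
HB.instance Definition _ := @GRing.isLinear.Build R V phase _ pair_v pair_v_linear.

Fact proj_x_linear : linear proj_x.
Proof. by []. Qed.
HB.instance Definition _ := @GRing.isLinear.Build R phase V _ proj_x proj_x_linear.

Fact coord_v_linear i : linear (coord_v i : phase -> R).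
Proof. by move=> a u v; rewrite /coord_v /= !mxE. Qed.
HB.instance Definition _ i := @GRing.isLinear.Build R phase R _ (coord_v i) (coord_v_linear i).

Lemma pair_x_continuous : continuous pair_x.
Proof.
apply/linear_bounded_continuous/linear_boundedP.
near=> r => x; apply: (@le_trans _ _ `|x|); last first.
  by rewrite ler_peMl//; near: r; exact: nbhs_pinfty_ge.
by rewrite prod_normE /= normr0 ge_max lexx normr_ge0.
Unshelve. all: by end_near. Qed.

Lemma pair_v_continuous : continuous pair_v.
Proof.
apply/linear_bounded_continuous/linear_boundedP.
near=> r => x; apply: (@le_trans _ _ `|x|); last first.
  by rewrite ler_peMl//; near: r; exact: nbhs_pinfty_ge.
by rewrite prod_normE /= normr0 ge_max lexx normr_ge0.
Unshelve. all: by end_near. Qed.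

Lemma proj_x_continuous : continuous proj_x.
Proof. by move=> x; exact: cvg_fst. Qed.

Lemma coord_v_continuous i : continuous (coord_v i).
Proof.
move=> z; apply: (@continuous_comp _ _ _ snd (fun v : V => v ord0 i)).
  exact: cvg_snd.
exact: coord_continuous.
Qed.

Lemma pairE (x v : V) : (x, v) = pair_x x + (0, v) /\ (x, v) = pair_v v + (x, 0).
Proof. by split; congr pair; rewrite /= ?addr0 ?add0r. Qed.

Definition dirX (s : seq 'I_d) : seq phase := map (fun i => pair_x (ebase i)) s.
Definition dirV (s : seq 'I_d) : seq phase := map (fun i => pair_v (ebase i)) s.

Implicit Types (F f g : phase -> R) (a : V -> R).

Lemma section_xE F v : (fun x => F (x, v)) = fun x => F (pair_x x + (0, v)).
Proof. by apply/funext => x; rewrite -(pairE x v).1. Qed.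

Lemma section_vE F x : (fun v => F (x, v)) = fun v => F (pair_v v + (x, 0)).
Proof. by apply/funext => v; rewrite -(pairE x v).2. Qed.

Lemma Cinfty_section_x F v : Cinfty F -> Cinfty (fun x => F (x, v)).
Proof.
move=> CF; rewrite section_xE.
by apply: (@Cinfty_affine _ _ _ pair_x) => //; exact: pair_x_continuous.
Qed.

Lemma Cinfty_section_v F x : Cinfty F -> Cinfty (fun v => F (x, v)).
Proof.
move=> CF; rewrite section_vE.
by apply: (@Cinfty_affine _ _ _ pair_v) => //; exact: pair_v_continuous.
Qed.

Lemma derive_along_section_x F v (s : seq V) : Cinfty F ->
  derive_along s (fun x => F (x, v)) = fun x => derive_along (map pair_x s) F (x, v).
Proof.
move=> CF; rewrite section_xE [RHS]section_xE.
exact: (@derive_along_affine _ _ _ pair_x).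
Qed.

Lemma derive_along_section_v F x (s : seq V) : Cinfty F ->
  derive_along s (fun v => F (x, v)) = fun v => derive_along (map pair_v s) F (x, v).
Proof.
move=> CF; rewrite section_vE [RHS]section_vE.
exact: (@derive_along_affine _ _ _ pair_v).
Qed.

Lemma continuous_section_v F x : continuous F -> continuous (fun v => F (x, v)).
Proof.
move=> cF; rewrite section_vE.
by apply: (@continuous_affine _ _ _ pair_v) => //; exact: pair_v_continuous.
Qed.

Lemma fst_liftE a : (fun z : phase => a z.1) = fun z => a (proj_x z + 0).
Proof. by apply/funext => z; rewrite addr0. Qed.

Lemma Cinfty_fst a : Cinfty a -> Cinfty (fun z : phase => a z.1).
Proof.
move=> Ca; rewrite fst_liftE.
by apply: (@Cinfty_affine _ _ _ proj_x) => //; exact: proj_x_continuous.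
Qed.

Lemma derive_fst a (u z : phase) : Cinfty a ->
  'D_u (fun z : phase => a z.1) z = 'D_(u.1) a z.1.
Proof.
move=> Ca; rewrite fst_liftE (@derive_affine _ _ _ proj_x)//=.
by rewrite addr0.
Qed.

Lemma Cinfty_coord_v i : Cinfty (coord_v i).
Proof. by apply: (Cinfty_linear (l := coord_v i)); exact: coord_v_continuous. Qed.

Lemma derive_coord_v i u z : 'D_u (coord_v i) z = coord_v i u.
Proof. by rewrite (congr1 (@^~ z) (derive_linear (l := coord_v i) u (@coord_v_continuous i))). Qed.

End phase_calculus.

Lemma sqr_bigsum_le (R : realType) (T : Type) (l : seq T) (f : T -> R) :
  (\sum_(k <- l) f k) ^+ 2 <= (size l)%:R * \sum_(k <- l) f k ^+ 2.
Proof.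
case: l => [|k0 l]; first by rewrite !big_nil expr0n mulr0.
rewrite !(big_nth k0) !big_mkord.
by have := sqr_sum_le (fun i : 'I_(size (k0 :: l)) => f (nth k0 (k0 :: l) i)); rewrite card_ord.
Qed.

Section L2.
Context {R : realType} d {T : measurableType d} (mu : {measure set T -> \bar R}).

Lemma L2_norm_sqr (f : T -> R) :
  (\int[mu]_z (f z ^+ 2)%:E = poweR ('N[mu]_2%:E[EFin \o f]) 2)%E.
Proof.
rewrite poweR_Lnorm; last by rewrite pnatr_eq0.
apply: eq_integral => z _ /=.
by rewrite powR_mulrn// real_normK// num_real.
Qed.

Lemma L2_integral (f : T -> R) : f \in Lfun mu 2%:E ->
  (\int[mu]_z (f z ^+ 2)%:E = ((fine 'N[mu]_2%:E[EFin \o f])%E ^+ 2)%:E)%E.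
Proof.
rewrite inE => /andP[_]; rewrite inE /finite_norm => Hf.
have E : ('N[mu]_2%:E[EFin \o f] = (fine 'N[mu]_2%:E[EFin \o f])%:E)%E.
  by rewrite fineK// ge0_fin_numE// Lnorm_ge0.
rewrite L2_norm_sqr E; move: (fine _) (fine_ge0 (Lnorm_ge0 mu 2%:E (EFin \o f))) => c c0.
by rewrite /= powR_mulrn.
Qed.

Lemma L2_mem (f : T -> R) : measurable_fun setT f ->
  (\int[mu]_z (f z ^+ 2)%:E < +oo)%E -> f \in Lfun mu 2%:E.
Proof.
move=> mf Hf; rewrite inE; apply/andP; split; rewrite inE//.
rewrite /finite_norm; have := Hf; rewrite L2_norm_sqr => H.
by apply: (@lty_poweRy _ _ 2).
Qed.

End L2.

Section phase_measure_theory.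
Context {R : realType} {d : nat}.
Local Notation V := 'rV[R]_d.
Local Notation phase := ('rV[R]_d * 'rV[R]_d)%type.
Implicit Types (F f g : phase -> R) (a : V -> R) (t s r : seq 'I_d).

Definition vw (v : V) : R := weight (@vweight R) v.

Lemma vw_gt0 v : 0 < vw v.
Proof. by apply: weight_gt0; exact: vweight_gt0. Qed.

(** The class in which the phase integrals of the functionals are taken. The bound is uniform in the
    position, so every velocity section is integrable, as [Rfubini12] requires. *)
Definition admissible F := continuous F /\ exists C, forall z, `|F z| <= C * vw z.2.

Lemma admissible_section F x : admissible F -> wbounded (@vweight R) (fun v => F (x, v)).
Proof.
move=> [cF [C HC]]; split; first exact: continuous_section_v.
by exists C => v; exact: HC.
Qed.

Lemma velocity_integrable (a : V -> R) : wbounded (@vweight R) a ->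
  (@velocity_measure R d).-integrable setT (EFin \o a).
Proof.
apply: wbounded_integrable; [exact: vweight_continuous|exact: vweight_gt0|exact: vweight_integral].
Qed.

Lemma space_integrable (a : V -> R) : continuous a -> (exists C, forall x, `|a x| <= C) ->
  (@space_measure R d).-integrable setT (EFin \o a).
Proof.
move=> ca [C HC]; apply: (@wbounded_integrable _ circle_measure (fun=> 1)).
- by move=> t; exact: cvg_cst.
- by [].
- exact: circle_weight_integral.
- by split=> //; exists C => x; rewrite /weight big1// mulr1.
Qed.

Lemma space_finite : (@space_measure R d setT < +oo)%E.
Proof.
have := @weight_integral R circle_measure (fun=> 1) _ _ circle_weight_integral d.
rewrite (_ : (fun x => (weight _ x)%:E) = cst 1%E); last first.
  by apply/funext => x; rewrite /weight big1.
rewrite integral_cst// mul1e; apply => //.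
by move=> t; exact: cvg_cst.
Qed.

Lemma phase_integrable F : admissible F ->
  (phase_measure d).-integrable setT (EFin \o F).
Proof.
move=> aF; have [cF [C HC]] := aF.
have mF : measurable_fun setT (EFin \o F).
  by apply/measurable_EFinP; exact: continuous_measurable_phase.
apply/integrable12ltyP => //.
have Iw : (\int[velocity_measure d]_v (vw v)%:E < +oo)%E.
  by apply: weight_integral; [exact: vweight_continuous|exact: vweight_gt0|exact: vweight_integral].
have C0 : 0 <= C.
  have := le_trans (normr_ge0 _) (HC 0); rewrite pmulr_lge0//; exact: vw_gt0.
have mw : measurable_fun setT (fun v : V => (vw v)%:E).
  by apply: measurable_row_fun; apply: weight_continuous; exact: vweight_continuous.
pose K := (C%:E * \int[velocity_measure d]_v (vw v)%:E)%E.
have K0 : (0 <= K)%E.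
  by rewrite mule_ge0// integral_ge0// => v _; rewrite lee_fin ltW// vw_gt0.
apply: (@le_lt_trans _ _ (\int[space_measure d]_x cst K x)%E).
  apply: ge0_le_integral => //.
  - by move=> x _; apply: integral_ge0 => v _; exact: abse_ge0.
  - apply: (measurable_fun_fubini_tonelli_F (fun z : phase => `|(EFin \o F) z|)%E) => //.
    by apply: measurableT_comp.
  - move=> x _; rewrite /K -ge0_integralZl//; last first.
      by move=> v _; rewrite lee_fin ltW// vw_gt0.
    apply: ge0_le_integral => //.
    - have mFx : measurable_fun setT (EFin \o (fun v => F (x, v))).
        by apply: measurable_row_fun; exact: continuous_section_v.
      exact: (@measurableT_comp _ _ _ _ _ _ abse _ (EFin \o (fun v => F (x, v)))) mFx.
    - exact: measurable_funeM.
    - by move=> v _; rewrite -EFinM lee_fin; exact: HC.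
rewrite integral_cst//; apply: lte_mul_pinfty => //; last exact: space_finite.
rewrite ge0_fin_numE// /K; apply: lte_mul_pinfty => //.
Qed.

Lemma phase_fubini F : admissible F ->
  \int[phase_measure d]_z F z = \int[space_measure d]_x \int[velocity_measure d]_v F (x, v).
Proof.
move=> aF; apply: Rfubini12; first exact: phase_integrable.
by move=> x; apply: velocity_integrable; exact: admissible_section.
Qed.

Lemma measurable_phase_sqr F : continuous F ->
  measurable_fun setT (fun z => (F z ^+ 2)%:E).
Proof.
by move=> cF; apply/measurable_EFinP; apply: continuous_measurable_phase; exact: continuous_sqr.
Qed.

Definition sobolev_cst : R := (1 + (2 * pi)^-1) ^+ d * (1 + 1) ^+ d.

Local Open Scope ereal_scope.

(** First the inequality on the circles in [x] at fixed [v], then the one on the lines in [v] for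
    each x-derivative, under the integral over [x]. The position must lie in the cell, the only
    region seen by [circle_measure]. *)
Lemma phase_sobolev F (x v : V) : Cinfty F -> (forall i, 0 <= x ord0 i <= 2 * pi)%R ->
  (F (x, v) ^+ 2)%:E <= sobolev_cst%:E * \sum_(s <- mixed d) \sum_(r <- mixed d)
     \int[phase_measure d]_z (derive_along (dirV r) (derive_along (dirX s) F) z ^+ 2)%:E.
Proof.
move=> CF Hx.
have p0 : (0 <= 1 + (2 * pi)^-1 :> R)%R by rewrite addr_ge0// invr_ge0 ltW// twopi_gt0.
have S1 := @power_sobolev R circle_measure [set u | 0 <= u <= 2 * pi]%R (1 + (2 * pi)^-1) p0
   (fun G dG u Du cdG HG => circle_sobolev Du cdG HG) d (fun x => F (x, v)) x
   (Cinfty_section_x v CF) Hx.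
apply: (le_trans S1); rewrite /sobolev_cst EFinM -muleA.
apply: lee_wpmul2l; first by rewrite lee_fin exprn_ge0.
rewrite ge0_sume_distrr; last first.
  by move=> s _; apply: sume_ge0 => r _; apply: integral_ge0 => z _; rewrite lee_fin sqr_ge0.
apply: lee_sum => s _.
have Cs : Cinfty (derive_along (dirX s) F) by exact: Cinfty_derive_along.
have msr (r : seq 'I_d) : measurable_fun setT (fun z : phase =>
   (derive_along (dirV r) (derive_along (dirX s) F) z ^+ 2)%:E).
  by apply: measurable_phase_sqr; apply: Cinfty_continuous; exact: Cinfty_derive_along.
have m2 (r : seq 'I_d) : measurable_fun setT (fun y : V => \int[velocity_measure d]_u
     (derive_along (dirV r) (derive_along (dirX s) F) (y, u) ^+ 2)%:E).
  apply: (measurable_fun_fubini_tonelli_F (fun z : phase =>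
   (derive_along (dirV r) (derive_along (dirX s) F) z ^+ 2)%:E)) => //.
  by move=> z; rewrite lee_fin sqr_ge0.
have g0 (r : seq 'I_d) y : 0 <= \int[velocity_measure d]_u
     (derive_along (dirV r) (derive_along (dirX s) F) (y, u) ^+ 2)%:E.
  by apply: integral_ge0 => u _; rewrite lee_fin sqr_ge0.
apply: (@le_trans _ _ (\int[space_measure d]_y (((1 + 1) ^+ d)%:E * \sum_(r <- mixed d)
   \int[velocity_measure d]_u (derive_along (dirV r) (derive_along (dirX s) F) (y, u) ^+ 2)%:E))).
  apply: ge0_le_integral; first by [].
  - by move=> y _; rewrite lee_fin sqr_ge0.
  - apply: measurable_row_sqr; apply: Cinfty_continuous; apply: Cinfty_derive_along.
    exact: Cinfty_section_x.
  - by apply: measurable_funeM; exact: emeasurable_sum.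
  - move=> y _.
    rewrite (congr1 (@^~ y) (derive_along_section_x v (map ebase s) CF)) -map_comp.
    have := @power_sobolev R lebesgue_measure setT (1 + 1) (addr_ge0 ler01 ler01)
      (fun G dG u _ cdG HG => lebesgue_sobolev u cdG HG) d
      (fun u => derive_along (dirX s) F (y, u)) v (Cinfty_section_v y Cs) (fun=> I).
    move=> /le_trans; apply; rewrite le_eqVlt; apply/orP; left; apply/eqP.
    congr (_ * _); apply: eq_bigr => r _; apply: eq_integral => u _.
    by rewrite (congr1 (@^~ u) (derive_along_section_v y (map ebase r) Cs)) -map_comp.
rewrite ge0_integralZl//; last 2 first.
- exact: emeasurable_sum.
- by move=> y _; apply: sume_ge0.
rewrite ge0_integral_sum// le_eqVlt; apply/orP; left; apply/eqP.
congr (_ * _); apply: eq_bigr => r _.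
by rewrite fubini_tonelli1// => z; rewrite lee_fin sqr_ge0.
Qed.

End phase_measure_theory.

(** * Weighted derivatives of smooth functions *)

Section terms.
Context {R : realType} {d : nat}.
Local Notation phase := ('rV[R]_d * 'rV[R]_d)%type.
Local Notation idx := (seq 'I_d).
Implicit Types (F f g : phase -> R) (i j : 'I_d).

Definition mon (t : idx) (z : phase) : R := \prod_(i <- t) coord_v i z.
(** With words a derivative just prepends a letter; the multi-indices of [weighted] are recovered by
    counting letters in [term_weighted]. *)
Definition term (t s r : idx) f (z : phase) : R :=
  mon t z * derive_along (dirX s ++ dirV r) f z.

(* [mon] of the listed words add up to the derivative of [mon t] along v_i. *)
Fixpoint dmon i (t : idx) : seq idx :=
  if t is j :: t' then (if j == i then [:: t'] else [::]) ++ map (cons j) (dmon i t')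
  else [::].

Lemma Cinfty_mon t : Cinfty (mon t).
Proof. by apply: Cinfty_prod => i _; exact: Cinfty_coord_v. Qed.

Lemma monS i t : mon (i :: t) = fun z => coord_v i z * mon t z.
Proof. by apply/funext => z; rewrite /mon big_cons. Qed.

Lemma coord_v_ebase i j : coord_v j (pair_v (ebase i)) = (j == i)%:R :> R.
Proof. by rewrite /coord_v /pair_v /= /ebase mxE eqxx. Qed.

Lemma derive_mon i t z : 'D_(pair_v (ebase i)) (mon t) z = \sum_(t' <- dmon i t) mon t' z.
Proof.
elim: t z => [|j t IH] z /=.
  rewrite (_ : mon [::] = cst 1) ?derive_cst ?big_nil//.
  by apply/funext => y; rewrite /mon big_nil.
rewrite monS deriveMx; [|exact: Cinfty_coord_v|exact: Cinfty_mon].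
rewrite IH derive_coord_v coord_v_ebase big_cat /= big_map [RHS]addrC; congr (_ + _).
  by rewrite mulr_sumr; apply: eq_bigr => t' _; rewrite monS.
by case: (j == i); rewrite /= ?mulr1n ?mulr0n ?mulr1 ?mulr0 ?big_seq1 ?big_nil.
Qed.

Lemma derive_mon_x u t z : 'D_(pair_x u) (mon t) z = 0.
Proof.
elim: t z => [|j t IH] z /=.
  rewrite (_ : mon [::] = cst 1) ?derive_cst//.
  by apply/funext => y; rewrite /mon big_nil.
rewrite monS deriveMx; [|exact: Cinfty_coord_v|exact: Cinfty_mon].
by rewrite IH derive_coord_v /coord_v /pair_x /= mxE !mulr0 addr0.
Qed.

Lemma Cinfty_term t s r f : Cinfty f -> Cinfty (term t s r f).
Proof. by move=> Cf; apply: CinftyM; [exact: Cinfty_mon|exact: Cinfty_derive_along]. Qed.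

Lemma dX_term i t s r f : Cinfty f -> dX i (term t s r f) = term t (i :: s) r f.
Proof.
move=> Cf; apply/funext => z; rewrite /dX /term.
rewrite (deriveMx (f := mon t)); [|exact: Cinfty_mon|exact: Cinfty_derive_along].
by rewrite derive_mon_x mulr0 addr0.
Qed.

Lemma dV_term i t s r f z : Cinfty f -> dV i (term t s r f) z =
  \sum_(t' <- dmon i t) term t' s r f z + term t s (i :: r) f z.
Proof.
move=> Cf; rewrite /dV /term.
rewrite (deriveMx (f := mon t)); [|exact: Cinfty_mon|exact: Cinfty_derive_along].
rewrite derive_mon addrC mulr_sumr; congr (_ + _).
  by apply: eq_bigr => t' _; rewrite mulrC.
rewrite !derive_along_cat /= derive_along_derive//.
exact: Cinfty_derive_along.
Qed.

Lemma derive_term_X s' t s r f : Cinfty f ->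
  derive_along (dirX s') (term t s r f) = term t (s' ++ s) r f.
Proof. by move=> Cf; elim: s' => //= i s' ->; exact: dX_term. Qed.

Definition comb (L : seq (idx * idx * idx)) f z : R :=
  \sum_(p <- L) term p.1.1 p.1.2 p.2 f z.

Lemma Cinfty_comb L f : Cinfty f -> Cinfty (comb L f).
Proof. by move=> Cf; apply: Cinfty_sum => p _; exact: Cinfty_term. Qed.

(** The list [L] is chosen before [f], so its length and the orders of its words yield constants
    uniform in [f]. *)
Lemma derive_term_V r' t s r : exists L, forall f, Cinfty f ->
  derive_along (dirV r') (term t s r f) = comb L f.
Proof.
elim: r' => [|i r' [L HL]].
  by exists [:: (t, s, r)] => f Cf; apply/funext => z; rewrite /comb big_seq1.
exists (flatten [seq [seq (t', p.1.2, p.2) | t' <- dmon i p.1.1] ++ [:: (p.1.1, p.1.2, i :: p.2)] | p <- L]).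
move=> f Cf; rewrite /= HL//; apply/funext => z.
rewrite /comb derive_sumx => [|p _]; last exact: Cinfty_term.
rewrite big_flatten big_map; apply: eq_bigr => p _.
by rewrite -/(dV i _ z) dV_term// big_cat big_map big_seq1.
Qed.

Lemma mon_count t z : mon t z = \prod_(i < d) coord_v i z ^+ count_mem i t.
Proof.
rewrite /mon; elim: t => [|j t IH]; first by rewrite big_nil big1.
rewrite big_cons IH (bigD1 j)//= [RHS](bigD1 j)//= mulrA eqxx; congr (_ * _).
  by rewrite add1n exprS.
by apply: eq_bigr => i ij; rewrite eq_sym (negbTE ij).
Qed.

Lemma perm_count_flatten (s : idx) :
  perm_eq (flatten [seq nseq (count_mem i s) i | i <- enum 'I_d]) s.
Proof.
apply/allP => j _ /=; rewrite count_flatten -map_comp sumnE big_map big_enum /=.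
rewrite (bigD1 j)//= big1 => [|i ij]; first by rewrite count_nseq /= eqxx mul1n addn0.
by rewrite count_nseq /= (negbTE ij).
Qed.

Lemma multi_derive_along (D : 'I_d -> phase) (op : 'I_d -> (phase -> R) -> phase -> R) s f :
  (forall i, op i = fun g => 'D_(D i) g) -> Cinfty f ->
  multi_derive op (fun i => count_mem i s) f = derive_along (map D s) f.
Proof.
move=> Hop Cf.
have E (l : idx) : foldr (fun i g => iter (count_mem i s) (op i) g) f l =
    derive_along (map D (flatten [seq nseq (count_mem i s) i | i <- l])) f.
  elim: l => //= i l ->; rewrite map_cat derive_along_cat.
  by elim: (count_mem i s) => //= n ->; rewrite Hop.
rewrite /multi_derive E; apply: derive_along_perm => //; apply: perm_map.
exact: perm_count_flatten.
Qed.

(** Sorting the letters is legitimate because derivatives commute ([derive_along_perm]). *)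
Lemma term_weighted t s r f : Cinfty f -> term t s r f =
  weighted (fun i => count_mem i t) (fun i => count_mem i s) (fun i => count_mem i r) f.
Proof.
move=> Cf; apply/funext => z; rewrite /term /weighted mon_count; congr (_ * _).
have EV : multi_derive dV (fun i => count_mem i r) f = derive_along (dirV r) f.
  by apply: (@multi_derive_along (fun i => pair_v (ebase i)) dV r f _ Cf).
have EX : multi_derive dX (fun i => count_mem i s) (derive_along (dirV r) f) =
    derive_along (dirX s) (derive_along (dirV r) f).
  apply: (@multi_derive_along (fun i => pair_x (ebase i)) dX s _ _ _) => //.
  exact: Cinfty_derive_along.
by rewrite EV EX derive_along_cat.
Qed.

End terms.

(** * Sup bounds and decay of smooth functions *)

Section smooth_bounds.
Context {R : realType} {d : nat}.
Local Notation phase := ('rV[R]_d * 'rV[R]_d)%type.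
Local Notation idx := (seq 'I_d).
Implicit Types (F f g : phase -> R) (i j : 'I_d).

Lemma fine_Lnorm_ge0 d' (T : measurableType d') (mu : {measure set T -> \bar R}) p (h : T -> \bar R) :
  0 <= fine ('N[mu]_p[h])%E.
Proof. by apply: fine_ge0; exact: Lnorm_ge0. Qed.

Lemma snorm_ge0 N f : 0 <= snorm N f.
Proof. by do 3 (apply: sumr_ge0 => ? _); exact: fine_Lnorm_ge0. Qed.

Lemma le_sum_nonneg (I : finType) (F : I -> R) k : (forall l, 0 <= F l) -> F k <= \sum_i F i.
Proof. by move=> F0; rewrite (bigD1 k)//= lerDl sumr_ge0. Qed.

Lemma snorm_ge N (m p q : 'I_d -> nat) f :
  (forall i, (m i <= N)%N) -> (forall i, (p i <= N)%N) -> (forall i, (q i <= N)%N) ->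
  fine ('N[phase_measure d]_2%:E[EFin \o weighted m p q f])%E <= snorm N f.
Proof.
pose lift_ (m : 'I_d -> nat) : {ffun 'I_d -> 'I_N.+1} := [ffun i => inord (m i)].
have liftE m0 : (forall i, (m0 i <= N)%N) -> (fun i => lift_ m0 i : nat) = m0.
  by move=> H; apply/funext => i; rewrite ffunE inordK// ltnS.
move=> Hm Hp Hq; rewrite /snorm.
rewrite -{1}(liftE _ Hm) -{1}(liftE _ Hp) -{1}(liftE _ Hq).
apply: le_trans (le_sum_nonneg (lift_ m) _); last first.
  by move=> ?; do 2 (apply: sumr_ge0 => ? _); exact: fine_Lnorm_ge0.
apply: le_trans (le_sum_nonneg (lift_ p) _); last first.
  by move=> ?; apply: sumr_ge0 => ? _; exact: fine_Lnorm_ge0.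
apply: le_trans (le_sum_nonneg (lift_ q) _); last first.
  by move=> ?; exact: fine_Lnorm_ge0.
exact: lexx.
Qed.

Definition order (k : idx * idx * idx) : nat := size k.1.1 + size k.1.2 + size k.2.

Lemma smooth_Cinfty f : smooth f -> Cinfty f.
Proof. by case. Qed.

Lemma term_L2 N t s r f : smooth f -> (order (t, s, r) <= N)%N ->
  (\int[phase_measure d]_z (term t s r f z ^+ 2)%:E <= (snorm N f ^+ 2)%:E)%E.
Proof.
move=> Sf HN; have [Cf _ Lf] := Sf; rewrite term_weighted// L2_integral//.
rewrite lee_fin ler_sqr ?nnegrE ?snorm_ge0 ?fine_Lnorm_ge0//.
have H (u : idx) : (size u <= order (t, s, r))%N -> forall i, (count_mem i u <= N)%N.
  by move=> Hu i; rewrite (leq_trans (count_size _ _))// (leq_trans Hu).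
apply: snorm_ge; apply: H; rewrite /order /=.
- by rewrite -addnA leq_addr.
- by rewrite addnAC leq_addl.
- by rewrite leq_addl.
Qed.

Lemma comb_L2 N L f : smooth f -> (forall p, p \in L -> (order p <= N)%N) ->
  (\int[phase_measure d]_z (comb L f z ^+ 2)%:E <= (((size L)%:R * snorm N f) ^+ 2)%:E)%E.
Proof.
move=> Sf HN; have Cf := smooth_Cinfty Sf.
have mt (p : idx * idx * idx) : measurable_fun setT (fun z => (term p.1.1 p.1.2 p.2 f z ^+ 2)%:E).
  by apply: measurable_phase_sqr; apply: Cinfty_continuous; exact: Cinfty_term.
have t0 (p : idx * idx * idx) (z : phase) : (0 <= (term p.1.1 p.1.2 p.2 f z ^+ 2)%:E)%E.
  by rewrite lee_fin sqr_ge0.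
apply: (@le_trans _ _ (\int[phase_measure d]_z ((size L)%:R%:E *
    \sum_(p <- L) (term p.1.1 p.1.2 p.2 f z ^+ 2)%:E))%E).
  apply: ge0_le_integral; first by [].
  - by move=> z _; rewrite lee_fin sqr_ge0.
  - by apply: measurable_phase_sqr; apply: Cinfty_continuous; exact: Cinfty_comb.
  - by apply: measurable_funeM; exact: emeasurable_sum.
  - by move=> z _; rewrite sumEFin -EFinM lee_fin; exact: sqr_bigsum_le.
rewrite ge0_integralZl//; last 2 first.
- exact: emeasurable_sum.
- by move=> z _; apply: sume_ge0.
rewrite ge0_integral_sum// exprMn expr2 -mulrA EFinM; apply: lee_wpmul2l.
  by rewrite lee_fin.
apply: (@le_trans _ _ (\sum_(p <- L) (snorm N f ^+ 2)%:E)%E).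
  rewrite big_seq [leRHS]big_seq; apply: lee_sum => -[[t s] r] pL.
  exact: term_L2 (HN _ pL).
rewrite sumEFin lee_fin big_const_seq count_predT iter_addr_0.
by rewrite -[leLHS]mulr_natl.
Qed.

Lemma periodic_phase_derive (u : phase) f : Cinfty f -> phase_periodic f -> phase_periodic ('D_u f).
Proof.
move=> Cf pf v i x.
have := congr1 (@^~ (x, v)) (derive_shift (pair_x ((2 * pi) *: ebase i)) u Cf).
rewrite (_ : (fun y => f (y + _)) = f) => [->|].
  by rewrite /pair_x /=; congr ('D_u f _); congr pair; rewrite /= addr0.
apply/funext => -[y w]; rewrite -[RHS](pf w i y); congr f.
by rewrite /pair_x; congr pair; rewrite /= addr0.
Qed.

Lemma periodic_phase_derive_along (s : seq phase) f :
  Cinfty f -> phase_periodic f -> phase_periodic (derive_along s f).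
Proof.
move=> Cf pf; elim: s => //= u s; apply: periodic_phase_derive.
exact: Cinfty_derive_along.
Qed.

Lemma periodic_term t s r f : Cinfty f -> phase_periodic f -> phase_periodic (term t s r f).
Proof.
move=> Cf pf v i x; rewrite /term (periodic_phase_derive_along _ Cf pf); congr (_ * _).
Qed.

(** The bound is demanded for every [N] beyond a threshold, so that finitely many bounds can be used
    with one common norm. *)
Definition ubound (A : (phase -> R) -> phase -> R) := exists C N0, 0 <= C /\
  forall N, (N0 <= N)%N -> forall f, smooth f -> forall z, `|A f z| <= C * snorm N f.

Lemma term_sup t s r : ubound (term t s r).
Proof.
have /choice[L HL] : forall p : idx * idx, exists L, forall f, Cinfty f ->
    derive_along (dirV p.2) (term t (p.1 ++ s) r f) = comb L f.
  by move=> p; exact: derive_term_V.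
(* The largest order among all terms that the Sobolev inequality produces from [term t s r]. *)
pose N0 := (\max_(s' <- mixed d) \max_(r' <- mixed d) \max_(p <- L (s', r')) order p)%N.
pose K : R := @sobolev_cst R d * \sum_(s' <- mixed d) \sum_(r' <- mixed d) (size (L (s', r')))%:R ^+ 2.
have S0 : 0 <= @sobolev_cst R d.
  by rewrite mulr_ge0// exprn_ge0// addr_ge0// invr_ge0 ltW// twopi_gt0.
have K0 : 0 <= K.
  by rewrite mulr_ge0//; do 2 (apply: sumr_ge0 => ? _); exact: sqr_ge0.
(* The square is bounded with constant [K]; [1 + K] dominates the square root of [K] and avoids
   taking it. *)
exists (1 + K), N0; split; first by rewrite addr_ge0.
move=> N HN f Sf [x0 v]; have [Cf pf Lf] := Sf.
have [x [Hx Ex]] := cell_point x0.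
rewrite (Ex (fun x => term t s r f (x, v))); last exact: periodic_term.
have CT := Cinfty_term t s r Cf.
have := phase_sobolev v CT Hx => H.
have H2 : ((term t s r f (x, v) ^+ 2)%:E <= (K * snorm N f ^+ 2)%:E)%E.
  apply: (le_trans H); rewrite /K -mulrA [leRHS]EFinM; apply: lee_wpmul2l; first by rewrite lee_fin.
  rewrite mulr_suml -sumEFin big_seq [leRHS]big_seq; apply: lee_sum => s' Hs'.
  rewrite mulr_suml -sumEFin big_seq [leRHS]big_seq; apply: lee_sum => r' Hr'.
  rewrite derive_term_X// (HL (s', r'))// -exprMn; apply: comb_L2 => // p pL.
  rewrite (leq_trans _ HN)//.
  apply: leq_trans (leq_bigmax_seq _ Hs' isT).
  apply: leq_trans (leq_bigmax_seq _ Hr' isT).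
  exact: (leq_bigmax_seq _ pL isT).
have n0 := snorm_ge0 N f.
rewrite -ler_sqr ?nnegrE ?mulr_ge0 ?addr_ge0// -normrX ger0_norm ?sqr_ge0//.
rewrite lee_fin in H2; apply: (le_trans H2).
rewrite exprMn ler_wpM2r ?sqr_ge0//.
by move: (K) K0; clear => k k0; rewrite expr2; nra.
Qed.

Definition dbound (A : (phase -> R) -> phase -> R) := exists C N0, 0 <= C /\
  forall N, (N0 <= N)%N -> forall f, smooth f -> forall z, `|A f z| <= C * snorm N f * vw z.2.

(* Multiplying by 1 + v_i^2 only adds terms, so the sup bound absorbs the weight. *)
Lemma term_decay t s r : dbound (term t s r).
Proof.
suff H (l : idx) : ubound (fun f z => (\prod_(i <- l) (1 + coord_v i z ^+ 2)) * term t s r f z).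
  have [C [N0 [C0 HC]]] := H (index_enum 'I_d); exists C, N0; split=> // N HN f Sf z.
  rewrite /vw /weight; under eq_bigr do rewrite /vweight.
  rewrite prodfV ler_pdivlMr; last by apply: prodr_gt0 => i _; rewrite ltr_wpDr// sqr_ge0.
  have := HC N HN f Sf z; rewrite normrM ger0_norm; first by rewrite mulrC.
  by apply: prodr_ge0 => i _; rewrite addr_ge0// sqr_ge0.
elim: l t => [|i l IH] t.
  have [C [N0 [C0 HC]]] := term_sup t s r; exists C, N0; split=> // N HN f Sf z.
  by rewrite big_nil mul1r; exact: HC.
have [C [N0 [C0 HC]]] := IH t.
have [C' [N0' [C0' HC']]] := IH [:: i, i & t].
exists (C + C'), (maxn N0 N0'); split; first exact: addr_ge0.
move=> N; rewrite geq_max => /andP[HN HN'] f Sf z.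
have := lerD (HC N HN f Sf z) (HC' N HN' f Sf z); rewrite -mulrDl; apply: le_trans.
apply: le_trans (ler_normD _ _); rewrite le_eqVlt; apply/orP; left; apply/eqP; congr (`|_|).
rewrite big_cons /term !monS; ring.
Qed.

Lemma term_admissible t s r f : smooth f -> admissible (term t s r f).
Proof.
move=> Sf; have [C [N0 [C0 HC]]] := term_decay t s r.
split; first by apply: Cinfty_continuous; apply: Cinfty_term; exact: smooth_Cinfty.
by exists (C * snorm N0 f) => z; exact: HC.
Qed.

End smooth_bounds.

Section derivative_bounds.
Context {R : realType} {V : normedModType R}.
Implicit Types (f : V -> R).

Lemma taylor_bound f x u (B h : R) : Cinfty f ->
  (forall y, `|'D_u ('D_u f) y| <= B) ->
  `|f (x + h *: u) - f x - h * 'D_u f x| <= B * h ^+ 2.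
Proof.
move=> Cf HB.
have [s sh ->] := @mean_value_abs _ _ f x u h (fun s => @Cinfty_derivable _ _ f _ _ Cf).
have CD : Cinfty ('D_u f) by exact: Cinfty_derive.
have [s' _ E] := @mean_value_abs _ _ ('D_u f) x u s (fun s => @Cinfty_derivable _ _ _ _ _ CD).
rewrite [h * _]mulrC -mulrBl E -mulrA normrM; apply: ler_pM => //.
by rewrite normrM -real_normK ?num_real// expr2 ler_wpM2r.
Qed.

Lemma quadratic_is_derive f x u (l B : R) :
  (forall h : R, `|f (x + h *: u) - f x - h * l| <= B * h ^+ 2) -> is_derive x u f l.
Proof.
move=> HB.
suff H : (fun h : R => h^-1 *: ((f \o shift x) (h *: u) - f x)) @ 0^' --> l.
  apply: DeriveDef; first by apply/cvg_ex; exists l.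
  by apply/cvg_lim.
have B0 : 0 <= B.
  by have := le_trans (normr_ge0 _) (HB 1); rewrite expr1n mulr1.
apply/cvgrPdist_le => e e0; near=> h.
have h0 : h != 0 by near: h; exact: nbhs_dnbhs_neq.
rewrite /= [h *: u + x]addrC.
have -> : l - h^-1 *: (f (x + h *: u) - f x) = - (h^-1 * (f (x + h *: u) - f x - h * l)).
  by rewrite mulrBr mulrA mulVf// mul1r opprB.
rewrite normrN normrM normfV ler_pdivrMl ?normr_gt0//.
apply: (le_trans (HB h)); rewrite -real_normK ?num_real// expr2 mulrCA ler_wpM2l//.
have hB : `|h| <= e / (B + 1).
  near: h; apply: dnbhs0_le; rewrite divr_gt0// ltr_wpDl//.
rewrite ler_pdivlMr ?ltr_wpDl// in hB; apply: le_trans hB.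
by rewrite mulrC ler_wpM2l// lerDl.
Unshelve. all: by end_near. Qed.

End derivative_bounds.

Lemma lipschitz_continuous (R : realType) (V : normedModType R) (f : V -> R) (B : R) :
  (forall x v, `|f (x + v) - f x| <= B * `|v|) -> continuous f.
Proof.
move=> HB x; apply/cvgrPdist_le => e e0; near=> y.
have := HB x (y - x); rewrite [x + _]addrC subrK distrC => /le_trans; apply.
apply: (@le_trans _ _ (`|B| * `|y - x|)); first by rewrite ler_wpM2r// ler_norm.
have yx : `|y - x| <= e / (`|B| + 1).
  rewrite distrC; near: y; apply: cvgr_dist_le; last by rewrite divr_gt0// ltr_wpDl.
  exact: cvg_id.
rewrite ler_pdivlMr ?ltr_wpDl// in yx; apply: le_trans yx.
by rewrite mulrC ler_wpM2l// lerDl.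
Unshelve. all: by end_near. Qed.

Section continuous_arith.
Context {R : realType} {T : topologicalType}.
Implicit Types f g : T -> R.

Lemma continuous_add f g : continuous f -> continuous g -> continuous (fun x => f x + g x).
Proof. by move=> cf cg x; apply: cvgD; [exact: cf|exact: cg]. Qed.

Lemma continuous_sub f g : continuous f -> continuous g -> continuous (fun x => f x - g x).
Proof. by move=> cf cg x; apply: cvgB; [exact: cf|exact: cg]. Qed.

Lemma continuous_mul f g : continuous f -> continuous g -> continuous (fun x => f x * g x).
Proof. by move=> cf cg x; apply: cvgM; [exact: cf|exact: cg]. Qed.

Lemma continuous_cst (c : R) : continuous ((fun=> c) : T -> R).
Proof. by move=> x; exact: cvg_cst. Qed.

Lemma continuous_scale (c : R) f : continuous f -> continuous (fun x => c * f x).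
Proof. by move=> cf; apply: continuous_mul => //; exact: continuous_cst. Qed.

End continuous_arith.

Section real_integrable.
Context {R : realType} d {T : measurableType d} (mu : {measure set T -> \bar R}).
Implicit Types f g : T -> R.
Local Notation "'integ' f" := (mu.-integrable setT (EFin \o f)) (at level 10).

Lemma integrable_sub f g : integ f -> integ g -> integ (fun x => f x - g x).
Proof.
move=> If Ig; have := integrableB measurableT If Ig; exact: eq_integrable.
Qed.

End real_integrable.

(** * Velocity moments *)

Section moments.
Context {R : realType} {d : nat}.
Local Notation V := 'rV[R]_d.
Local Notation phase := ('rV[R]_d * 'rV[R]_d)%type.
Local Notation idx := (seq 'I_d).
Implicit Types (F f g : phase -> R).

Lemma vw_ge0 (v : V) : 0 <= vw v.
Proof. exact/ltW/vw_gt0. Qed.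

Lemma admissible0 : admissible ((fun=> 0) : phase -> R).
Proof.
split; first exact: continuous_cst.
by exists 0 => z; rewrite normr0 mul0r.
Qed.

Lemma admissibleD F f : admissible F -> admissible f -> admissible (fun z => F z + f z).
Proof.
move=> [cF [C HC]] [cf [C' HC']]; split; first exact: continuous_add.
exists (C + C') => z; rewrite mulrDl; apply: (le_trans (ler_normD _ _)).
by apply: lerD; [exact: HC|exact: HC'].
Qed.

Lemma admissible_bounded (b F : phase -> R) (B : R) : continuous b -> (forall z, `|b z| <= B) ->
  admissible F -> admissible (fun z => b z * F z).
Proof.
move=> cb HB [cF [C HC]]; split; first exact: continuous_mul.
by exists (B * C) => z; rewrite normrM -mulrA; apply: ler_pM.
Qed.

Lemma admissibleZ (c : R) F : admissible F -> admissible (fun z => c * F z).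
Proof. by apply: admissible_bounded => // z; exact: cvg_cst. Qed.

Lemma admissible_sum I (r : seq I) (P : pred I) (F : I -> phase -> R) :
  (forall i, P i -> admissible (F i)) -> admissible (fun z => \sum_(i <- r | P i) F i z).
Proof.
move=> aF; elim: r => [|i r IH].
  by under eq_fun do rewrite big_nil; exact: admissible0.
have [Pi|/negbTE Pi] := boolP (P i); under eq_fun do rewrite big_cons Pi; last by [].
by apply: admissibleD => //; exact: aF.
Qed.

Lemma continuous_fst (a : V -> R) : continuous a -> continuous (fun z : phase => a z.1).
Proof. by move=> ca z; apply: (@continuous_comp _ _ _ fst a); [exact: cvg_fst|exact: ca]. Qed.

Lemma admissible_fst (a : V -> R) F : torus_smooth a -> admissible F ->
  admissible (fun z => a z.1 * F z).
Proof.
move=> Ta; have [B HB] := torus_bounded Ta; have [Ca _] := Ta.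
apply: (admissible_bounded (b := fun z : phase => a z.1)) => //.
by apply: continuous_fst; exact: Cinfty_continuous.
Qed.

Definition vtotal : R := \int[velocity_measure d]_v vw v.

Lemma vw_wbounded (C : R) : wbounded (@vweight R) (fun v : V => C * vw v).
Proof.
split.
  by apply: continuous_scale; apply: weight_continuous; exact: vweight_continuous.
by exists `|C| => v; rewrite normrM [`|vw v|]gtr0_norm ?vw_gt0.
Qed.

Lemma velocity_integral_le (a : V -> R) (C : R) : continuous a ->
  (forall v, `|a v| <= C * vw v) -> `|\int[velocity_measure d]_v a v| <= C * vtotal.
Proof.
move=> ca Ha.
have Ia : (velocity_measure d).-integrable setT (EFin \o a).
  by apply: velocity_integrable; split=> //; exists C.
have IC : (velocity_measure d).-integrable setT (EFin \o (fun v => C * vw v)).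
  by apply: velocity_integrable; exact: vw_wbounded.
apply: (le_trans (le_normr_Rintegral _ Ia)) => //.
have Iv : (velocity_measure d).-integrable setT (EFin \o (fun v : V => vw v)).
  by have := velocity_integrable (vw_wbounded 1); congr (integrable _ _ (EFin \o _)); apply/funext => v; rewrite mul1r.
rewrite /vtotal -RintegralZl//; apply: le_Rintegral => //.
by apply: integrable_norm.
Qed.

Definition moment F (x : V) : R := \int[velocity_measure d]_v F (x, v).

(** Only derivatives in [x] are controlled, which is what differentiating a velocity integral
    requires. The class is closed under these derivatives and contains both the terms of smooth
    functions and the test functions. *)
Definition xrapid F := Cinfty F /\ forall s : idx, admissible (derive_along (dirX s) F).

Lemma xrapid_admissible F : xrapid F -> admissible F.
Proof. by case=> _ /(_ [::]). Qed.

Lemma derive_pair_x u F z : Cinfty F ->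
  'D_(pair_x u) F z = \sum_i u ord0 i * 'D_(pair_x (ebase i)) F z.
Proof.
move=> CF; rewrite {1}(row_ebase u) linear_sum derive_vsum; last exact: Cinfty_differentiable.
apply: eq_bigr => i _; rewrite linearZ derive_scale//; exact: Cinfty_differentiable.
Qed.

Lemma xrapid_derive u F : xrapid F -> xrapid ('D_(pair_x u) F).
Proof.
move=> [CF aF]; split=> [|s]; first exact: Cinfty_derive.
have -> : 'D_(pair_x u) F = fun z => \sum_i u ord0 i * 'D_(pair_x (ebase i)) F z.
  by apply/funext => z; exact: derive_pair_x.
rewrite derive_along_sum => [|i _]; last by apply: CinftyZ; exact: Cinfty_derive.
apply: admissible_sum => i _; rewrite derive_alongZ; last exact: Cinfty_derive.
apply: admissibleZ; have := aF (rcons s i).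
by rewrite /dirX map_rcons derive_along_rcons.
Qed.

Lemma section_derive_x F x u v : Cinfty F ->
  'D_u (fun x => F (x, v)) x = 'D_(pair_x u) F (x, v).
Proof. by move=> CF; have := congr1 (@^~ x) (derive_along_section_x v [:: u] CF). Qed.

(* The Taylor remainder is dominated by the second derivative, so no limit has to
   be exchanged with the integral. *)
Lemma is_derive_moment F x u : xrapid F ->
  is_derive x u (moment F) (moment ('D_(pair_x u) F) x).
Proof.
move=> rF; have [CF _] := rF.
have r1 := xrapid_derive u rF; have r2 := xrapid_derive u r1.
have [_ [C HC]] := xrapid_admissible r2.
apply: (@quadratic_is_derive _ _ _ _ _ _ (C * vtotal)) => h.
have S F' y : xrapid F' -> (velocity_measure d).-integrable setT (EFin \o (fun v => F' (y, v))).
  by move=> rF'; apply: velocity_integrable; apply: admissible_section; exact: xrapid_admissible.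
have I1 := S _ (x + h *: u) rF; have I2 := S _ x rF; have I3 := S _ x r1.
have I4 : (velocity_measure d).-integrable setT (EFin \o (fun v => h * 'D_(pair_x u) F (x, v))).
  apply: velocity_integrable; apply: (admissible_section (F := fun z => h * 'D_(pair_x u) F z)).
  by apply: admissibleZ; exact: xrapid_admissible.
rewrite /moment -RintegralZl// -RintegralB// -RintegralB//; last first.
  exact: integrable_sub.
rewrite mulrAC; apply: velocity_integral_le.
  apply: continuous_sub; first apply: continuous_sub.
  - exact: continuous_section_v (Cinfty_continuous CF).
  - exact: continuous_section_v (Cinfty_continuous CF).
  - apply: continuous_scale; apply: (@continuous_section_v _ _ ('D_(pair_x u) F)); apply: Cinfty_continuous; exact: Cinfty_derive.
move=> v; rewrite -(section_derive_x x u v CF).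
rewrite [leRHS]mulrAC; apply: (taylor_bound (f := fun x => F (x, v))); first exact: Cinfty_section_x.
move=> y.
rewrite (_ : 'D_u (fun x => F (x, v)) = fun x => 'D_(pair_x u) F (x, v)); last first.
  by apply/funext => y'; exact: section_derive_x.
rewrite (@section_derive_x ('D_(pair_x u) F)); last exact: Cinfty_derive.
exact: HC.
Qed.

(** A Lipschitz bound from the first x-derivatives. It is proved separately because directional
    derivatives alone do not give continuity. *)
Lemma moment_continuous F : xrapid F -> continuous (moment F).
Proof.
move=> rF; have [CF _] := rF.
have HC i : exists C, 0 <= C /\ forall z, `|'D_(pair_x (ebase i)) F z| <= C * vw z.2.
  have [_ [C HC]] := xrapid_admissible (xrapid_derive (ebase i) rF); exists C; split=> //.
  by have := le_trans (normr_ge0 _) (HC 0); rewrite pmulr_lge0// vw_gt0.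
have [C HC'] := choice HC.
apply: (@lipschitz_continuous _ _ _ ((\sum_i C i) * vtotal * d%:R)) => x u.
have S y : (velocity_measure d).-integrable setT (EFin \o (fun v => F (y, v))).
  by apply: velocity_integrable; apply: admissible_section; exact: xrapid_admissible.
rewrite /moment -RintegralB//.
have -> : (\sum_i C i) * vtotal * d%:R * `|u| = ((\sum_i C i) * d%:R * `|u|) * vtotal by ring.
apply: velocity_integral_le.
  by apply: continuous_sub; exact: continuous_section_v (Cinfty_continuous CF).
move=> v.
apply: (@le_trans _ _ (((\sum_i C i) * vw v) * \sum_i `|u ord0 i|)).
  apply: (row_lipschitz (f := fun x => F (x, v))); first exact: Cinfty_section_x.
  move=> i y; rewrite /partial section_derive_x//; have [C0 H] := HC' i.
  apply: (le_trans (H _)); rewrite ler_wpM2r ?vw_ge0//.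
  by apply: le_sum_nonneg => j; have [] := HC' j.
have -> : (\sum_i C i) * d%:R * `|u| * vw v = (\sum_i C i) * vw v * (d%:R * `|u|) by ring.
apply: ler_wpM2l.
  by rewrite mulr_ge0 ?vw_ge0// sumr_ge0// => j _; have [] := HC' j.
rewrite mulr_natl -[X in _ *+ X]card_ord -sumr_const; apply: ler_sum => i _; exact: row_norm_le.
Qed.

Lemma admissible_sectionI F x : admissible F ->
  (velocity_measure d).-integrable setT (EFin \o (fun v => F (x, v))).
Proof. by move=> aF; apply: velocity_integrable; exact: admissible_section. Qed.

Lemma momentZ (c : R) F x : admissible F -> moment (fun z => c * F z) x = c * moment F x.
Proof. by move=> aF; rewrite /moment RintegralZl//; exact: admissible_sectionI. Qed.

Lemma momentD F f x : admissible F -> admissible f ->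
  moment (fun z => F z + f z) x = moment F x + moment f x.
Proof. by move=> aF af; rewrite /moment RintegralD//; exact: admissible_sectionI. Qed.

Lemma moment_sum I (r : seq I) (F : I -> phase -> R) x : (forall i, admissible (F i)) ->
  moment (fun z => \sum_(i <- r) F i z) x = \sum_(i <- r) moment (F i) x.
Proof.
move=> aF; elim: r => [|i r IH].
  rewrite big_nil /moment; under eq_Rintegral do rewrite big_nil.
  by rewrite Rintegral_cst// mul0r.
rewrite big_cons -IH -momentD//; last exact: admissible_sum.
by apply: eq_Rintegral => v _; rewrite big_cons.
Qed.

Lemma moment_Cinfty F : xrapid F -> Cinfty (moment F).
Proof.
move=> rF; apply: (Cinfty_coind (S := [set m | exists F, xrapid F /\ m = moment F])); last by exists F.
move=> _ [{rF}F [rF ->]]; split=> [x|u]; last first.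
  exists ('D_(pair_x u) F); split; first exact: xrapid_derive.
  by apply/funext => x; have [_ ->] := is_derive_moment x u rF.
apply: (@partials_differentiable _ _ _ (fun i => moment ('D_(pair_x (ebase i)) F))).
  by move=> i; apply: moment_continuous; exact: xrapid_derive.
move=> y v.
rewrite (_ : \sum_i _ = moment ('D_(pair_x v) F) y); first exact: is_derive_moment.
apply: esym; transitivity (moment (fun z => \sum_i v ord0 i * 'D_(pair_x (ebase i)) F z) y).
  by have [CF _] := rF; congr (moment _ y); apply/funext => z; exact: derive_pair_x.
have aD i : admissible ('D_(pair_x (ebase i)) F).
  by apply: xrapid_admissible; exact: xrapid_derive.
rewrite moment_sum => [|i]; last exact: admissibleZ.
by apply: eq_bigr => i _; rewrite momentZ.
Qed.

Lemma moment_torus F : xrapid F -> phase_periodic F -> torus_smooth (moment F).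
Proof.
move=> rF pF; split; first exact: moment_Cinfty.
by move=> i x; rewrite /moment; apply: eq_Rintegral => v _; exact: pF.
Qed.

Lemma derive_moment F u x : xrapid F -> 'D_u (moment F) x = moment ('D_(pair_x u) F) x.
Proof. by move=> rF; have [_ ->] := is_derive_moment x u rF. Qed.

Lemma moment_le F x (C : R) : admissible F -> (forall z, `|F z| <= C * vw z.2) ->
  `|moment F x| <= C * vtotal.
Proof.
move=> [cF _] HC; apply: velocity_integral_le; first exact: continuous_section_v.
by move=> v; exact: HC.
Qed.

Lemma phase_moment (a : V -> R) F : torus_smooth a -> admissible F ->
  \int[phase_measure d]_z (a z.1 * F z) = \int[space_measure d]_x (a x * moment F x).
Proof.
move=> Ta aF; rewrite phase_fubini; last exact: admissible_fst.
apply: eq_Rintegral => x _ /=; rewrite /moment RintegralZl//.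
by apply: velocity_integrable; exact: admissible_section.
Qed.

Lemma moment_dV i F x : Cinfty F -> admissible F -> (forall j, admissible (dV j F)) ->
  moment (dV i F) x = 0.
Proof.
move=> CF aF adF.
have E j : partial j (fun v => F (x, v)) = fun v => dV j F (x, v).
  by have := derive_along_section_v x [:: ebase j] CF.
rewrite /moment (_ : \int[velocity_measure d]_v _ =
  \int[velocity_measure d]_v partial i (fun v => F (x, v)) v); last by rewrite E.
apply: (@integral_partial R lebesgue_measure (@vweight R) (@vweight_continuous R)
  (@vweight_gt0 R) (@vweight_integral R) setT) => //.
- by move=> G dG C cdG HG HC HdC _; exact: (lebesgue_null cdG HG HC HdC).
- exact: Cinfty_section_v.
- exact: admissible_section.
- by move=> j; rewrite E; exact: admissible_section.
Qed.

Lemma torus_integrable (a : V -> R) : torus_smooth a ->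
  (@space_measure R d).-integrable setT (EFin \o a).
Proof.
move=> Ta; have [Ca _] := Ta.
by apply: space_integrable; [exact: Cinfty_continuous|exact: torus_bounded].
Qed.

Lemma space_partial i (a : V -> R) : torus_smooth a ->
  \int[space_measure d]_x partial i a x = 0.
Proof.
move=> Ta; have [Ca pa] := Ta.
have W (b : V -> R) : torus_smooth b -> wbounded (fun=> 1 : R) b.
  move=> Tb; have [Cb _] := Tb; split; first exact: Cinfty_continuous.
  by have [C HC] := torus_bounded Tb; exists C => x; rewrite /weight big1// mulr1.
apply: (@integral_partial R circle_measure (fun=> 1) (fun t => cvg_cst _) (fun=> ltr01)
  (@circle_weight_integral R) [set G : R -> R | forall t, G (t + 2 * pi) = G t]) => //.
- by move=> G dG C cdG HG HC HdC; exact: (circle_null cdG HG HC HdC).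
- by move=> j x t /=; rewrite scalerDl addrA pa.
- exact: W.
- by move=> j; apply: W; exact: torus_derive.
Qed.

End moments.

Section L2_closure.
Context {R : realType} d {T : measurableType d} (mu : {measure set T -> \bar R}).
Implicit Types (f g : T -> R).

Lemma measurable_sqr f : measurable_fun setT f -> measurable_fun setT (fun z => (f z ^+ 2)%:E).
Proof. by move=> mf; apply/measurable_EFinP; exact: measurable_funX. Qed.

Lemma L2_measurable f : f \in Lfun mu 2%:E -> measurable_fun setT f.
Proof. by rewrite inE => /andP[]; rewrite inE. Qed.

Lemma L2_add f g : f \in Lfun mu 2%:E -> g \in Lfun mu 2%:E -> (f \+ g) \in Lfun mu 2%:E.
Proof.
move=> Lf Lg; have mf := L2_measurable Lf; have mg := L2_measurable Lg.
apply: L2_mem; first exact: measurable_funD.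
apply: (@le_lt_trans _ _ (\int[mu]_z (2%:E * ((f z ^+ 2)%:E + (g z ^+ 2)%:E)))%E).
  apply: ge0_le_integral; first by [].
  - by move=> z _; rewrite lee_fin sqr_ge0.
  - by apply: measurable_sqr; exact: measurable_funD.
  - by apply: measurable_funeM; apply: emeasurable_funD; exact: measurable_sqr.
  - move=> z _; rewrite -EFinD -EFinM lee_fin /=; move: (f z) (g z) => a b.
    by have := sqr_ge0 (a - b); nra.
rewrite ge0_integralZl//; last 2 first.
- by apply: emeasurable_funD; exact: measurable_sqr.
- by move=> z _; rewrite adde_ge0// lee_fin sqr_ge0.
rewrite ge0_integralD//; try exact: measurable_sqr.
- by rewrite !L2_integral// -EFinD -EFinM ltry.
- by move=> z _; rewrite lee_fin sqr_ge0.
- by move=> z _; rewrite lee_fin sqr_ge0.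
Qed.

Lemma L2_integralZ (c : R) f : f \in Lfun mu 2%:E ->
  (\int[mu]_z ((c * f z) ^+ 2)%:E = (c ^+ 2)%:E * \int[mu]_z (f z ^+ 2)%:E)%E.
Proof.
move=> Lf; rewrite -ge0_integralZl//.
- by apply: eq_integral => z _; rewrite exprMn EFinM.
- exact/measurable_sqr/L2_measurable.
- by move=> z _; rewrite lee_fin sqr_ge0.
- by rewrite lee_fin sqr_ge0.
Qed.

Lemma L2_scale (c : R) f : f \in Lfun mu 2%:E -> (fun z => c * f z) \in Lfun mu 2%:E.
Proof.
move=> Lf; apply: L2_mem; first by apply: measurable_funM => //; exact: L2_measurable.
by rewrite L2_integralZ// L2_integral// -EFinM ltry.
Qed.

Lemma L2_normZ (c : R) f : f \in Lfun mu 2%:E ->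
  fine ('N[mu]_2%:E[EFin \o (fun z => (c * f z)%R)])%E = `|c| * fine ('N[mu]_2%:E[EFin \o f])%E.
Proof.
move=> Lf; have := L2_integralZ c Lf; rewrite !L2_integral//; last exact: L2_scale.
rewrite -EFinM -(@real_normK _ c) ?num_real// -exprMn => -[] /eqP.
rewrite eqrXn2 ?fine_Lnorm_ge0 ?mulr_ge0 ?fine_Lnorm_ge0//.
by move=> /eqP.
Qed.

End L2_closure.

(** * The space of smooth functions *)

Section smooth_class.
Context {R : realType} {d : nat}.
Local Notation V := 'rV[R]_d.
Local Notation phase := ('rV[R]_d * 'rV[R]_d)%type.
Local Notation idx := (seq 'I_d).
Implicit Types (f g : phase -> R) (p m q : 'I_d -> nat).

Definition word p : idx := flatten [seq nseq (p i) i | i <- enum 'I_d].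

Lemma count_word p : (fun i => count_mem i (word p)) = p.
Proof.
apply/funext => j; rewrite /word count_flatten -map_comp sumnE big_map big_enum /=.
rewrite (bigD1 j)//= big1 => [|i ij]; first by rewrite count_nseq /= eqxx mul1n addn0.
by rewrite count_nseq /= (negbTE ij).
Qed.

Lemma weighted_term m p q f : Cinfty f ->
  weighted m p q f = term (word m) (word p) (word q) f.
Proof. by move=> Cf; rewrite term_weighted// !count_word. Qed.

Lemma smoothP f : smooth f <-> [/\ Cinfty f, phase_periodic f &
  forall t s r, term t s r f \in Lfun (phase_measure d) 2%:E].
Proof.
split=> -[Cf pf Lf]; split=> //; first by move=> t s r; rewrite term_weighted.
by move=> m p q; rewrite weighted_term.
Qed.

Lemma termD t s r f g : Cinfty f -> Cinfty g ->
  term t s r (f \+ g) = term t s r f \+ term t s r g.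
Proof.
move=> Cf Cg; apply/funext => z; rewrite /term.
by rewrite (congr1 (@^~ z) (derive_alongD _ Cf Cg)) /= mulrDr.
Qed.

Lemma termZ t s r (c : R) f : Cinfty f ->
  term t s r (fun z => c * f z) = fun z => c * term t s r f z.
Proof.
move=> Cf; apply/funext => z; rewrite /term.
by rewrite (congr1 (@^~ z) (derive_alongZ c _ Cf)) /= mulrCA.
Qed.

Lemma smoothD f g : smooth f -> smooth g -> smooth (f \+ g).
Proof.
move=> /smoothP[Cf pf Lf] /smoothP[Cg pg Lg]; apply/smoothP; split.
- exact: CinftyD.
- by move=> v i x /=; rewrite (pf v i x) (pg v i x).
- by move=> t s r; rewrite termD//; exact: L2_add.
Qed.

Lemma smoothZ (c : R) f : smooth f -> smooth (fun z => c * f z).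
Proof.
move=> /smoothP[Cf pf Lf]; apply/smoothP; split.
- exact: CinftyZ.
- by move=> v i x /=; rewrite (pf v i x).
- by move=> t s r; rewrite termZ//; exact: L2_scale.
Qed.

Lemma snormZ N (c : R) f : smooth f -> snorm N (fun z => c * f z) = `|c| * snorm N f.
Proof.
move=> Sf; have [Cf _ Lf] := Sf; rewrite /snorm mulr_sumr; apply: eq_bigr => m _.
rewrite mulr_sumr; apply: eq_bigr => p _; rewrite mulr_sumr; apply: eq_bigr => q _.
rewrite weighted_term; last exact: CinftyZ.
by rewrite termZ// -weighted_term// L2_normZ.
Qed.

Lemma term_nil f : term [::] [::] [::] f = f.
Proof. by apply/funext => z; rewrite /term /mon big_nil mul1r. Qed.

Lemma xrapid_term t s r f : smooth f -> xrapid (term t s r f).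
Proof.
move=> Sf; have Cf := smooth_Cinfty Sf; split=> [|s']; first exact: Cinfty_term.
by rewrite derive_term_X//; exact: term_admissible.
Qed.

Lemma smooth_xrapid f : smooth f -> xrapid f.
Proof. by move=> Sf; rewrite -(term_nil f); exact: xrapid_term. Qed.

Definition mterm t s r f : V -> R := moment (term t s r f).

Lemma mterm_torus t s r f : smooth f -> torus_smooth (mterm t s r f).
Proof.
move=> Sf; have [Cf pf _] := Sf; apply: moment_torus; first exact: xrapid_term.
exact: periodic_term.
Qed.

Lemma mtermD t s r f g x : smooth f -> smooth g ->
  mterm t s r (f \+ g) x = mterm t s r f x + mterm t s r g x.
Proof.
move=> Sf Sg; rewrite /mterm termD; [|exact: smooth_Cinfty..].
by apply: momentD; exact: term_admissible.
Qed.

Lemma partial_mterm i t s r f x : smooth f ->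
  partial i (mterm t s r f) x = mterm t (i :: s) r f x.
Proof.
move=> Sf; rewrite /partial derive_moment; last exact: xrapid_term.
by rewrite /mterm -(dX_term i t s r (smooth_Cinfty Sf)).
Qed.

Lemma derive_along_mterm s' t s r f : smooth f ->
  derive_along (map ebase s') (mterm t s r f) = mterm t (s' ++ s) r f.
Proof.
move=> Sf; elim: s' => //= i s' ->; apply/funext => x; exact: partial_mterm.
Qed.

Lemma dV_term_admissible i t s r f : smooth f -> admissible (dV i (term t s r f)).
Proof.
move=> Sf; rewrite (_ : dV i _ = fun z => \sum_(t' <- dmon i t) term t' s r f z + term t s (i :: r) f z).
  apply: admissibleD; last exact: term_admissible.
  by apply: admissible_sum => t' _; exact: term_admissible.
by apply/funext => z; apply: dV_term; exact: smooth_Cinfty.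
Qed.

(** Integration by parts in [v_i], with the boundary terms removed by decay. Each velocity
    derivative thus consumes one factor of the monomial; the brackets reduce to density and current
    in this way. *)
Lemma mterm_parts i t s r f x : smooth f ->
  mterm t s (i :: r) f x = - \sum_(t' <- dmon i t) mterm t' s r f x.
Proof.
move=> Sf; apply/eqP; rewrite -addr_eq0 addrC; apply/eqP.
have Cf := smooth_Cinfty Sf.
rewrite -[RHS](@moment_dV _ _ i (term t s r f) x).
- rewrite -moment_sum; last by move=> t'; exact: term_admissible.
  rewrite -momentD; last 2 first.
  - by apply: admissible_sum => t' _; exact: term_admissible.
  - exact: term_admissible.
  by congr (moment _ x); apply/funext => z; rewrite dV_term.
- exact: Cinfty_term.
- exact: term_admissible.
- by move=> j; exact: dV_term_admissible.
Qed.

Definition xbound (A : (phase -> R) -> V -> R) := exists C N0, 0 <= C /\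
  forall N, (N0 <= N)%N -> forall f, smooth f -> forall x, `|A f x| <= C * snorm N f.

Lemma mterm_bound t s r : xbound (mterm t s r).
Proof.
have [C [N0 [C0 HC]]] := @term_decay R d t s r.
have v0 : 0 <= @vtotal R d by apply: Rintegral_ge0 => v _; exact: vw_ge0.
exists (C * vtotal (d := d)), N0; split; first exact: mulr_ge0.
move=> N HN f Sf x; rewrite mulrAC; apply: moment_le; first exact: term_admissible.
by move=> z; exact: HC.
Qed.

End smooth_class.

(** * Inverse Laplacian *)

Section space_integral.
Context {R : realType} {d : nat}.
Local Notation V := 'rV[R]_d.
Local Notation vol := ((2 * pi : R) ^+ d).
Implicit Types (a b g u w : V -> R).

Lemma power_circle_total n :
  (\int[power_measure (@circle_measure R) n]_x 1%:E = ((2 * pi) ^+ n)%:E)%E.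
Proof.
elim: n => [|n IH].
  by rewrite /= integral_dirac// diracT mul1e expr0.
rewrite power_ge0_integral//.
rewrite IH (@circle_ge0_integral _ (fun=> (2 * pi) ^+ n)).
- rewrite integral_cst//= lebesgue_measure_itv/= lte_fin twopi_gt0 -EFinD -EFinM.
  by rewrite subr0 exprSr.
- by move=> t; exact: cvg_cst.
- by move=> t; rewrite exprn_ge0// ltW// twopi_gt0.
Qed.

Lemma vol_gt0 : 0 < vol.
Proof. by rewrite exprn_gt0// twopi_gt0. Qed.

Lemma space_cst (c : R) : \int[@space_measure R d]_x c = c * vol.
Proof.
rewrite Rintegral_cst//; congr (_ * _).
have := @power_circle_total d; rewrite integral_cst//= mul1e /space_measure => ->//.
Qed.

Lemma spaceD a b : torus_smooth a -> torus_smooth b ->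
  \int[@space_measure R d]_x (a x + b x) =
  \int[@space_measure R d]_x a x + \int[@space_measure R d]_x b x.
Proof. by move=> Ta Tb; rewrite RintegralD//; exact: torus_integrable. Qed.

Lemma spaceB a b : torus_smooth a -> torus_smooth b ->
  \int[@space_measure R d]_x (a x - b x) =
  \int[@space_measure R d]_x a x - \int[@space_measure R d]_x b x.
Proof. by move=> Ta Tb; rewrite RintegralB//; exact: torus_integrable. Qed.

Lemma spaceZ (c : R) a : torus_smooth a ->
  \int[@space_measure R d]_x (c * a x) = c * \int[@space_measure R d]_x a x.
Proof. by move=> Ta; rewrite RintegralZl//; exact: torus_integrable. Qed.

Lemma torusN a : torus_smooth a -> torus_smooth (fun x => - a x).
Proof. by move=> Ta; under eq_fun do rewrite -mulN1r; exact: torusZ. Qed.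

Lemma spaceN a : torus_smooth a ->
  \int[@space_measure R d]_x (- a x) = - \int[@space_measure R d]_x a x.
Proof.
by move=> Ta; rewrite -mulN1r -spaceZ//; apply: eq_Rintegral => x _; rewrite mulN1r.
Qed.

Lemma space_sum I (r : seq I) (F : I -> V -> R) : (forall i, torus_smooth (F i)) ->
  \int[@space_measure R d]_x \sum_(i <- r) F i x = \sum_(i <- r) \int[@space_measure R d]_x F i x.
Proof.
move=> TF; elim: r => [|i r IH].
  rewrite big_nil; under eq_Rintegral do rewrite big_nil.
  by rewrite space_cst mul0r.
rewrite big_cons -IH -spaceD//; last exact: torus_sum.
by apply: eq_Rintegral => x _; rewrite big_cons.
Qed.

Lemma space_le a (B : R) : torus_smooth a -> (forall x, `|a x| <= B) ->
  `|\int[@space_measure R d]_x a x| <= B * vol.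
Proof.
move=> Ta HB; have Ia := torus_integrable Ta.
apply: (le_trans (le_normr_Rintegral _ Ia)) => //.
rewrite -space_cst; apply: le_Rintegral => //; first exact: integrable_norm.
by have := torus_integrable (torus_cst B : torus_smooth (fun _ : V => B)).
Qed.

(** Integrating [w x - w y] over [y] leaves [w x] times the volume. This turns the oscillation bound
    of [poisson_bound] into a sup bound. *)
Lemma zero_mean_le w (B : R) : torus_smooth w -> \int[@space_measure R d]_x w x = 0 ->
  (forall x y, `|w x - w y| <= B) -> forall x, `|w x| <= B.
Proof.
move=> Tw w0 HB x; have T1 : torus_smooth (fun y => w x - w y) by apply: torusB => //; exact: torus_cst.
have := space_le T1 (HB x); rewrite spaceB//; last exact: torus_cst.
rewrite w0 subr0 space_cst normrM [`|vol|]gtr0_norm ?vol_gt0//.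
by rewrite ler_pM2r// vol_gt0.
Qed.

Lemma torus_partial i a : torus_smooth a -> torus_smooth (partial i a).
Proof. exact: torus_derive. Qed.

Lemma space_parts i a b : torus_smooth a -> torus_smooth b ->
  \int[@space_measure R d]_x (partial i a x * b x) =
  - \int[@space_measure R d]_x (a x * partial i b x).
Proof.
move=> Ta Tb; have [Ca _] := Ta; have [Cb _] := Tb.
apply/eqP; rewrite -addr_eq0 -spaceD; last 2 first.
- by apply: torusM => //; exact: torus_partial.
- by apply: torusM => //; exact: torus_partial.
rewrite -(space_partial i (torusM Ta Tb)); apply/eqP/eq_Rintegral => x _.
by rewrite /partial [RHS](deriveMx _ _ Ca Cb) addrC [_ * b x]mulrC.
Qed.

Lemma space_green a b : torus_smooth a -> torus_smooth b ->
  \int[@space_measure R d]_x (laplacian a x * b x) =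
  - \int[@space_measure R d]_x (\sum_i partial i a x * partial i b x).
Proof.
move=> Ta Tb.
pose F i x := partial i (partial i a) x * b x.
pose G i x := partial i a x * partial i b x.
have TF i : torus_smooth (F i) := torusM (torus_partial i (torus_partial i Ta)) Tb.
have TG i : torus_smooth (G i) := torusM (torus_partial i Ta) (torus_partial i Tb).
transitivity (\int[@space_measure R d]_x \sum_i F i x).
  by apply: eq_Rintegral => x _; rewrite /laplacian mulr_suml.
transitivity (- \int[@space_measure R d]_x \sum_i G i x); last by [].
rewrite (space_sum _ TF) (space_sum _ TG) -sumrN; apply: eq_bigr => i _.
by apply: space_parts => //; exact: torus_partial.
Qed.

Lemma space_laplacian_sym a b : torus_smooth a -> torus_smooth b ->
  \int[@space_measure R d]_x (laplacian a x * b x) =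
  \int[@space_measure R d]_x (a x * laplacian b x).
Proof.
move=> Ta Tb.
have E : \int[@space_measure R d]_x (laplacian b x * a x) =
    \int[@space_measure R d]_x (a x * laplacian b x).
  by apply: eq_Rintegral => x _; rewrite mulrC.
apply: etrans (space_green Ta Tb) (etrans _ (etrans (esym (space_green Tb Ta)) E)).
apply: (congr1 -%R); apply: eq_Rintegral => x _; apply: eq_bigr => i _.
exact: mulrC.
Qed.

Lemma space_laplacian a : torus_smooth a -> \int[@space_measure R d]_x laplacian a x = 0.
Proof.
move=> Ta; rewrite /laplacian space_sum => [|i]; last by do 2 apply: torus_partial.
by rewrite big1// => i _; apply: space_partial; exact: torus_partial.
Qed.

Lemma laplacianD a b x : torus_smooth a -> torus_smooth b ->
  laplacian (fun x => a x + b x) x = laplacian a x + laplacian b x.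
Proof.
move=> [Ca _] [Cb _]; rewrite /laplacian -big_split; apply: eq_bigr => i _ /=.
rewrite /partial.
have -> : 'D_(ebase i) (fun x => a x + b x) = fun x => 'D_(ebase i) a x + 'D_(ebase i) b x.
  by apply/funext => y; exact: deriveDx.
by rewrite deriveDx//; exact: Cinfty_derive.
Qed.

Lemma laplacianZ (c : R) a x : torus_smooth a ->
  laplacian (fun x => c * a x) x = c * laplacian a x.
Proof.
move=> [Ca _]; rewrite /laplacian mulr_sumr; apply: eq_bigr => i _ /=; rewrite /partial.
by rewrite deriveZ_fun// deriveZx//; exact: Cinfty_derive.
Qed.

Lemma laplacian_cst (c : R) x : laplacian (fun _ : V => c) x = 0.
Proof.
rewrite /laplacian big1// => i _; rewrite /partial.
have -> : 'D_(ebase i) (fun _ : V => c) = fun=> 0 by apply/funext => y; exact: derive_cst.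
exact: derive_cst.
Qed.

(** [poisson_bound] with [B = 0] makes [w] constant, and the mean fixes the constant. *)
Lemma harmonic_zero w : torus_smooth w -> (forall x, laplacian w x = 0) ->
  \int[@space_measure R d]_x w x = 0 -> forall x, w x = 0.
Proof.
move=> Tw L0 w0 x; apply/normr0_eq0/eqP; rewrite eq_le normr_ge0 andbT.
apply: (zero_mean_le Tw w0) => {}x y.
have := @poisson_bound R d w 0 x y Tw; rewrite mulr0 mulr0; apply => p _ z.
have -> : laplacian w = fun=> 0 by apply/funext.
have -> : derive_along (map ebase p) (fun _ : V => 0 : R) = fun=> 0.
  elim: p => //= i p ->; apply/funext => y'; exact: derive_cst.
by rewrite normr0.
Qed.

(** A Laplacian integrates to zero, as does [g], so the constant left open by [poisson_existence] is
    zero. Subtracting its mean normalizes the solution. *)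
Lemma inv_laplacianP g : torus_smooth g -> \int[@space_measure R d]_x g x = 0 ->
  is_inv_laplacian g (inv_laplacian g).
Proof.
move=> Tg g0; rewrite /inv_laplacian; set S := [set u | _].
suff [u Su] : exists u, is_inv_laplacian g u by exact: (xgetPex (fun=> 0) (ex_intro S u Su)).
have [c Hc] := poisson_existence Tg; have Tp := poisson_sol_torus Tg.
have c0 : c = 0.
  have := space_laplacian Tp; under eq_Rintegral do rewrite Hc.
  rewrite spaceB//; last exact: torus_cst.
  rewrite g0 sub0r space_cst => /eqP; rewrite oppr_eq0 mulf_eq0 [vol == 0]gt_eqF ?vol_gt0// orbF.
  by move=> /eqP.
pose m := (\int[space_measure d]_x poisson_sol g x) / vol.
have T2 : torus_smooth (fun x => poisson_sol g x + - m) by apply: torusD => //; exact: torus_cst.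
have [C2 P2] := T2.
exists (fun x => poisson_sol g x + - m); split=> //.
  rewrite spaceD//; last exact: torus_cst.
  by rewrite space_cst /m mulNr divfK ?subrr// gt_eqF// vol_gt0.
move=> x; rewrite laplacianD//; last exact: torus_cst.
by rewrite laplacian_cst addr0 Hc c0 subr0.
Qed.

Lemma inv_laplacian_uniq g u v : is_inv_laplacian g u -> is_inv_laplacian g v -> u = v.
Proof.
move=> [Cu pu u0 Lu] [Cv pv v0 Lv]; apply/funext => x; apply/eqP; rewrite -subr_eq0; apply/eqP.
have Tu : torus_smooth u by []. have Tv : torus_smooth v by [].
have Tn := torusN Tv.
apply: (@harmonic_zero (fun x => u x + - v x)).
- exact: torusD.
- move=> y; rewrite laplacianD// Lu (_ : (fun x => - v x) = fun x => -1 * v x).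
    by rewrite laplacianZ// Lv mulN1r subrr.
  by apply/funext => z; rewrite mulN1r.
- by rewrite spaceD// spaceN// u0 v0 subrr.
Qed.

Lemma inv_laplacian_eq g u : is_inv_laplacian g u -> inv_laplacian g = u.
Proof.
move=> Hu; apply: (inv_laplacian_uniq _ Hu).
rewrite /inv_laplacian; exact: (xgetPex (fun=> 0) (ex_intro [set u | is_inv_laplacian g u] u Hu)).
Qed.

Lemma inv_laplacian_torus g : torus_smooth g -> \int[@space_measure R d]_x g x = 0 ->
  torus_smooth (inv_laplacian g).
Proof. by move=> Tg g0; have [] := inv_laplacianP Tg g0. Qed.

Lemma inv_laplacianD g h : torus_smooth g -> \int[@space_measure R d]_x g x = 0 ->
  torus_smooth h -> \int[@space_measure R d]_x h x = 0 ->
  inv_laplacian (fun x => g x + h x) = fun x => inv_laplacian g x + inv_laplacian h x.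
Proof.
move=> Tg g0 Th h0; have [Cu pu u0 Lu] := inv_laplacianP Tg g0.
have [Cv pv v0 Lv] := inv_laplacianP Th h0.
have Tu := inv_laplacian_torus Tg g0; have Tv := inv_laplacian_torus Th h0.
have [C p] := torusD Tu Tv.
apply: inv_laplacian_eq; split=> //.
- by rewrite spaceD// u0 v0 addr0.
- by move=> x; rewrite laplacianD// Lu Lv.
Qed.

(** [poisson_bound] is applied to [partial i u], with [u] the inverse Laplacian of [g]: it has zero
    mean, and its Laplacian is [partial i g]. This accounts for the extra letter [i] in the
    words. *)
Lemma partial_inv_laplacian_le g i (B : R) : torus_smooth g -> \int[@space_measure R d]_x g x = 0 ->
  (forall p, p \in subs (enum 'I_d) -> forall z,
     `|derive_along (map ebase (rcons p i)) g z| <= B) ->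
  forall x, `|partial i (inv_laplacian g) x| <= 2 * (@elliptic_cst R d * B).
Proof.
move=> Tg g0 HB; have [Cu pu u0 Lu] := inv_laplacianP Tg g0.
have Tu := inv_laplacian_torus Tg g0; have Tw := torus_partial i Tu.
apply: zero_mean_le => //; first exact: space_partial.
move=> x y; apply: poisson_bound => // p Hp z.
have -> : laplacian (partial i (inv_laplacian g)) = partial i g.
  by rewrite -(derive_along_laplacian [:: ebase i] Tu) (_ : laplacian _ = g)//; exact/funext.
by have := HB p Hp z; rewrite map_rcons derive_along_rcons.
Qed.

End space_integral.

(** * Test functions and uniqueness of derivatives *)

Section flat_functions.
Context {R : realType}.
Implicit Types (p : {poly R}).

Lemma expn_le_expR (s : R) k : 0 <= s -> s ^+ k <= k`!%:R * expR s.
Proof.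
move=> s0; case: k => [|k].
  by rewrite expr0 mul1r; apply: le_trans (expR_ge1Dx s); rewrite lerDl.
have k0 : 0 < k.+1`!%:R :> R by rewrite ltr0n fact_gt0.
rewrite mulrC -ler_pdivrMr//; apply: le_trans (expR_ge1Dxn k s0).
by rewrite lerDr.
Qed.

Lemma horner_le_expR p : exists2 B, 0 <= B & forall s, 0 <= s -> `|p.[s]| <= B * expR s.
Proof.
exists (\sum_(i < size p) `|p`_i| * i`!%:R); first by apply: sumr_ge0 => i _; rewrite mulr_ge0.
move=> s s0; rewrite horner_coef mulr_suml; apply: (le_trans (ler_norm_sum _ _ _)).
apply: ler_sum => i _; rewrite normrM normrX (ger0_norm s0) -mulrA ler_wpM2l//.
exact: expn_le_expR.
Qed.

(* Closed under derivation: the derivative of [flat p] is [flat (flat_next p)]. *)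
Definition flat p (t : R) : R := if 0 < t then p.[t^-1] * expR (- t^-1) else 0.

Lemma flat_le p : exists B, forall t, `|flat p t| <= B * t ^+ 2.
Proof.
have [B B0 HB] := horner_le_expR (p * 'X^2); exists B => t; rewrite /flat.
case: ifPn => t0; last by rewrite normr0 mulr_ge0// sqr_ge0.
have s0 : 0 < t^-1 by rewrite invr_gt0.
have := HB _ (ltW s0); rewrite hornerM hornerXn normrM [`|t^-1 ^+ 2|]ger0_norm ?sqr_ge0// => H.
rewrite normrM [`|expR _|]ger0_norm ?expR_ge0// expRN.
rewrite ler_pdivrMr ?expR_gt0// mulrAC -ler_pdivrMr ?exprn_gt0//.
by rewrite -exprVn.
Qed.

(** For [t > 0] the derivative of [p(1/t) exp(-1/t)] is [t^-2 (p - p')(1/t) exp(-1/t)]. *)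
Definition flat_next p : {poly R} := 'X^2 * (p - p^`()).

Lemma is_derive_flat p t : is_derive t (1 : R) (flat p) (flat (flat_next p) t).
Proof.
have [t0|t0|->] := ltgtP t 0.
- rewrite {2}/flat ltNge (ltW t0) /=.
  apply: (@near_eq_is_derive _ _ _ (cst 0)).
  near=> s; rewrite /flat ltNge ltW//=.
  by near: s; exact: lt_nbhsl.
- have tn0 : t != 0 by rewrite gt_eqF.
  have D1 : is_derive t (1 : R) (fun s : R => s^-1) (- t ^- 2).
    by have := @is_deriveV _ id t 1 1 tn0 (is_derive_id _ _); rewrite [_ *: _]mulr1.
  have D2 := is_derive1_comp (f := horner p) (is_derive_poly p t^-1) D1.
  have D3 := @is_derive1_comp _ expR (- (fun s : R => s^-1)) t _ _ (is_derive_expR (- t^-1)) (is_deriveN D1).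
  have D4 : is_derive t (1 : R) (fun s => p.[s^-1] * expR (- s^-1)) (flat (flat_next p) t).
    have [D5 E5] := is_deriveM D2 D3; apply: DeriveDef; first exact: D5.
    apply: (etrans E5); rewrite /flat t0 /flat_next hornerM hornerXn hornerD hornerN /= -exprVn.
    transitivity (p.[t^-1] * (expR (- t^-1) * - - t^-1 ^+ 2) +
      expR (- t^-1) * (p^`().[t^-1] * - t^-1 ^+ 2)); [by []|ring].
  apply: (near_eq_is_derive _ D4).
  near=> s; rewrite /flat ifT//; near: s; exact: lt_nbhsr.
(* At the junction point the quadratic bound alone gives derivative zero. *)
- rewrite {2}/flat ltxx; have [B HB] := flat_le p.
  apply: (@quadratic_is_derive _ _ _ _ _ _ B) => h.
  rewrite add0r mulr0 subr0 [flat p 0]/flat ltxx subr0.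
  by rewrite [h *: _]mulr1; exact: HB.
Unshelve. all: by end_near. Qed.

Lemma flat_Cinfty p : Cinfty (flat p).
Proof.
apply: (Cinfty_coind (S := [set f | exists p, f = flat p])); last by exists p.
move=> _ [{}p ->]; have dp x : differentiable (flat p) x.
  by apply/derivable1_diffP; have [] := is_derive_flat p x.
split=> // u; exists (u *: flat_next p); apply/funext => t.
rewrite -[u in LHS]mulr1 (@derive_scale _ _ (flat p) t u 1)//.
have [_ ->] := is_derive_flat p t; rewrite /flat; case: ifP => _; last by rewrite mulr0.
by rewrite hornerZ mulrA.
Qed.

Definition bump : R -> R := flat 1.

Lemma bump_gt0 t : 0 < t -> 0 < bump t.
Proof. by move=> t0; rewrite /bump /flat t0 hornerC mul1r expR_gt0. Qed.

Lemma bump_eq0 t : t <= 0 -> bump t = 0.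
Proof. by move=> t0; rewrite /bump /flat ltNge t0. Qed.

Lemma derive_comp1 (V : normedModType R) (f : R -> R) (g : V -> R) x u :
  differentiable f (g x) -> differentiable g x ->
  'D_u (fun y => f (g y)) x = 'D_1 f (g x) * 'D_u g x.
Proof.
move=> df dg; rewrite !deriveE//; last exact: differentiable_comp.
rewrite diff_comp//= -[X in 'd f _ X]mulr1 [_ * 1]/(_ *: _) linearZ /= mulrC //.
Qed.

(** The class closed under derivation consists of finite sums of [h (g x) * k x]: the chain rule
    sends such a product to two of the same form. *)
Lemma Cinfty_comp (V : normedModType R) (f : R -> R) (g : V -> R) :
  Cinfty f -> Cinfty g -> Cinfty (fun x => f (g x)).
Proof.
move=> Cf Cg.
pose S : set (V -> R) := [set k | exists r : seq ((R -> R) * (V -> R)),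
   (forall q, q \in r -> Cinfty q.1 /\ Cinfty q.2) /\
   k = fun x => \sum_(q <- r) q.1 (g x) * q.2 x].
apply: (@Cinfty_coind _ _ S); last first.
  exists [:: (f, fun=> 1)]; split=> [q|].
    by rewrite inE => /eqP ->; split=> //; exact: Cinfty_cst.
  by apply/funext => x; rewrite big_seq1 mulr1.
have C1 (h : R -> R) : Cinfty h -> forall x, differentiable (fun y => h (g y)) x.
  by move=> Ch x; apply: (@differentiable_comp _ _ _ _ g h); exact: Cinfty_differentiable.
move=> _ [r [Hr ->]]; split.
  move=> x; elim: r Hr => [|p r IH] Hr.
    by under eq_fun do rewrite big_nil; exact: differentiable_cst.
  under eq_fun do rewrite big_cons.
  have [D1 D2] := Hr p (mem_head _ _).
  apply: differentiableD.
    by apply: differentiableM; [exact: C1|exact: Cinfty_differentiable].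
  by apply: IH => q qr; apply: Hr; rewrite inE qr orbT.
move=> u; elim: r Hr => [|p r IH] Hr.
  exists [::]; split => //; apply/funext => x.
  under eq_fun do rewrite big_nil.
  by rewrite derive_cst big_nil.
have [D1 D2] := Hr p (mem_head _ _).
have Hr' q : q \in r -> Cinfty q.1 /\ Cinfty q.2.
  by move=> qr; apply: Hr; rewrite inE qr orbT.
have [r' [Hr'' E]] := IH Hr'.
exists [:: (p.1, 'D_u p.2), ('D_1 p.1, fun x => p.2 x * 'D_u g x) & r']; split.
  move=> q; rewrite !inE => /or3P[/eqP ->|/eqP ->|]; last exact: Hr''.
  - by split=> //; exact: Cinfty_derive.
  - by split; [exact: Cinfty_derive|apply: CinftyM => //; exact: Cinfty_derive].
apply/funext => x; rewrite !big_cons/= addrA -(congr1 (@^~ x) E).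
have dS y : differentiable (fun y => \sum_(j <- r) j.1 (g y) * j.2 y) y.
  elim: (r) Hr' => [|q r0 IH0] H0.
    by under eq_fun do rewrite big_nil; exact: differentiable_cst.
  under eq_fun do rewrite big_cons.
  have [F1 F2] := H0 q (mem_head _ _).
  apply: differentiableD.
    by apply: differentiableM; [exact: C1|exact: Cinfty_differentiable].
  by apply: IH0 => q' qr; apply: H0; rewrite inE qr orbT.
have d1 := C1 _ D1 x; have d2 := Cinfty_differentiable x D2.
rewrite (_ : (fun y => _) = (fun y => p.1 (g y) * p.2 y) + (fun y => \sum_(j <- r) j.1 (g y) * j.2 y)); last first.
  by apply/funext => y; rewrite big_cons.
rewrite deriveD; [|by apply: diff_derivable; exact: differentiableM|exact: diff_derivable].
congr (_ + _).
have := deriveM (diff_derivable (v := u) d1) (diff_derivable (v := u) d2).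
rewrite (derive_comp1 u (Cinfty_differentiable _ D1) (Cinfty_differentiable x Cg)).
move=> E1; apply: (etrans E1).
transitivity (p.1 (g x) * 'D_u p.2 x + p.2 x * ('D_1 p.1 (g x) * 'D_u g x)); [by []|ring].
Qed.

End flat_functions.

(** * Functions of bounded velocity support *)

Section test_functions.
Context {R : realType} {d : nat}.
Local Notation V := 'rV[R]_d.
Local Notation phase := ('rV[R]_d * 'rV[R]_d)%type.
Local Notation idx := (seq 'I_d).
Implicit Types (F A B T f g h : phase -> R) (rho : R).

(** Compact support on the torus times the velocity space. The radius is kept explicit because
    [annihilates] tests [F] against functions of the same radius, among them [F] and its
    derivatives. *)
Definition test_fun rho F := [/\ Cinfty F, phase_periodic F &
  forall (z : phase) i, rho < `|z.2 ord0 i| -> F z = 0].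

Lemma test_fun_mul rho F h : Cinfty h -> phase_periodic h -> test_fun rho F ->
  test_fun rho (fun z => h z * F z).
Proof.
move=> Ch ph [CF pF ZF]; split.
- exact: CinftyM.
- by move=> v i x; rewrite (ph v i x) (pF v i x).
- by move=> z i zi; rewrite (ZF z i zi) mulr0.
Qed.

Lemma test_fun_derive rho F u : test_fun rho F -> test_fun rho ('D_u F).
Proof.
move=> [CF pF ZF]; split.
- exact: Cinfty_derive.
- exact: periodic_phase_derive.
(* The condition on the velocity is open, so [F] vanishes near [z] and so does its derivative. *)
- move=> z i zi; rewrite (@near_eq_derive _ _ _ F (cst 0)) ?derive_cst//.
  have cn : continuous (fun y : phase => `|coord_v i y|).
    move=> y; apply: (@continuous_comp _ _ _ (coord_v i) (fun t : R => `|t|)).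
      exact: coord_v_continuous.
    exact: norm_continuous.
  have : \forall y \near z, rho < `|coord_v i y|.
    by apply: (cvgr_gt _ (cn z)).
  by apply: filterS => y Hy; exact: ZF Hy.
Qed.

Lemma test_fun_derive_along rho F (s : seq phase) : test_fun rho F -> test_fun rho (derive_along s F).
Proof. by move=> TF; elim: s => //= u s; exact: test_fun_derive. Qed.

Lemma test_fun_bounded rho F : test_fun rho F -> exists M, forall z, `|F z| <= M.
Proof.
move=> [CF pF ZF].
pose K := [set y : V | forall i, 0 <= y ord0 i <= 2 * pi] `*`
  [set v : V | forall i, `[- rho, rho : R]%classic (v ord0 i)].
have cK : compact K.
  apply: compact_setX; first exact: cell_compact.
  by apply: (@rV_compact _ d (fun=> `[- rho, rho : R]%classic)) => i; exact: segment_compact.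
have : compact (F @` K).
  by apply: continuous_compact => //; apply: continuous_subspaceT; exact: Cinfty_continuous.
move=> /compact_bounded[M [_ HM]]; exists (`|M| + 1) => -[x v].
have M1 : M < `|M| + 1 by rewrite ltr_pwDr// ler_norm.
have [[i Hi]|H] := pselect (exists i, rho < `|v ord0 i|).
  by rewrite (ZF _ i)// normr0 addr_ge0.
have [y [Hy E]] := cell_point x; rewrite (E (fun x => F (x, v)))//.
apply: (HM _ M1); exists (y, v) => //; split=> // i /=; rewrite in_itv/= -ler_norml.
by rewrite leNgt; apply/negP => Hi; apply: H; exists i.
Qed.

Lemma test_fun_admissible rho F : test_fun rho F -> admissible F.
Proof.
move=> TF; have [CF pF ZF] := TF; split; first exact: Cinfty_continuous.
(* Multiplication by the reciprocal of the weight keeps a test function; boundedness of the product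
   is the decay of [F]. *)
have T2 : test_fun rho (fun z => (\prod_(i < d) (1 + coord_v i z ^+ 2)) * F z).
  apply: test_fun_mul => //.
  by apply: Cinfty_prod => i _; apply: CinftyD; [exact: Cinfty_cst|apply: CinftyX; exact: Cinfty_coord_v].
have [M HM] := test_fun_bounded T2; exists M => z.
rewrite /vw /weight; under eq_bigr do rewrite /vweight.
rewrite prodfV ler_pdivlMr; last by apply: prodr_gt0 => i _; rewrite ltr_wpDr// sqr_ge0.
have := HM z; rewrite normrM ger0_norm; first by rewrite mulrC.
by apply: prodr_ge0 => i _; rewrite addr_ge0// sqr_ge0.
Qed.

Lemma test_fun_term rho t s r F : test_fun rho F -> test_fun rho (term t s r F).
Proof.
move=> TF; apply: test_fun_mul; [exact: Cinfty_mon|by []|exact: test_fun_derive_along].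
Qed.

Lemma test_fun_smooth rho F : test_fun rho F -> smooth F.
Proof.
move=> TF; have [CF pF ZF] := TF; apply/smoothP; split=> // t s r.
have T2 := test_fun_term t s r TF.
have T3 : test_fun rho (fun z => term t s r F z * term t s r F z).
  by apply: test_fun_mul => //; case: T2.
apply: L2_mem.
  apply: continuous_measurable_phase; apply: Cinfty_continuous; exact: Cinfty_term.
rewrite (_ : (fun z => _) = EFin \o (fun z => term t s r F z * term t s r F z)); last first.
  by apply/funext => z /=; rewrite expr2.
have := integrable_fin_num measurableT (phase_integrable (test_fun_admissible T3)).
by rewrite ge0_fin_numE//; apply: integral_ge0 => z _; rewrite lee_fin -expr2 sqr_ge0.
Qed.

Lemma test_fun_int_dX rho i F : test_fun rho F -> \int[phase_measure d]_z dX i F z = 0.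
Proof.
move=> TF; have [CF pF _] := TF.
have xF : xrapid F.
  by split=> // s; apply: (@test_fun_admissible rho); exact: test_fun_derive_along.
rewrite phase_fubini; last by apply: (@test_fun_admissible rho); exact: test_fun_derive.
rewrite -(space_partial i (moment_torus xF pF)); apply: eq_Rintegral => x _.
by rewrite /partial derive_moment.
Qed.

Lemma test_fun_int_dV rho i F : test_fun rho F -> \int[phase_measure d]_z dV i F z = 0.
Proof.
move=> TF; have [CF pF _] := TF.
have aD j : admissible (dV j F) by apply: (@test_fun_admissible rho); exact: test_fun_derive.
rewrite phase_fubini//; transitivity (\int[@space_measure R d]_x (0 : R)); last first.
  by rewrite space_cst mul0r.
apply: eq_Rintegral => x _; apply: moment_dV => //; exact: test_fun_admissible TF.
Qed.

Definition annihilates rho F := forall T, test_fun rho T -> \int[phase_measure d]_z (F z * T z) = 0.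

(** Integration by parts: the derivative is moved onto the test function, which stays a test
    function. *)
Lemma annihilates_derive rho u F : test_fun rho F ->
  (forall A, test_fun rho A -> \int[phase_measure d]_z 'D_u A z = 0) ->
  annihilates rho F -> annihilates rho ('D_u F).
Proof.
move=> TF Hu aF T TT; have [CF pF _] := TF; have [CT _ _] := TT.
have TD := test_fun_derive u TT; have TDF := test_fun_derive u TF.
have I1 : test_fun rho (fun z => F z * 'D_u T z) by apply: test_fun_mul.
have I2 : test_fun rho (fun z => T z * 'D_u F z).
  by apply: test_fun_mul => //; case: TT.
have := Hu (fun z => F z * T z) (test_fun_mul CF pF TT).
under eq_Rintegral do rewrite deriveMx//.
rewrite RintegralD//; last 2 first.
- exact: phase_integrable (test_fun_admissible I1).
- exact: phase_integrable (test_fun_admissible I2).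
rewrite (aF _ TD) add0r => <-; apply: eq_Rintegral => z _; exact: mulrC.
Qed.

(* All derivatives of [F] annihilate test functions too, in particular themselves,
   so the right-hand side of the Sobolev inequality vanishes. *)
Lemma annihilates_zero rho F : test_fun rho F -> annihilates rho F -> forall z, F z = 0.
Proof.
move=> TF aF [x0 v]; have [CF pF ZF] := TF.
have [x [Hx E]] := cell_point x0; rewrite (E (fun x => F (x, v)))//.
have H (s r : idx) : test_fun rho (derive_along (dirV r) (derive_along (dirX s) F)) /\
    annihilates rho (derive_along (dirV r) (derive_along (dirX s) F)).
  elim: r => [|i r [T1 A1]] /=.
    elim: s => [|i s [T1 A1]] //=; split; first exact: test_fun_derive.
    by apply: annihilates_derive => // A TA; exact: (test_fun_int_dX i TA).
  split; first exact: test_fun_derive.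
  by apply: annihilates_derive => // A TA; exact: (test_fun_int_dV i TA).
have := phase_sobolev v CF Hx.
rewrite big1 ?mule0 => [|s _]; last first.
  apply: big1 => r _; have [T1 A1] := H s r; have := A1 _ T1.
  set G := derive_along _ _ in T1 *; rewrite /Rintegral => G0.
  have I1 : test_fun rho (fun z => G z * G z) by apply: test_fun_mul => //; case: T1.
  have := integrable_fin_num measurableT (phase_integrable (test_fun_admissible I1)).
  by move=> /fineK; rewrite G0 => E1; rewrite [RHS]E1; apply: eq_integral => z _; rewrite expr2.
by rewrite lee_fin => H0; apply/eqP; rewrite -sqrf_eq0 eq_le H0 sqr_ge0.
Qed.

Definition cutoff rho (z : phase) : R := \prod_(i < d) bump (rho ^+ 2 - coord_v i z ^+ 2).

Lemma cutoff_test rho : 0 <= rho -> test_fun rho (cutoff rho).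
Proof.
move=> rho0; split=> //.
  apply: Cinfty_prod => i _.
  apply: (Cinfty_comp (g := fun z => rho ^+ 2 - coord_v i z ^+ 2)); first exact: flat_Cinfty.
  by apply: CinftyB; [exact: Cinfty_cst|apply: CinftyX; exact: Cinfty_coord_v].
move=> z i zi; rewrite /cutoff (bigD1 i)//= bump_eq0 ?mul0r//.
by rewrite subr_le0 -[leRHS]real_normK ?num_real// ler_sqr ?nnegrE// ltW.
Qed.

Lemma cutoff_gt0 rho (z : phase) : (forall i, `|z.2 ord0 i| < rho) -> 0 < cutoff rho z.
Proof.
move=> H; apply: prodr_gt0 => i _; apply: bump_gt0.
rewrite subr_gt0 -[ltLHS]real_normK ?num_real// ltr_sqr ?nnegrE//; first exact: H.
exact: le_trans (normr_ge0 _) (ltW (H i)).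
Qed.

Lemma test_functions_separate h : Cinfty h -> phase_periodic h ->
  (forall rho T, test_fun rho T -> \int[phase_measure d]_z (h z * T z) = 0) ->
  forall z, h z = 0.
Proof.
(* The radius is taken larger than the velocity of [z], where the cutoff must be positive in order
   to be divided out. *)
move=> Ch ph H z; pose rho := `|z.2| + 1.
have rho0 : 0 <= rho by rewrite addr_ge0.
have Tc := cutoff_test rho0; have [Cc pc _] := Tc.
have Tch := test_fun_mul Ch ph Tc.
have := annihilates_zero Tch _ z => H2.
have c0 : 0 < cutoff rho z.
  by apply: cutoff_gt0 => i; rewrite /rho ltr_pwDr// row_norm_le.
have /eqP : h z * cutoff rho z = 0.
  apply: H2 => T TT; rewrite -(H _ _ (test_fun_mul Cc pc TT)).
  by apply: eq_Rintegral => y _; rewrite mulrA.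
by rewrite mulf_eq0 [cutoff rho z == 0]gt_eqF// orbF => /eqP.
Qed.

End test_functions.

(** * Uniqueness of the derivative of a functional *)

Section frechet_derivative.
Context {R : realType} {d : nat}.
Local Notation phase := ('rV[R]_d * 'rV[R]_d)%type.
Implicit Types (f g h : phase -> R) (G H : (phase -> R) -> R).

Lemma zero_of_le_scaled (D K t0 : R) : 0 < t0 ->
  (forall t, 0 < t -> t <= t0 -> t * `|D| <= K * t ^+ 2) -> D = 0.
Proof.
move=> t00 H; apply/eqP; rewrite -normr_eq0; apply/negP => /negP D0.
have {D0} : 0 < `|D| by rewrite lt_def D0 normr_ge0.
move: `|D| H => {}D H D0.
(* Testing with [t = e * t0] yields [D <= |K| * e * t0], whereas [e * (D + t0 * |K| + 1) = D] with
   [e] and [D] positive. *)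
pose e := D / (D + t0 * `|K| + 1).
have k0 := normr_ge0 K.
have den : 0 < D + t0 * `|K| + 1 by rewrite ltr_wpDl// addr_ge0 ?mulr_ge0// ltW.
have e0 : 0 < e by rewrite divr_gt0.
have e1 : e <= 1.
  by rewrite ler_pdivrMr// mul1r -addrA lerDl addr_ge0 ?mulr_ge0// ltW.
have te : 0 < e * t0 by rewrite mulr_gt0.
have := H (e * t0) te; rewrite ger_pMl// => /(_ e1).
rewrite expr2 [leRHS]mulrCA ler_pM2l// => H1.
have H2 : D <= `|K| * (e * t0).
  by apply: (le_trans H1); rewrite ler_wpM2r ?ler_norm// ltW.
have E : e * (D + t0 * `|K| + 1) = D by rewrite /e divfK// gt_eqF.
have eD := mulr_gt0 e0 D0; clearbody e; clear -H2 E e0 eD; nra.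
Qed.

(** Both derivatives are tested on [t * T]. The difference of the two remainders is linear in [t]
    and bounded by a multiple of [t ^+ 2], so it vanishes for every test function. *)
Lemma is_frechet_uniq G f h1 h2 : is_frechet G f h1 -> is_frechet G f h2 -> h1 = h2.
Proof.
move=> [C1 p1 I1 [N1 [c1 B1]]] [C2 p2 I2 [N2 [c2 B2]]].
suff H z : h1 z - h2 z = 0 by apply/funext => z; apply/eqP; rewrite -subr_eq0 H.
apply: (@test_functions_separate _ _ (fun z => h1 z - h2 z)).
- exact: CinftyB.
- by move=> v i x; rewrite (p1 v i x) (p2 v i x).
move=> rho T TT; have ST := test_fun_smooth TT.
transitivity (\int[phase_measure d]_z (h1 z * T z) - \int[phase_measure d]_z (h2 z * T z)).
  rewrite -RintegralB//; [|exact: I1|exact: I2].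
  by apply: eq_Rintegral => y _; rewrite mulrBl.
pose n1 := snorm N1 T; pose n2 := snorm N2 T.
have n10 : 0 <= n1 := snorm_ge0 _ _; have n20 : 0 <= n2 := snorm_ge0 _ _.
have s0 : 0 < 1 + n1 + n2 by rewrite -addrA ltr_pwDl// addr_ge0.
(* The range of [t] keeps both norms of [t * T] at most 1, where the remainder bounds hold. *)
apply: (@zero_of_le_scaled _ (c1 * n1 ^+ 2 + c2 * n2 ^+ 2) (1 + n1 + n2)^-1); first by rewrite invr_gt0.
move=> t t0; rewrite -[X in _ <= X -> _]mul1r ler_pdivlMr// => tn.
have Sh : smooth (fun z => t * T z) by exact: smoothZ.
have E1 N : snorm N (fun z => t * T z) = t * snorm N T by rewrite snormZ// gtr0_norm.
have I h : (forall df, smooth df ->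
    (phase_measure d).-integrable setT (fun z => (h z * df z)%:E)) ->
    \int[phase_measure d]_z (h z * (t * T z)) = t * \int[phase_measure d]_z (h z * T z).
  move=> Ih; rewrite -RintegralZl//; last exact: Ih.
  by apply: eq_Rintegral => y _; rewrite mulrCA.
have := B1 _ Sh; have := B2 _ Sh; rewrite !E1 -/n1 -/n2 (I _ I1) (I _ I2).
have t1 : t * n1 <= 1 /\ t * n2 <= 1 by split; nra.
move: t1 => [t1 t2] /(_ t2) H2 /(_ t1) H1.
rewrite -{1}(gtr0_norm t0) -normrM mulrBr.
set a := G (f \+ _) - G f in H1 H2.
set x := t * _ in H1 *; set y := t * _ in H2 *.
have -> : x - y = (a - y) - (a - x) by ring.
apply: (le_trans (ler_normB _ _)).
have -> : (c1 * n1 ^+ 2 + c2 * n2 ^+ 2) * t ^+ 2 = c2 * (t * n2) ^+ 2 + c1 * (t * n1) ^+ 2 by ring.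
exact: lerD.
Qed.

Lemma frechet_eq G f h : is_frechet G f h -> frechet G f = h.
Proof.
move=> Gh; apply: (is_frechet_uniq (G := G) (f := f) _ Gh).
by rewrite /frechet; exact: (xgetPex (fun=> 0) (ex_intro [set h | is_frechet G f h] h Gh)).
Qed.

(** Only the values at [f] and at [f] plus smooth variations enter [is_frechet]. A closed formula
    valid on smooth functions is therefore enough to differentiate a bracket. *)
Lemma is_frechet_ext G H f h : (forall g, smooth g -> G g = H g) -> smooth f ->
  is_frechet H f h -> is_frechet G f h.
Proof.
move=> GH Sf [C p I [N [c B]]]; split=> //; exists N, c => df Sdf n.
by rewrite !GH//; [exact: B|exact: smoothD].
Qed.

End frechet_derivative.

(** * Electric potential *)

Section poisson_potential.
Context {R : realType} {d : nat}.
Local Notation V := 'rV[R]_d.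
Local Notation phase := ('rV[R]_d * 'rV[R]_d)%type.
Local Notation vol := ((2 * pi : R) ^+ d).
Local Notation idx := (seq 'I_d).
Implicit Types (f g h : phase -> R) (a b w : V -> R).

Lemma densityE f : density f = mterm [::] [::] [::] f.
Proof. by rewrite /mterm term_nil. Qed.

Lemma density_torus f : smooth f -> torus_smooth (density f).
Proof. by rewrite densityE; exact: mterm_torus. Qed.

Lemma smooth_admissible f : smooth f -> admissible f.
Proof. by move=> /smooth_xrapid/xrapid_admissible. Qed.

Lemma massE f : smooth f -> mass f = vol^-1 * \int[@space_measure R d]_x density f x.
Proof. by move=> Sf; rewrite /mass phase_fubini//; exact: smooth_admissible. Qed.

Lemma densityD f g x : smooth f -> smooth g -> density (f \+ g) x = density f x + density g x.
Proof. by rewrite !densityE; exact: mtermD. Qed.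

Lemma massD f g : smooth f -> smooth g -> mass (f \+ g) = mass f + mass g.
Proof.
move=> Sf Sg; rewrite !massE//; last exact: smoothD.
rewrite -mulrDr -spaceD; [|exact: density_torus..].
by congr (_ * _); apply: eq_Rintegral => x _; exact: densityD.
Qed.

Definition charge_excess f (x : V) : R := density f x - mass f.

Lemma charge_excess_torus f : smooth f -> torus_smooth (charge_excess f).
Proof. by move=> Sf; apply: torusB; [exact: density_torus|exact: torus_cst]. Qed.

Lemma charge_excess_mean f : smooth f -> \int[@space_measure R d]_x charge_excess f x = 0.
Proof.
move=> Sf; rewrite spaceB; [|exact: density_torus|exact: torus_cst].
rewrite space_cst massE// mulrAC mulVf ?mul1r ?subrr// gt_eqF//; exact: vol_gt0.
Qed.

Lemma potentialE f : potential f = fun x => - inv_laplacian (charge_excess f) x.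
Proof. by []. Qed.

Lemma potential_torus f : smooth f -> torus_smooth (potential f).
Proof.
move=> Sf; apply: torusN; apply: inv_laplacian_torus.
  exact: charge_excess_torus.
exact: charge_excess_mean.
Qed.

Lemma laplacianN a x : torus_smooth a -> laplacian (fun y => - a y) x = - laplacian a x.
Proof.
move=> Ta; rewrite (_ : (fun y => - a y) = fun y => -1 * a y).
  by rewrite laplacianZ// mulN1r.
by apply/funext => y; rewrite mulN1r.
Qed.

Lemma laplacian_potential f x : smooth f -> laplacian (potential f) x = mass f - density f x.
Proof.
move=> Sf; have T1 := charge_excess_torus Sf; have M1 := charge_excess_mean Sf.
have [_ _ _ L] := inv_laplacianP T1 M1.
by rewrite laplacianN ?L ?opprB//; exact: inv_laplacian_torus.
Qed.

Lemma potential_mean f : smooth f -> \int[@space_measure R d]_x potential f x = 0.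
Proof.
move=> Sf; have T1 := charge_excess_torus Sf; have M1 := charge_excess_mean Sf.
have [_ _ M2 _] := inv_laplacianP T1 M1.
by rewrite spaceN ?M2 ?oppr0//; exact: inv_laplacian_torus.
Qed.

Lemma potentialD f g : smooth f -> smooth g ->
  potential (f \+ g) = fun x => potential f x + potential g x.
Proof.
move=> Sf Sg; apply/funext => x; rewrite !potentialE.
rewrite (_ : charge_excess (f \+ g) = fun x => charge_excess f x + charge_excess g x).
  rewrite inv_laplacianD ?opprD//;
    (exact: charge_excess_torus || exact: charge_excess_mean).
by apply/funext => y; rewrite /charge_excess densityD// massD//; ring.
Qed.

Lemma partial_potentialD i f g x : smooth f -> smooth g ->
  partial i (potential (f \+ g)) x = partial i (potential f) x + partial i (potential g) x.
Proof.
move=> Sf Sg; rewrite potentialD// /partial deriveDx//; apply: (proj1 (potential_torus _)) => //.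
Qed.

Lemma mterm_bound_seq (l : seq idx) : exists C N0, 0 <= C :> R /\
  forall N, (N0 <= N)%N -> forall f, smooth f -> forall s, s \in l -> forall x,
  `|mterm [::] s [::] f x| <= C * snorm N f.
Proof.
elim: l => [|s l [C [N0 [C0 HC]]]]; first by exists 0, 0%N; split=> // N _ f Sf s.
have [C' [N0' [C0' HC']]] := @mterm_bound R d [::] s [::].
exists (C + C'), (maxn N0 N0'); split; first exact: addr_ge0.
move=> N; rewrite geq_max => /andP[HN HN'] f Sf s'; rewrite inE => /orP[/eqP ->|sl] x.
  by apply: (le_trans (HC' _ HN' _ Sf x)); rewrite ler_wpM2r ?snorm_ge0// lerDr.
by apply: (le_trans (HC _ HN _ Sf _ sl x)); rewrite ler_wpM2r ?snorm_ge0// lerDl.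
Qed.

(** The estimate behind every remainder that involves the field: the force is controlled in sup norm
    by a norm of [f], linearly and uniformly in [f]. *)
Lemma partial_potential_bound i : xbound (fun f => partial i (potential f)).
Proof.
have [C [N0 [C0 HC]]] := mterm_bound_seq [seq rcons p i | p <- subs (enum 'I_d)].
exists (2 * (@elliptic_cst R d * C)), N0; split.
  by apply: mulr_ge0 => //; apply: mulr_ge0 => //; exact: elliptic_cst_ge0.
move=> N HN f Sf x.
have T1 := charge_excess_torus Sf; have M1 := charge_excess_mean Sf.
have T2 := inv_laplacian_torus T1 M1.
have -> : partial i (potential f) x = - partial i (inv_laplacian (charge_excess f)) x.
  by apply: deriveNx; case: T2.
rewrite normrN.
have -> : 2 * (@elliptic_cst R d * C) * snorm N f = 2 * (@elliptic_cst R d * (C * snorm N f)).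
  by move: (@elliptic_cst R d) => e; rewrite !mulrA.
apply: (@partial_inv_laplacian_le R d _ i _ T1 M1) => // p Hp z.
rewrite map_rcons derive_along_rcons.
(* The mass is constant in space and drops out, leaving derivatives of the density only. *)
have -> : 'D_(ebase i) (charge_excess f) = 'D_(ebase i) (density f).
  have [Cd _] := density_torus Sf; apply/funext => y.
  rewrite /charge_excess deriveBx//; last exact: Cinfty_cst.
  by rewrite (derive_cst (mass f)) subr0.
rewrite -derive_along_rcons -map_rcons densityE derive_along_mterm// cats0.
by apply: HC => //; exact: map_f.
Qed.

Lemma density_bound : xbound (@density R d).
Proof.
have [C [N0 [C0 HC]]] := @mterm_bound R d [::] [::] [::].
by exists C, N0; split=> // N HN f Sf x; rewrite densityE; exact: HC.
Qed.

(** Symmetry of the inverse Laplacian. The mass term drops out because [inv_laplacian w] has zero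
    mean. *)
Lemma potential_dual f w : smooth f -> torus_smooth w -> \int[@space_measure R d]_x w x = 0 ->
  \int[@space_measure R d]_x (potential f x * w x) =
  - \int[@space_measure R d]_x (inv_laplacian w x * density f x).
Proof.
move=> Sf Tw w0; have [_ _ u0 Lu] := inv_laplacianP Tw w0.
have Tu := inv_laplacian_torus Tw w0; have Tp := potential_torus Sf; have Td := density_torus Sf.
transitivity (\int[@space_measure R d]_x (potential f x * laplacian (inv_laplacian w) x)).
  by apply: eq_Rintegral => x _; rewrite Lu.
apply: (etrans (esym (space_laplacian_sym Tp Tu))).
transitivity (\int[@space_measure R d]_x
    (mass f * inv_laplacian w x - inv_laplacian w x * density f x)).
  by apply: eq_Rintegral => x _; rewrite laplacian_potential// mulrBl [density _ _ * _]mulrC.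
have T1 : torus_smooth (fun x => mass f * inv_laplacian w x) := torusZ (mass f) Tu.
have T2 : torus_smooth (fun x => inv_laplacian w x * density f x) := torusM Tu Td.
by rewrite (spaceB T1 T2) (spaceZ (mass f) Tu) u0 mulr0 sub0r.
Qed.

End poisson_potential.

(** * Derivatives of the functionals and their brackets *)

Section functionals.
Context {R : realType} {d : nat}.
Local Notation V := 'rV[R]_d.
Local Notation phase := ('rV[R]_d * 'rV[R]_d)%type.
Local Notation vol := ((2 * pi : R) ^+ d).
Local Notation idx := (seq 'I_d).
Local Notation sint a := (\int[@space_measure R d]_x a x).
Implicit Types (f g h df : phase -> R) (a b w : V -> R).

Lemma admissible_fst_term a t s r f : torus_smooth a -> smooth f ->
  admissible (fun z => a z.1 * term t s r f z).
Proof. by move=> Ta Sf; apply: admissible_fst => //; exact: term_admissible. Qed.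

Lemma phase_term_sum I (l : seq I) (a : I -> V -> R) (t s r : I -> idx) f :
  smooth f -> (forall k, torus_smooth (a k)) ->
  \int[phase_measure d]_z \sum_(k <- l) (a k z.1 * term (t k) (s k) (r k) f z) =
  \sum_(k <- l) \int[@space_measure R d]_x (a k x * mterm (t k) (s k) (r k) f x).
Proof.
move=> Sf Ta; have A k := admissible_fst_term (t k) (s k) (r k) (Ta k) Sf.
elim: l => [|k l IH].
  rewrite big_nil; under eq_Rintegral do rewrite big_nil.
  by rewrite Rintegral_cst// mul0r.
rewrite big_cons -IH -phase_moment//; last exact: term_admissible.
rewrite -RintegralD//; last 2 first.
- exact: (phase_integrable (A k)).
- by apply: phase_integrable; apply: admissible_sum => j _; exact: A.
by apply: eq_Rintegral => z _; rewrite big_cons.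
Qed.

Lemma mbracket_fst a f z : torus_smooth a ->
  mbracket (fun z => a z.1) f z = \sum_i partial i a z.1 * dV i f z.
Proof.
move=> [Ca _]; rewrite /mbracket [X in _ - X]big1 ?subr0 => [|i _].
  by apply: eq_bigr => i _; rewrite /dX derive_fst.
by rewrite {1}/dV derive_fst// derive0 mul0r.
Qed.

Definition kinetic_derivative (z : phase) : R := (\sum_(i < d) z.2 ord0 i ^+ 2) / 2.

Lemma kinetic_derivative_term t s r f z : kinetic_derivative z * term t s r f z =
  \sum_i 2^-1 * term (i :: i :: t) s r f z.
Proof.
rewrite /kinetic_derivative mulrAC mulr_suml mulr_suml; apply: eq_bigr => i _.
by rewrite /term !monS /coord_v; ring.
Qed.

Lemma kinetic_admissible f : smooth f -> admissible (fun z => kinetic_derivative z * f z).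
Proof.
move=> Sf; rewrite (_ : (fun z => _) = fun z => \sum_i 2^-1 * term [:: i; i] [::] [::] f z).
  by apply: admissible_sum => i _; apply: admissibleZ; exact: term_admissible.
by apply/funext => z; rewrite -kinetic_derivative_term term_nil.
Qed.

Lemma frechet_kinetic f : smooth f -> is_frechet kinetic f kinetic_derivative.
Proof.
move=> Sf; split.
- rewrite (_ : kinetic_derivative = fun z => 2^-1 * \sum_i coord_v i z ^+ 2).
    by apply: CinftyZ; apply: Cinfty_sum => i _; apply: CinftyX; exact: Cinfty_coord_v.
  by apply/funext => z; rewrite mulrC.
- by [].
- by move=> df Sdf; apply: phase_integrable; exact: kinetic_admissible.
(* [kinetic] is linear, so its remainder vanishes identically. *)
exists 0%N, 0 => df Sdf _; rewrite mul0r.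
have E : kinetic (f \+ df) = kinetic f + \int[phase_measure d]_z (kinetic_derivative z * df z).
  rewrite /kinetic -RintegralD//; last 2 first.
  - exact: (phase_integrable (kinetic_admissible Sf)).
  - exact: (phase_integrable (kinetic_admissible Sdf)).
  by apply: eq_Rintegral => z _; rewrite -mulrDr.
by rewrite E [_ + _ - kinetic f]addrAC subrr add0r subrr normr0.
Qed.

Lemma xbound_all (A : 'I_d -> (phase -> R) -> V -> R) : (forall i, xbound (A i)) ->
  exists C N0, 0 <= C /\ forall N, (N0 <= N)%N -> forall f, smooth f ->
    forall i x, `|A i f x| <= C * snorm N f.
Proof.
move=> /choice[C /choice[N0 H]].
exists (\sum_i C i), (\max_i N0 i)%N; split; first by apply: sumr_ge0 => i _; have [] := H i.
move=> N HN f Sf i x; have [C0 Hi] := H i.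
apply: (le_trans (Hi N (leq_trans (leq_bigmax i) HN) f Sf x)).
rewrite ler_wpM2r ?snorm_ge0//; apply: le_sum_nonneg => j; by have [] := H j.
Qed.

Lemma torus_grad i f : smooth f -> torus_smooth (partial i (potential f)).
Proof. by move=> Sf; apply: torus_partial; exact: potential_torus. Qed.

Lemma electricE f : smooth f -> electric f =
  2^-1 * \sum_i sint (fun x => partial i (potential f) x * partial i (potential f) x).
Proof.
move=> Sf; have T i := torusM (torus_grad i Sf) (torus_grad i Sf).
rewrite -(space_sum _ T) -(spaceZ _ (torus_sum _ T)).
apply: eq_Rintegral => x _; congr (_ * _); apply: eq_bigr => i _.
by rewrite /efield sqrrN expr2.
Qed.

(** Green's formula and the Poisson equation for [g]; the potential of [f] has zero mean, so the
    mass of [g] does not contribute. This turns the cross term of the electric energy into a pairing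
    with the variation. *)
Lemma grad_dual f g : smooth f -> smooth g ->
  \sum_i sint (fun x => partial i (potential f) x * partial i (potential g) x) =
  sint (fun x => potential f x * density g x).
Proof.
move=> Sf Sg; have Tf := potential_torus Sf; have Tg := potential_torus Sg.
have Td := density_torus Sg.
have T1 i := torusM (torus_grad i Sf) (torus_grad i Sg).
rewrite -(space_sum _ T1); apply: oppr_inj.
transitivity (- sint (fun x => \sum_i partial i (potential g) x * partial i (potential f) x)).
  by apply: (congr1 -%R); apply: eq_Rintegral => x _; apply: eq_bigr => i _; exact: mulrC.
apply: (etrans (esym (space_green Tg Tf))).
transitivity (sint (fun x => mass g * potential f x - potential f x * density g x)).
  by apply: eq_Rintegral => x _; rewrite laplacian_potential// mulrBl [density _ _ * _]mulrC.
by rewrite (spaceB (torusZ _ Tf) (torusM Tf Td)) (spaceZ _ Tf) potential_mean// mulr0 sub0r.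
Qed.

Lemma frechet_fst_integrable a df : torus_smooth a -> smooth df ->
  (phase_measure d).-integrable setT (fun z => (a z.1 * df z)%:E).
Proof.
move=> Ta Sdf; apply: phase_integrable; apply: admissible_fst => //; exact: smooth_admissible.
Qed.

Lemma phase_density a f : torus_smooth a -> smooth f ->
  \int[phase_measure d]_z (a z.1 * f z) = sint (fun x => a x * density f x).
Proof. by move=> Ta Sf; rewrite phase_moment//; exact: smooth_admissible. Qed.

Lemma space_sqrD (a b : 'I_d -> V -> R) :
  (forall i, torus_smooth (a i)) -> (forall i, torus_smooth (b i)) ->
  \sum_i sint (fun x => (a i x + b i x) * (a i x + b i x)) =
  \sum_i sint (fun x => a i x * a i x) + 2 * \sum_i sint (fun x => a i x * b i x) +
  \sum_i sint (fun x => b i x * b i x).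
Proof.
move=> Ta Tb; rewrite mulr_sumr -!big_split; apply: eq_bigr => i _ /=.
have T1 := torusM (Ta i) (Ta i); have T2 := torusM (Ta i) (Tb i); have T3 := torusM (Tb i) (Tb i).
rewrite -(spaceZ 2 T2) -(spaceD T1 (torusZ 2 T2)) -(spaceD (torusD T1 (torusZ 2 T2)) T3).
by apply: eq_Rintegral => x _ /=; ring.
Qed.

Lemma space_sqr_le (b : 'I_d -> V -> R) (B : R) : (forall i, torus_smooth (b i)) ->
  (forall i x, `|b i x| <= B) -> `|\sum_i sint (fun x => b i x * b i x)| <= d%:R * vol * B ^+ 2.
Proof.
move=> Tb HB; apply: (le_trans (ler_norm_sum _ _ _)).
apply: (@le_trans _ _ (\sum_(i < d) B ^+ 2 * vol)).
  apply: ler_sum => i _; apply: space_le; first exact: torusM.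
  by move=> x; rewrite normrM expr2; apply: ler_pM => //; exact: HB.
by rewrite sumr_const card_ord -[leLHS]mulr_natl -mulrA ler_wpM2l// mulrC.
Qed.

Lemma grad_potentialD i f g : smooth f -> smooth g ->
  partial i (potential (f \+ g)) =
  fun x => partial i (potential f) x + partial i (potential g) x.
Proof. by move=> Sf Sg; apply/funext => x; exact: partial_potentialD. Qed.

(** [electric] is a quadratic form: the cross term is the pairing with the potential, and the
    remainder is the field energy of [df]. *)
Lemma frechet_electric f : smooth f -> is_frechet electric f (fun z => potential f z.1).
Proof.
move=> Sf; have Tp := potential_torus Sf; have [Cp pp] := Tp.
split.
- exact: Cinfty_fst.
- by move=> v i x; exact: pp.
- by move=> df Sdf; exact: frechet_fst_integrable.
have [C [N0 [C0 HC]]] := xbound_all (@partial_potential_bound R d).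
exists N0, (2^-1 * (d%:R * vol * C ^+ 2)) => df Sdf _.
have Ta i := torus_grad i Sf; have Tb i := torus_grad i Sdf.
have E := electricE (smoothD Sf Sdf).
have E1 : electric (f \+ df) = electric f + sint (fun x => potential f x * density df x) +
    2^-1 * \sum_i sint (fun x => partial i (potential df) x * partial i (potential df) x).
  have E3 : \sum_i sint (fun x => partial i (potential (f \+ df)) x * partial i (potential (f \+ df)) x) =
     \sum_i sint (fun x => (partial i (potential f) x + partial i (potential df) x) *
       (partial i (potential f) x + partial i (potential df) x)).
    by apply: eq_bigr => i _; rewrite (grad_potentialD i Sf Sdf).
  have arith (A B C' D e : R) : e = 2^-1 * A -> B = D ->
      2^-1 * (A + 2 * B + C') = e + D + 2^-1 * C' by move=> -> ->; field.
  apply: (etrans E (etrans (congr1 ( *%R 2^-1) (etrans E3 (space_sqrD Ta Tb))) _)).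
  exact: (arith _ _ _ _ _ (electricE Sf) (grad_dual Sf Sdf)).
have rem (U D X : R) : U + D + X - U - D = X by ring.
rewrite E1 (phase_density Tp Sdf) rem.
rewrite normrM ger0_norm ?invr_ge0// -!mulrA ler_pM2l ?invr_gt0//.
apply: (le_trans (space_sqr_le Tb (HC N0 (leqnn _) df Sdf))).
by rewrite [(C * _) ^+ 2]exprMn !mulrA.
Qed.

(** The derivative of [electric] depends on [x] only, so the microcanonical bracket retains just the
    force term. *)
Lemma bracket_electric H f : smooth f -> bracket H electric f =
  \int[phase_measure d]_z (frechet H f z * \sum_i partial i (potential f) z.1 * dV i f z).
Proof.
move=> Sf; rewrite /bracket (frechet_eq (frechet_electric Sf)).
by apply: eq_Rintegral => z _; rewrite mbracket_fst//; exact: potential_torus.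
Qed.

End functionals.

(** * Expansions of bilinear and cubic integrals over the torus *)

Section abstract_sums.
Context {R : realType} {d : nat}.
Local Notation V := 'rV[R]_d.
Local Notation vol := ((2 * pi : R) ^+ d).
Local Notation sint a := (\int[@space_measure R d]_x a x).
Implicit Types (a b c j k : 'I_d -> V -> R) (u w : V -> R).

Lemma space_mulD a b j k : (forall i, torus_smooth (a i)) -> (forall i, torus_smooth (b i)) ->
  (forall i, torus_smooth (j i)) -> (forall i, torus_smooth (k i)) ->
  \sum_i sint (fun x => (a i x + b i x) * (j i x + k i x)) =
  \sum_i sint (fun x => a i x * j i x) + \sum_i sint (fun x => a i x * k i x) +
  \sum_i sint (fun x => b i x * j i x) + \sum_i sint (fun x => b i x * k i x).
Proof.
move=> Ta Tb Tj Tk; rewrite -!big_split; apply: eq_bigr => i _ /=.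
have T1 := torusM (Ta i) (Tj i); have T2 := torusM (Ta i) (Tk i).
have T3 := torusM (Tb i) (Tj i); have T4 := torusM (Tb i) (Tk i).
rewrite -(spaceD T1 T2) -(spaceD (torusD T1 T2) T3) -(spaceD (torusD (torusD T1 T2) T3) T4).
by apply: eq_Rintegral => x _ /=; ring.
Qed.

(** Grouped for a cubic functional: the value, the two first-order parts, and all higher orders with
    a factor [b i] taken out, ready for [space_mul_le]. *)
Lemma space_cubeD a b u w : (forall i, torus_smooth (a i)) -> (forall i, torus_smooth (b i)) ->
  torus_smooth u -> torus_smooth w ->
  \sum_i sint (fun x => (a i x + b i x) * (a i x + b i x) * (u x + w x)) =
  \sum_i sint (fun x => a i x * a i x * u x) + \sum_i sint (fun x => a i x * a i x * w x) +
  \sum_i sint (fun x => b i x * (2 * (a i x * u x))) +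
  \sum_i sint (fun x => b i x * (2 * (a i x * w x) + b i x * u x + b i x * w x)).
Proof.
move=> Ta Tb Tu Tw; rewrite -!big_split; apply: eq_bigr => i _ /=.
have T1 := torusM (torusM (Ta i) (Ta i)) Tu; have T2 := torusM (torusM (Ta i) (Ta i)) Tw.
have T3 := torusM (Tb i) (torusZ 2 (torusM (Ta i) Tu)).
have T4 := torusM (Tb i) (torusD (torusD (torusZ 2 (torusM (Ta i) Tw)) (torusM (Tb i) Tu)) (torusM (Tb i) Tw)).
rewrite -(spaceD T1 T2) -(spaceD (torusD T1 T2) T3) -(spaceD (torusD (torusD T1 T2) T3) T4).
by apply: eq_Rintegral => x _ /=; ring.
Qed.

Lemma space_mul_le b k (B K : R) : (forall i, torus_smooth (b i)) ->
  (forall i, torus_smooth (k i)) ->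
  (forall i x, `|b i x| <= B) -> (forall i x, `|k i x| <= K) ->
  `|\sum_i sint (fun x => b i x * k i x)| <= d%:R * vol * (B * K).
Proof.
move=> Tb Tk HB HK; apply: (le_trans (ler_norm_sum _ _ _)).
apply: (@le_trans _ _ (\sum_(i < d) B * K * vol)).
  apply: ler_sum => i _; apply: space_le; first exact: torusM.
  by move=> x; rewrite normrM ler_pM.
rewrite sumr_const card_ord; move: vol => e.
by rewrite (_ : d%:R * e * (B * K) = (B * K * e) *+ d)// -[RHS]mulr_natl; ring.
Qed.

Lemma space_parts_sum u j : torus_smooth u -> (forall i, torus_smooth (j i)) ->
  \sum_i sint (fun x => partial i u x * j i x) =
  - sint (fun x => u x * \sum_i partial i (j i) x).
Proof.
move=> Tu Tj; have Tp i := torusM Tu (torus_partial i (Tj i)).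
transitivity (\sum_i - sint (fun x => u x * partial i (j i) x)).
  by apply: eq_bigr => i _; exact: space_parts.
rewrite sumrN -(space_sum _ Tp); apply: (congr1 -%R).
by apply: eq_Rintegral => x _; rewrite mulr_sumr.
Qed.

Lemma space_sum_mulr a w : (forall i, torus_smooth (a i)) -> torus_smooth w ->
  sint (fun x => (\sum_i a i x) * w x) = \sum_i sint (fun x => a i x * w x).
Proof.
move=> Ta Tw; have T i := torusM (Ta i) Tw; rewrite -(space_sum _ T).
by apply: eq_Rintegral => x _; rewrite mulr_suml.
Qed.

End abstract_sums.

Section brackets.
Context {R : realType} {d : nat}.
Local Notation V := 'rV[R]_d.
Local Notation phase := ('rV[R]_d * 'rV[R]_d)%type.
Local Notation sint a := (\int[@space_measure R d]_x a x).
Implicit Types (f g h df : phase -> R) (a b w : V -> R) (G : (phase -> R) -> R).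

Definition divergence (j : 'I_d -> V -> R) (x : V) : R := \sum_i partial i (j i) x.

Lemma divergence_torus j : (forall i, torus_smooth (j i)) -> torus_smooth (divergence j).
Proof. by move=> Tj; apply: torus_sum => i; exact: torus_partial. Qed.

Lemma divergence_mean j : (forall i, torus_smooth (j i)) -> sint (divergence j) = 0.
Proof.
move=> Tj; rewrite (space_sum _ (fun i => torus_partial i (Tj i))).
by apply: big1 => i _; exact: space_partial.
Qed.

Lemma inv_divergence_torus j : (forall i, torus_smooth (j i)) ->
  torus_smooth (inv_laplacian (divergence j)).
Proof. by move=> Tj; apply: inv_laplacian_torus; [exact: divergence_torus|exact: divergence_mean]. Qed.

(** Moves a variation of the potential onto the density: by parts onto the divergence of [j], then
    by symmetry of the inverse Laplacian. It supplies the nonlocal parts of [interaction_derivative]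
    and [flux_derivative]. *)
Lemma grad_current_dual g j : smooth g -> (forall i, torus_smooth (j i)) ->
  \sum_i sint (fun x => partial i (potential g) x * j i x) =
  sint (fun x => inv_laplacian (divergence j) x * density g x).
Proof.
move=> Sg Tj; apply: (etrans (space_parts_sum (potential_torus Sg) Tj)).
apply: (etrans (congr1 -%R (potential_dual Sg (divergence_torus Tj) (divergence_mean Tj)))).
exact: opprK.
Qed.

Definition current i f : V -> R := mterm [:: i] [::] [::] f.

Lemma current_torus i f : smooth f -> torus_smooth (current i f).
Proof. exact: mterm_torus. Qed.

Lemma mterm_force i f x : smooth f -> mterm [::] [::] [:: i] f x = 0.
Proof. by move=> Sf; rewrite mterm_parts//= big_nil oppr0. Qed.

Lemma mterm_current_force i j f x : smooth f ->
  mterm [:: j] [::] [:: i] f x = - ((j == i)%:R * density f x).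
Proof.
move=> Sf; rewrite mterm_parts//= densityE.
by case: (j == i); rewrite /= ?big_seq1 ?mul1r ?big_nil ?mul0r.
Qed.

Lemma mterm_energy_force i j f x : smooth f ->
  mterm [:: j; j] [::] [:: i] f x = - ((j == i)%:R * (2 * current i f x)).
Proof.
move=> Sf; rewrite mterm_parts//= /current.
have [->|_] := eqVneq j i; last by rewrite /= big_nil mul0r.
by rewrite /= big_cons big_seq1 mul1r; congr (- _); ring.
Qed.

Definition interaction f : R := - \sum_i sint (fun x => partial i (potential f) x * current i f x).

Lemma dV_term_nil t i f z : mon t z * dV i f z = term t [::] [:: i] f z.
Proof. by []. Qed.

(** Pairs of coordinates index the sum: the first is the direction of the force, the second the
    coordinate in the kinetic energy. *)
Lemma bracket_kinetic_electric f : smooth f -> bracket kinetic electric f = interaction f.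
Proof.
move=> Sf; rewrite bracket_electric// (frechet_eq (frechet_kinetic Sf)).
pose F (p : 'I_d * 'I_d) (x : V) := 2^-1 * partial p.1 (potential f) x.
have TF p : torus_smooth (F p) := torusZ 2^-1 (torus_grad p.1 Sf).
transitivity (\int[phase_measure d]_z \sum_(p <- index_enum ('I_d * 'I_d)%type)
    (F p z.1 * term [:: p.2; p.2] [::] [:: p.1] f z)).
  apply: eq_Rintegral => z _; rewrite mulr_sumr.
  transitivity (\sum_i \sum_j F (i, j) z.1 * term [:: j; j] [::] [:: i] f z); last first.
    exact: (pair_bigA _ (fun i j => F (i, j) z.1 * term [:: j; j] [::] [:: i] f z)).
  apply: eq_bigr => i _; rewrite mulrCA.
  have -> : dV i f z = term [::] [::] [:: i] f z by rewrite -dV_term_nil /mon big_nil mul1r.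
  rewrite kinetic_derivative_term mulr_sumr; apply: eq_bigr => j _; rewrite /F /=.
  by move: (partial _ _ _) (term _ _ _ _ _) => p q; rewrite mulrCA mulrA.
apply: (etrans (phase_term_sum _ (fun p => [:: p.2; p.2]) (fun=> [::]) (fun p => [:: p.1]) Sf TF)).
transitivity (\sum_i \sum_j sint (fun x => F (i, j) x * mterm [:: j; j] [::] [:: i] f x)).
  by apply/esym; exact: (pair_bigA _ (fun i j => sint (fun x => F (i, j) x * mterm [:: j; j] [::] [:: i] f x))).
rewrite /interaction -sumrN; apply: eq_bigr => i _.
have Ti := torusM (torus_grad i Sf) (current_torus i Sf).
(* Off the diagonal the velocity derivative meets a monomial free of [v_i] and integrates to
   zero. *)
rewrite (bigD1 i)//= [X in _ + X]big1 => [|j ji]; last first.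
  transitivity (sint (fun _ => 0)); last by rewrite space_cst mul0r.
  by apply: eq_Rintegral => x _; rewrite mterm_energy_force// (negbTE ji) mul0r oppr0 mulr0.
rewrite addr0 -(spaceN Ti); apply: eq_Rintegral => x _.
rewrite mterm_energy_force// eqxx /F /=.
by move: (partial _ _ _) (current _ _ _) => p q; field.
Qed.

End brackets.

(** * The functional obtained from the first bracket *)

Section interaction_brackets.
Context {R : realType} {d : nat}.
Local Notation V := 'rV[R]_d.
Local Notation phase := ('rV[R]_d * 'rV[R]_d)%type.
Local Notation vol := ((2 * pi : R) ^+ d).
Local Notation sint a := (\int[@space_measure R d]_x a x).
Implicit Types (f g h df : phase -> R) (a b w : V -> R) (G : (phase -> R) -> R).

Lemma currentD i f g : smooth f -> smooth g ->
  current i (f \+ g) = fun x => current i f x + current i g x.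
Proof. by move=> Sf Sg; apply/funext => x; exact: mtermD. Qed.

Lemma densityD_fun f g : smooth f -> smooth g ->
  density (f \+ g) = fun x => density f x + density g x.
Proof. by move=> Sf Sg; apply/funext => x; exact: densityD. Qed.

(** The contribution of varying the potential inside [interaction], after [grad_current_dual] has
    moved the variation onto the density. *)
Definition interaction_potential f : V -> R :=
  fun x => - inv_laplacian (divergence (fun i => current i f)) x.

Definition interaction_derivative f (z : phase) : R :=
  interaction_potential f z.1 - \sum_i partial i (potential f) z.1 * coord_v i z.

Lemma interaction_potential_torus f : smooth f -> torus_smooth (interaction_potential f).
Proof. by move=> Sf; apply: torusN; apply: inv_divergence_torus => i; exact: current_torus. Qed.

Lemma interaction_derivativeM f g z : interaction_derivative f z * g z =
  interaction_potential f z.1 * g z -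
  \sum_i partial i (potential f) z.1 * term [:: i] [::] [::] g z.
Proof.
rewrite /interaction_derivative mulrBl mulr_suml; congr (_ - _); apply: eq_bigr => i _.
by rewrite /term /mon big_seq1 mulrA.
Qed.

Lemma interaction_admissible f g : smooth f -> smooth g ->
  admissible (fun z => interaction_potential f z.1 * g z) /\
  admissible (fun z => \sum_i partial i (potential f) z.1 * term [:: i] [::] [::] g z).
Proof.
move=> Sf Sg; split.
  apply: admissible_fst; [exact: interaction_potential_torus|exact: smooth_admissible].
by apply: admissible_sum => i _; apply: admissible_fst_term => //; exact: torus_grad.
Qed.

Lemma interaction_derivative_int f g : smooth f -> smooth g ->
  (phase_measure d).-integrable setT (fun z => (interaction_derivative f z * g z)%:E) /\
  \int[phase_measure d]_z (interaction_derivative f z * g z) =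
  sint (fun x => interaction_potential f x * density g x) -
  \sum_i sint (fun x => partial i (potential f) x * current i g x).
Proof.
move=> Sf Sg; have [A1 A2] := interaction_admissible Sf Sg.
have E : (fun z => interaction_derivative f z * g z) = fun z =>
  interaction_potential f z.1 * g z -
  \sum_i partial i (potential f) z.1 * term [:: i] [::] [::] g z.
  by apply/funext => z; exact: interaction_derivativeM.
split.
  rewrite (_ : (fun z => _) = EFin \o (fun z => interaction_derivative f z * g z))// E.
  by apply: integrable_sub; exact: phase_integrable.
rewrite E RintegralB//; [|exact: (phase_integrable A1)|exact: (phase_integrable A2)].
have -> : \int[phase_measure d]_z (interaction_potential f z.1 * g z) =
    sint (fun x => interaction_potential f x * density g x).
  by apply: phase_density => //; exact: interaction_potential_torus.
apply: (congr1 (fun y => _ - y)).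
exact: (phase_term_sum _ (fun i => [:: i]) (fun=> [::]) (fun=> [::]) Sg (fun i => torus_grad i Sf)).
Qed.

(** [interaction] is quadratic in [f] through a bilinear pairing of force and current, so its
    remainder is its own value at [df], at most a sup bound of the force times one of the
    current. *)
Lemma frechet_interaction f : smooth f -> is_frechet interaction f (interaction_derivative f).
Proof.
move=> Sf; have Tp := interaction_potential_torus Sf; have [Cp pp] := Tp.
split.
- apply: CinftyB; first exact: Cinfty_fst.
  apply: Cinfty_sum => i _; apply: CinftyM; last exact: Cinfty_coord_v.
  by apply: Cinfty_fst; case: (torus_grad i Sf).
- move=> v i x; rewrite /interaction_derivative /= pp; congr (_ - _).
  by apply: eq_bigr => j _; have [_ ->] := torus_grad j Sf.
- by move=> df Sdf; have [] := interaction_derivative_int Sf Sdf.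
have [C [N0 [C0 HC]]] := xbound_all (@partial_potential_bound R d).
have [C' [N0' [C0' HC']]] := xbound_all (fun i => @mterm_bound R d [:: i] [::] [::]).
pose N := maxn N0 N0'; exists N, (d%:R * vol * (C * C')) => df Sdf _.
have Ta i := torus_grad i Sf; have Tb i := torus_grad i Sdf.
have Tj i := current_torus i Sf; have Tk i := current_torus i Sdf.
have [_ I2] := interaction_derivative_int Sf Sdf.
have E3 : \sum_i sint (fun x => partial i (potential (f \+ df)) x * current i (f \+ df) x) =
   \sum_i sint (fun x => (partial i (potential f) x + partial i (potential df) x) *
     (current i f x + current i df x)).
  by apply: eq_bigr => i _; rewrite (grad_potentialD i Sf Sdf) (currentD i Sf Sdf).
have D := grad_current_dual Sdf Tj.
have P : sint (fun x => interaction_potential f x * density df x) =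
    - sint (fun x => inv_laplacian (divergence (fun i => current i f)) x * density df x).
  rewrite -(spaceN (torusM (inv_divergence_torus Tj) (density_torus Sdf))).
  by apply: eq_Rintegral => x _; exact: mulNr.
have arith (A B C1 D1 S Q : R) : B = S -> Q = - S -> - (A + D1 + B + C1) - - A - (Q - D1) = - C1.
  by move=> -> ->; ring.
rewrite {1}/interaction I2 E3 (space_mulD Ta Tb Tj Tk) (arith _ _ _ _ _ _ D P) normrN.
have B : d%:R * vol * (C * snorm N df * (C' * snorm N df)) = d%:R * vol * (C * C') * snorm N df ^+ 2.
  by move: vol => e; ring.
rewrite -B; apply: space_mul_le => // i x.
- by apply: HC => //; exact: leq_maxl.
- by apply: HC' => //; exact: leq_maxr.
Qed.

Definition energy_flux f : R :=
  \sum_i sint (fun x => partial i (potential f) x * partial i (potential f) x * density f x).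

Lemma force_termE f z : \sum_i partial i (potential f) z.1 * dV i f z =
  \sum_i partial i (potential f) z.1 * term [::] [::] [:: i] f z.
Proof. by apply: eq_bigr => i _; rewrite -dV_term_nil /mon big_nil mul1r. Qed.

(** A factor depending on [x] alone leaves an exact velocity derivative. The vanishing serves the
    second bracket, the third bracket, and, with [H = 1], the conservation of mass. *)
Lemma phase_force H f : torus_smooth H -> smooth f ->
  admissible (fun z => H z.1 * \sum_i partial i (potential f) z.1 * dV i f z) /\
  \int[phase_measure d]_z (H z.1 * \sum_i partial i (potential f) z.1 * dV i f z) = 0.
Proof.
move=> TH Sf; have T i := torusM TH (torus_grad i Sf).
have E : (fun z => H z.1 * \sum_i partial i (potential f) z.1 * dV i f z) =
    fun z => \sum_i (H z.1 * partial i (potential f) z.1) * term [::] [::] [:: i] f z.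
  by apply/funext => z; rewrite force_termE mulr_sumr; apply: eq_bigr => i _; rewrite mulrA.
split.
  by rewrite E; apply: admissible_sum => i _; exact: (admissible_fst_term [::] [::] [:: i] (T i) Sf).
rewrite E.
apply: (etrans (phase_term_sum _ (fun=> [::]) (fun=> [::]) (fun i => [:: i]) Sf T)).
apply: big1 => i _; transitivity (sint (fun _ => 0)); last by rewrite space_cst mul0r.
by apply: eq_Rintegral => x _; rewrite mterm_force// mulr0.
Qed.

(** The part of the derivative depending on [x] contributes nothing by [phase_force]. In the part
    linear in [v], integration by parts pairs [v_j] with the derivative in [v_i] and leaves the
    density on the diagonal. *)
Lemma bracket_interaction f : smooth f ->
  admissible (fun z => interaction_derivative f z * \sum_i partial i (potential f) z.1 * dV i f z) /\
  \int[phase_measure d]_z (interaction_derivative f z *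
    \sum_i partial i (potential f) z.1 * dV i f z) = energy_flux f.
Proof.
move=> Sf; have [A1 I1] := phase_force (interaction_potential_torus Sf) Sf.
pose F (p : 'I_d * 'I_d) (x : V) := partial p.2 (potential f) x * partial p.1 (potential f) x.
have TF p : torus_smooth (F p) := torusM (torus_grad p.2 Sf) (torus_grad p.1 Sf).
pose S z := \sum_(p <- index_enum ('I_d * 'I_d)%type)
    (F p z.1 * term [:: p.2] [::] [:: p.1] f z).
have AS : admissible S.
  by apply: admissible_sum => p _; exact: (admissible_fst_term [:: p.2] [::] [:: p.1] (TF p) Sf).
have E : (fun z => interaction_derivative f z * \sum_i partial i (potential f) z.1 * dV i f z) =
  fun z => interaction_potential f z.1 * (\sum_i partial i (potential f) z.1 * dV i f z) - S z.
  apply/funext => z; rewrite /interaction_derivative mulrBl; congr (_ - _).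
  rewrite force_termE mulr_sumr.
  transitivity (\sum_i \sum_j F (i, j) z.1 * term [:: j] [::] [:: i] f z); last first.
    exact: (pair_bigA _ (fun i j => F (i, j) z.1 * term [:: j] [::] [:: i] f z)).
  apply: eq_bigr => i _; rewrite mulr_suml; apply: eq_bigr => j _.
  rewrite /F /= /term /mon big_nil big_seq1 mul1r.
  by move: (partial _ _ _) (partial _ _ _) (derive_along _ _ _) => p q r; ring.
split.
  rewrite E (_ : (fun z => _) = fun z => interaction_potential f z.1 *
    (\sum_i partial i (potential f) z.1 * dV i f z) + -1 * S z).
    by apply: admissibleD => //; exact: admissibleZ.
  by apply/funext => z; rewrite mulN1r.
rewrite E RintegralB//; [|exact: (phase_integrable A1)|exact: (phase_integrable AS)].
rewrite I1 sub0r.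
apply: (etrans (congr1 -%R (phase_term_sum _ (fun p => [:: p.2]) (fun=> [::]) (fun p => [:: p.1]) Sf TF))).
transitivity (- \sum_i \sum_j sint (fun x => F (i, j) x * mterm [:: j] [::] [:: i] f x)).
  by apply/(congr1 -%R)/esym; exact: (pair_bigA _ (fun i j => sint (fun x => F (i, j) x * mterm [:: j] [::] [:: i] f x))).
rewrite -sumrN; apply: eq_bigr => i _.
rewrite (bigD1 i)//= [X in _ + X]big1 => [|j ji]; last first.
  transitivity (sint (fun _ => 0)); last by rewrite space_cst mul0r.
  by apply: eq_Rintegral => x _; rewrite mterm_current_force// (negbTE ji) mul0r oppr0 mulr0.
have Ti := torusM (TF (i, i)) (mterm_torus [:: i] [::] [:: i] Sf).
rewrite addr0 -(spaceN Ti); apply: eq_Rintegral => x _.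
rewrite /= mterm_current_force// eqxx /F /=.
by move: (partial _ _ _) (density _ _) => p q; ring.
Qed.

End interaction_brackets.

(** * The functional obtained from the second bracket, and the third bracket *)

Section energy_flux_brackets.
Context {R : realType} {d : nat}.
Local Notation V := 'rV[R]_d.
Local Notation phase := ('rV[R]_d * 'rV[R]_d)%type.
Local Notation vol := ((2 * pi : R) ^+ d).
Local Notation sint a := (\int[@space_measure R d]_x a x).
Implicit Types (f g h df : phase -> R) (a b w : V -> R) (G : (phase -> R) -> R).

Definition grad_sqr f (x : V) : R := \sum_i partial i (potential f) x * partial i (potential f) x.

Lemma grad_sqr_torus f : smooth f -> torus_smooth (grad_sqr f).
Proof. by move=> Sf; apply: torus_sum => i; apply: torusM; exact: torus_grad. Qed.

Definition weighted_gradient f (i : 'I_d) (x : V) : R := 2 * (partial i (potential f) x * density f x).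

Lemma weighted_gradient_torus f i : smooth f -> torus_smooth (weighted_gradient f i).
Proof. by move=> Sf; exact: (torusZ 2 (torusM (torus_grad i Sf) (density_torus Sf))). Qed.

Definition flux_potential f : V -> R := inv_laplacian (divergence (weighted_gradient f)).

Lemma flux_potential_torus f : smooth f -> torus_smooth (flux_potential f).
Proof. by move=> Sf; apply: inv_divergence_torus => i; exact: weighted_gradient_torus. Qed.

(** The first summand comes from varying the density, the second from varying both gradients,
    carried back to the density by [grad_current_dual]. No velocity appears, which is the reason for
    the third bracket to vanish. *)
Definition flux_derivative f (x : V) : R := grad_sqr f x + flux_potential f x.

Lemma flux_derivative_torus f : smooth f -> torus_smooth (flux_derivative f).
Proof. by move=> Sf; apply: torusD; [exact: grad_sqr_torus|exact: flux_potential_torus]. Qed.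

(** The functional is cubic, so the remainder has parts of order two and three in [df]. The constant
    depends on [f] through the sup bounds [A] of its force and [P] of its density. *)
Lemma frechet_energy_flux f : smooth f ->
  is_frechet energy_flux f (fun z => flux_derivative f z.1).
Proof.
move=> Sf; have Tp := flux_derivative_torus Sf; have [Cp pp] := Tp.
split.
- exact: Cinfty_fst.
- by move=> v i x; exact: pp.
- by move=> df Sdf; exact: frechet_fst_integrable.
have [C [N0 [C0 HC]]] := xbound_all (@partial_potential_bound R d).
have [C' [N0' [C0' HC']]] := @density_bound R d.
pose N := maxn N0 N0'; pose A := C * snorm N f; pose P := C' * snorm N f.
have A0 : 0 <= A by rewrite mulr_ge0// snorm_ge0.
have P0 : 0 <= P by rewrite mulr_ge0// snorm_ge0.
have HN := leq_maxl N0 N0'; have HN' := leq_maxr N0 N0'.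
exists N, (d%:R * vol * (C * (2 * (A * C') + C * P + C * C'))) => df Sdf s1.
have Ta i := torus_grad i Sf; have Tb i := torus_grad i Sdf.
have Tu := density_torus Sf; have Tw := density_torus Sdf.
have Tj i := weighted_gradient_torus i Sf.
have E3 : energy_flux (f \+ df) =
   \sum_i sint (fun x => (partial i (potential f) x + partial i (potential df) x) *
     (partial i (potential f) x + partial i (potential df) x) * (density f x + density df x)).
  by apply: eq_bigr => i _; rewrite (grad_potentialD i Sf Sdf) (densityD_fun Sf Sdf).
have E := etrans E3 (space_cubeD Ta Tb Tu Tw).
have D := grad_current_dual Sdf Tj.
have TG := grad_sqr_torus Sf; have TX := flux_potential_torus Sf.
have I2 : \int[phase_measure d]_z (flux_derivative f z.1 * df z) =
    \sum_i sint (fun x => partial i (potential f) x * partial i (potential f) x * density df x) +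
    sint (fun x => flux_potential f x * density df x).
  apply: (etrans (phase_density Tp Sdf)).
  rewrite -(space_sum_mulr (fun i => torusM (Ta i) (Ta i)) Tw) -(spaceD (torusM TG Tw) (torusM TX Tw)).
  by apply: eq_Rintegral => x _; exact: mulrDl.
have arith (F0 A1 B S Rm : R) : B = S -> F0 + A1 + B + Rm - F0 - (A1 + S) = Rm.
  by move=> ->; ring.
rewrite {1}E I2 (arith _ _ _ _ _ D).
set s := snorm N df in s1 *; have s0 : 0 <= s := snorm_ge0 _ _.
have B : d%:R * vol * (C * s * ((2 * (A * C') + C * P + C * C') * s)) =
    d%:R * vol * (C * (2 * (A * C') + C * P + C * C')) * s ^+ 2.
  by move: vol => e; ring.
rewrite -B; apply: space_mul_le => //.
- move=> i; exact: torusD (torusD (torusZ 2 (torusM (Ta i) Tw)) (torusM (Tb i) Tu)) (torusM (Tb i) Tw).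
- by move=> i x; exact: HC.
move=> i x; have Hb := HC N HN df Sdf i x; have Ha := HC N HN f Sf i x.
have Hu := HC' N HN' f Sf x; have Hw := HC' N HN' df Sdf x.
rewrite -/s in Hb Hw; rewrite -/A in Ha; rewrite -/P in Hu.
move: (partial i (potential f) x) (partial i (potential df) x) (density f x) (density df x) Ha Hb Hu Hw.
move=> a b u w Ha Hb Hu Hw.
have -> : (2 * (A * C') + C * P + C * C') * s = 2 * (A * (C' * s)) + C * s * P + C * s * C' by ring.
(* The third-order part is reduced to second order by [s <= 1], the smallness allowed by
   [is_frechet]. *)
apply: (le_trans (ler_normD _ _)); apply: lerD; last first.
  rewrite normrM; apply: ler_pM => //; apply: (le_trans Hw).
  by rewrite ler_piMr.
apply: (le_trans (ler_normD _ _)); apply: lerD; last by rewrite normrM; exact: ler_pM.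
by rewrite normrM ger0_norm// ler_wpM2l// normrM; exact: ler_pM.
Qed.

Lemma energy_fluxE f : smooth f -> energy_flux f = 2 * mass f * electric f + cubic f.
Proof.
move=> Sf; have Ta i := torus_grad i Sf; have T2 i := torusM (Ta i) (Ta i).
have TG := grad_sqr_torus Sf; have TL := torus_laplacian (potential_torus Sf).
have E1 := electricE Sf.
have E2 : electric f = 2^-1 * sint (grad_sqr f).
  by apply: (etrans E1); rewrite -(space_sum _ T2).
have E3 : cubic f = - sint (fun x => laplacian (potential f) x * grad_sqr f x).
  apply: (congr1 -%R); apply: eq_Rintegral => x _; apply: (congr1 ( *%R _)); rewrite /grad_sqr.
  by apply: eq_bigr => i _; rewrite expr2.
have E4 : energy_flux f = sint (fun x => mass f * grad_sqr f x - laplacian (potential f) x * grad_sqr f x).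
  apply: (etrans (esym (space_sum_mulr T2 (density_torus Sf)))).
  apply: eq_Rintegral => x _.
  change (grad_sqr f x * density f x = mass f * grad_sqr f x - laplacian (potential f) x * grad_sqr f x).
  rewrite (laplacian_potential x Sf).
  by move: (grad_sqr f x) (density f x) => p q; ring.
rewrite E4 (spaceB (torusZ _ TG) (torusM TL TG)) (spaceZ _ TG) E2 E3.
by move: (sint (grad_sqr f)) => p; field.
Qed.

Lemma frechet_bracket_kinetic f : smooth f ->
  is_frechet (bracket kinetic electric) f (interaction_derivative f).
Proof.
move=> Sf; apply: is_frechet_ext (frechet_interaction Sf) => // g.
exact: bracket_kinetic_electric.
Qed.

Lemma double_bracket f : smooth f ->
  bracket (bracket kinetic electric) electric f = energy_flux f.
Proof.
move=> Sf; rewrite bracket_electric// (frechet_eq (frechet_bracket_kinetic Sf)).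
by have [_ ->] := bracket_interaction Sf.
Qed.

Lemma frechet_double_bracket f : smooth f ->
  is_frechet (bracket (bracket kinetic electric) electric) f (fun z => flux_derivative f z.1).
Proof.
move=> Sf; apply: is_frechet_ext (frechet_energy_flux Sf) => // g; exact: double_bracket.
Qed.

Lemma bracket_defined_electric G f h : smooth f -> is_frechet G f h ->
  admissible (fun z => h z * \sum_i partial i (potential f) z.1 * dV i f z) ->
  bracket_defined G electric f.
Proof.
move=> Sf Gh Ah; have Gu := frechet_electric Sf; split; [by exists h|by exists (fun z => potential f z.1)|].
rewrite (frechet_eq Gh) (frechet_eq Gu).
have := phase_integrable Ah; congr (integrable _ _ (EFin \o _)); apply/funext => z.
by rewrite mbracket_fst//; exact: potential_torus.
Qed.

Lemma triple_bracket f : smooth f ->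
  bracket (bracket (bracket kinetic electric) electric) electric f = 0.
Proof.
move=> Sf; rewrite bracket_electric// (frechet_eq (frechet_double_bracket Sf)).
by have [_] := phase_force (flux_derivative_torus Sf) Sf.
Qed.

Lemma kinetic_force_admissible f : smooth f ->
  admissible (fun z => kinetic_derivative z * \sum_i partial i (potential f) z.1 * dV i f z).
Proof.
move=> Sf.
have -> : (fun z => kinetic_derivative z * \sum_i partial i (potential f) z.1 * dV i f z) =
    fun z => \sum_i \sum_(j < d) 2^-1 * (partial i (potential f) z.1 * term [:: j; j] [::] [:: i] f z).
  apply/funext => z; rewrite force_termE mulr_sumr; apply: eq_bigr => i _.
  rewrite mulrCA kinetic_derivative_term mulr_sumr; apply: eq_bigr => j _; exact: mulrCA.
apply: admissible_sum => i _; apply: admissible_sum => j _; apply: admissibleZ.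
exact: (admissible_fst_term [:: j; j] [::] [:: i] (torus_grad i Sf) Sf).
Qed.

End energy_flux_brackets.

Lemma cubic_dim1 (R : realType) (f : 'rV[R]_1 * 'rV[R]_1 -> R) : smooth f -> cubic f = 0.
Proof.
move=> Sf; have Ta := torus_grad ord0 Sf; set a := partial ord0 (potential f) in Ta.
(* In dimension one the integrand is [a' * a ^+ 2], the derivative of a third of the cube of [a]. *)
have [Ca _] := Ta; pose b y := 3^-1 * (a y * a y * a y).
have Tb : torus_smooth b := torusZ 3^-1 (torusM (torusM Ta Ta) Ta).
have C2 : Cinfty (fun y => a y * a y) := CinftyM Ca Ca.
have C3 : Cinfty (fun y => a y * a y * a y) := CinftyM C2 Ca.
have E x : partial ord0 b x = partial ord0 a x * a x ^+ 2.
  apply: (etrans (deriveZx 3^-1 _ _ C3)).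
  rewrite (deriveMx (f := fun y => a y * a y) _ _ C2 Ca) (deriveMx _ _ Ca Ca).
  by rewrite -/(partial ord0 a x); move: (partial _ _ _) (a x) => p q; field.
rewrite /cubic -[RHS]oppr0; apply: (congr1 -%R); apply: etrans (space_partial ord0 Tb).
by apply: eq_Rintegral => x _; rewrite E /laplacian !big_ord1.
Qed.

(** * Conservation of mass *)

Section conservation_of_mass.
Context {R : realType} {d : nat}.
Local Notation V := 'rV[R]_d.
Local Notation phase := ('rV[R]_d * 'rV[R]_d)%type.
Implicit Types (f g h : phase -> R).

Lemma dbound_all (A : 'I_d -> (phase -> R) -> phase -> R) : (forall i, dbound (A i)) ->
  exists C N0, 0 <= C /\ forall N, (N0 <= N)%N -> forall f, smooth f ->
    forall i z, `|A i f z| <= C * snorm N f * vw z.2.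
Proof.
move=> /choice[C /choice[N0 H]].
exists (\sum_i C i), (\max_i N0 i)%N; split; first by apply: sumr_ge0 => i _; have [] := H i.
move=> N HN f Sf i z; have [C0 Hi] := H i.
apply: (le_trans (Hi N (leq_trans (leq_bigmax i) HN) f Sf z)).
rewrite ler_wpM2r ?vw_ge0// ler_wpM2r ?snorm_ge0//; apply: le_sum_nonneg => j; by have [] := H j.
Qed.

Definition vlasov_rate f (z : phase) : R :=
  \sum_i partial i (potential f) z.1 * dV i f z - \sum_i z.2 ord0 i * dX i f z.

Lemma transportE f (z : phase) : \sum_i z.2 ord0 i * dX i f z = \sum_i term [:: i] [:: i] [::] f z.
Proof. by apply: eq_bigr => i _; rewrite /term /mon big_seq1. Qed.

(** The transport term is linear in [f] and the force term quadratic, hence the two powers of the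
    norm. The weight provides the integrable majorant for differentiation under the integral. *)
Lemma vlasov_rate_bound : exists C N0, 0 <= C /\ forall N, (N0 <= N)%N -> forall f, smooth f ->
  forall z, `|vlasov_rate f z| <= C * (snorm N f + snorm N f ^+ 2) * vw z.2.
Proof.
have [C1 [N1 [C10 H1]]] := xbound_all (@partial_potential_bound R d).
have [C2 [N2 [C20 H2]]] := dbound_all (fun i => @term_decay R d [::] [::] [:: i]).
have [C3 [N3 [C30 H3]]] := dbound_all (fun i => @term_decay R d [:: i] [:: i] [::]).
exists (d%:R * (C1 * C2 + C3)), (maxn N1 (maxn N2 N3)); split.
  by rewrite mulr_ge0// addr_ge0// mulr_ge0.
move=> N; rewrite !geq_max => /and3P[HN1 HN2 HN3] f Sf z.
have s0 := snorm_ge0 N f; have w0 := vw_ge0 z.2.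
rewrite /vlasov_rate force_termE transportE -sumrB; apply: (le_trans (ler_norm_sum _ _ _)).
apply: (@le_trans _ _ (\sum_(i < d) (C1 * C2 + C3) * (snorm N f + snorm N f ^+ 2) * vw z.2)).
  apply: ler_sum => i _; apply: (le_trans (ler_normB _ _)).
  have B1 := H1 N HN1 f Sf i z.1; have B2 := H2 N HN2 f Sf i z; have B3 := H3 N HN3 f Sf i z.
  apply: (@le_trans _ _ (C1 * snorm N f * (C2 * snorm N f * vw z.2) + C3 * snorm N f * vw z.2)).
    by apply: lerD => //; rewrite normrM; exact: ler_pM.
  move: (snorm N f) (vw z.2) s0 w0 => s w s0 w0.
  rewrite -subr_ge0 (_ : _ - _ = (C1 * C2 * s + C3 * s ^+ 2) * w); last by ring.
  by rewrite mulr_ge0// addr_ge0// !mulr_ge0// sqr_ge0.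
rewrite sumr_const card_ord; move: (_ + snorm N f ^+ 2) (vw _) => s w.
by rewrite (_ : d%:R * _ * s * w = ((C1 * C2 + C3) * s * w) *+ d)// -[RHS]mulr_natl; ring.
Qed.

(** The force term is a velocity derivative, and the transport term integrates in [v] to the
    divergence of the current. *)
Lemma vlasov_rate_int f : smooth f -> \int[phase_measure d]_z vlasov_rate f z = 0.
Proof.
move=> Sf; have [A1 I1] := phase_force (torus_cst 1) Sf.
have A2 : admissible (fun z => \sum_i term [:: i] [:: i] [::] f z).
  by apply: admissible_sum => i _; exact: term_admissible.
have T1 (i : 'I_d) : torus_smooth (fun _ : V => 1 : R) := torus_cst 1.
transitivity (\int[phase_measure d]_z (1 * (\sum_i partial i (potential f) z.1 * dV i f z) -
    \sum_i term [:: i] [:: i] [::] f z)).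
  by apply: eq_Rintegral => z _; rewrite mul1r -transportE.
rewrite RintegralB//; [|exact: (phase_integrable A1)|exact: (phase_integrable A2)].
rewrite I1 sub0r; apply/eqP; rewrite oppr_eq0; apply/eqP.
transitivity (\int[phase_measure d]_z \sum_i 1 * term [:: i] [:: i] [::] f z).
  by apply: eq_Rintegral => z _; apply: eq_bigr => i _; rewrite mul1r.
apply: (etrans (phase_term_sum _ (fun i => [:: i]) (fun i => [:: i]) (fun=> [::]) Sf T1)).
apply: big1 => i _; rewrite -[RHS](space_partial i (mterm_torus [:: i] [::] [::] Sf)).
by apply: eq_Rintegral => x _; rewrite mul1r partial_mterm.
Qed.

Lemma vw_admissible (C : R) : admissible (fun z : phase => C * vw z.2).
Proof.
split.
  apply: continuous_scale => z; apply: (@continuous_comp _ _ _ snd (@vw R d)).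
    exact: cvg_snd.
  by apply: weight_continuous; exact: vweight_continuous.
by exists `|C| => z; rewrite normrM [`|vw _|]gtr0_norm ?vw_gt0.
Qed.

Lemma is_derive_total (a b : R) (f : R -> phase -> R) t : vlasov_poisson_solution a b f ->
  a < t < b -> is_derive t (1 : R) (fun s => \int[phase_measure d]_z f s z) 0.
Proof.
move=> [Sf Bf Ef] /andP[at_ tb].
have [C [N [C0 HC]]] := vlasov_rate_bound.
(* A smaller interval around [t], on whose closure the norms of the solution are bounded; the bound
   [M] yields a majorant independent of time. *)
pose u := (a + t) / 2; pose v := (t + b) / 2.
have au : a < u by rewrite /u; lra.
have ut : u < t by rewrite /u; lra.
have tv : t < v by rewrite /v; lra.
have vb : v < b by rewrite /v; lra.
have [M HM] := Bf N u v au vb.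
have Iab x : `]u, v[%classic x -> a < x < b.
  by rewrite /= in_itv/= => /andP[ux xv]; rewrite (lt_trans au ux) (lt_trans xv vb).
have HMI x : `]u, v[%classic x -> snorm N (f x) <= M.
  by rewrite /= in_itv/= => /andP[ux xv]; apply: HM; rewrite !ltW.
have tI : `]u, v[%classic t by rewrite /= in_itv/= ut tv.
have M0 : 0 <= M := le_trans (snorm_ge0 _ _) (HMI t tI).
have rate x z : `]u, v[%classic x -> 'D_1 (fun s => f s z) x = vlasov_rate (f x) z.
  move=> xI; have [_ E] := Ef x z (Iab x xI); apply/eqP; rewrite -subr_eq0 -[X in _ == X]E.
  by rewrite /vlasov_rate opprB addrA.
pose G (z : phase) := C * (M + M ^+ 2) * vw z.2.
have intf x : `]u, v[%classic x -> (phase_measure d).-integrable setT (EFin \o f x).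
  by move=> xI; apply: phase_integrable; apply: smooth_admissible; exact/Sf/Iab.
have derf x z : `]u, v[%classic x -> [set: phase] z -> derivable (f ^~ z) x 1.
  by move=> xI _; have [] := Ef x z (Iab x xI).
have G0 z : 0 <= G z.
  by rewrite /G !mulr_ge0 ?vw_ge0// addr_ge0// sqr_ge0.
have intG : (phase_measure d).-integrable setT (EFin \o G).
  by apply: phase_integrable; exact: vw_admissible.
have Gub x z : `]u, v[%classic x -> [set: phase] z -> `|partial1of2 f x z| <= G z.
  move=> xI _; rewrite partial1of2E rate//.
  apply: (le_trans (HC N (leqnn N) _ (Sf _ (Iab x xI)) z)).
  have := HMI x xI; have := snorm_ge0 N (f x); move: (snorm _ _) => s s0 sM.
  rewrite /G ler_wpM2r ?vw_ge0// ler_wpM2l// lerD// ler_sqr//.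
have D := derivable_under_integral measurableT tI intf derf G0 intG Gub.
apply: DeriveDef; first exact: D.
rewrite -derive1E (differentiation_under_integral measurableT tI intf derf G0 intG Gub).
rewrite -[RHS](vlasov_rate_int (Sf t (Iab t tI))); apply: eq_Rintegral => z _.
by rewrite partial1of2E rate.
Qed.

Lemma mass_constant : constant_of_motion (@mass R d).
Proof.
move=> a b f Hf s t.
wlog st : s t / s <= t.
  by move=> H sI tI; have [/H|/ltW/H] := leP s t => H'; [apply: H'|apply/esym/H'].
move=> /andP[as_ sb] /andP[at_ tb]; rewrite /mass; congr (_ * _).
pose F r := \int[phase_measure d]_z f r z.
have dF r : s <= r <= t -> is_derive r (1 : R) F 0.
  move=> /andP[sr rt]; apply: (is_derive_total Hf).
  by rewrite (lt_le_trans as_ sr) (le_lt_trans rt tb).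
have cF : {within `[s, t], continuous F}.
  apply: derivable_within_continuous => r; rewrite in_itv/= => rI.
  by have [] := dF r rI.
have [r|c _] := @MVT_segment R F (fun=> 0) s t st _ cF.
  by rewrite in_itv/= => /andP[sr rt]; apply: dF; rewrite !ltW.
by rewrite mul0r => /eqP; rewrite subr_eq0 => /eqP E; exact: esym E.
Qed.

End conservation_of_mass.

Theorem proposition2p1 (R : realType) (d : nat) (hd : (1 <= d)%N) :
  [/\ (d <= 3)%N ->
        (forall f : 'rV[R]_d * 'rV[R]_d -> R, smooth f ->
           bracket (bracket kinetic electric) electric f =
             2 * mass f * electric f + cubic f) /\
        constant_of_motion (@mass R d),
      d = 1%N ->
        forall f : 'rV[R]_d * 'rV[R]_d -> R, smooth f -> cubic f = 0 &
      forall f : 'rV[R]_d * 'rV[R]_d -> R, smooth f ->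
        [/\ bracket_defined kinetic electric f,
            bracket_defined (bracket kinetic electric) electric f,
            bracket_defined (bracket (bracket kinetic electric) electric)
              electric f &
            bracket (bracket (bracket kinetic electric) electric) electric f
              = 0]].
Proof.
split=> [_|d1|f Sf].
- split; last exact: mass_constant.
  by move=> f Sf; rewrite double_bracket// energy_fluxE.
- by move: hd; rewrite d1 => _ f; exact: cubic_dim1.
- split.
  + exact: bracket_defined_electric (frechet_kinetic Sf) (kinetic_force_admissible Sf).
  + apply: bracket_defined_electric (frechet_bracket_kinetic Sf) _ => //.
    by have [] := bracket_interaction Sf.
  + apply: bracket_defined_electric (frechet_double_bracket Sf) _ => //.
    by have [] := phase_force (flux_derivative_torus Sf) Sf.
  + exact: triple_bracket.
Qed.
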